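(* Every braced triangulation $G=(P,B)$ with $|B|=2$ can be constructed by a sequence of topological vertex splitting moves starting from one of the following five braced triangulations: (I) vertices $1,\dots,6$; $P$ is the octahedron, whose edges are all pairs except $\{1,4\},\{2,5\},\{3,6\}$; $B=\{14,25\}$. (II) vertices $a,t,c,m,h,k$; $P$ has edges $at,tc,ca,am,mc,ha,hm,hc,th,mk,kh,kc$; $B=\{tm,ka\}$. (III) the same $P$ as in (II), with $B=\{tm,tk\}$. (IV) vertices $s_1,s_2,s_3,s_4,v_1,v_2,v_3$; $P$ has edges $s_1s_3,s_3v_2,v_2s_1,s_4v_1,v_1s_2,s_2v_2,s_4s_1,v_1s_1,s_2s_1,s_2s_3,v_1s_3,s_4s_3,s_4v_3,v_3s_1,v_3s_3$; $B=\{v_1v_2,v_1v_3\}$. (V) vertices $s_1,s_2,s_3,s_4,v_1,v_2,v_3$; $P$ has edges $s_1s_3,s_3v_2,v_2s_1,s_4v_1,v_1s_2,s_2v_2,s_4s_1,v_1s_1,s_2s_1,s_2s_3,v_1s_3,s_4v_3,v_3s_1,v_3s_3,v_1v_3$; $B=\{v_1v_2,s_4s_3\}$.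
   Context: A sphere graph is a simple graph with a fixed embedding in the 2-sphere without edge crossings. A (sphere) triangulation $P$ is a maximal sphere graph with at least 3 vertices. An edge $e$ of $P$ is contractible in $P$ if it belongs to precisely two 3-cycles of $P$; then the contraction $P/e$ (with the induced embedding) is again a triangulation. A braced triangulation $G=(P,B)$ is the simple graph obtained from a triangulation $P$ by adjoining a set $B$ of additional edges (braces) joining pairs of vertices non-adjacent in $P$. An edge $e$ of $P$ is contractible in $G$ if $e$ is contractible in $P$ and $e$ does not belong to any 3-cycle of $G$ containing a brace; in that case $(P/e,B)$ is again a braced triangulation. If $G'=(P,B)$ is a braced triangulation and $e$ is an edge of $P$ contractible in $G'$, then $G'$ is said to be obtained from $G=(P/e,B)$ by a topological vertex splitting move. Braced triangulations are identified up to isomorphism (bijections of vertices mapping triangulation edges to triangulation edges and braces to braces). *)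

(* Defs.v *)
From mathcomp Require Import all_boot all_fingroup.

Set Implicit Arguments.
Unset Strict Implicit.
Unset Printing Implicit Defensive.

Definition edges (V : finType) (r : rel V) : {set {set V}} :=
  [set [set p.1; p.2] | p : V * V & r p.1 p.2].

(* In a simple graph a 3-cycle is determined by its vertex set. *)
Definition three_cycles (V : finType) (r : rel V) : {set {set V}} :=
  [set T : {set V} | (#|T| == 3) &&
    [forall x in T, forall y in T, (x != y) ==> r x y]].

(* A crossing-free embedding in the oriented sphere is encoded, up to
   homeomorphism, by its rotation system: [rot x] sends each neighbour of x
   to the next one in the cyclic order around x (its values outside the
   neighbourhood of x are irrelevant). The darts are the ordered pairs
   (x, y) with x and y adjacent, and the boundary walks of the faces are the
   orbits of [next_dart] on them. *)
Definition next_dart (V : finType) (rot : V -> {perm V}) (d : V * V) : V * V :=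
  (d.2, rot d.2 d.1).

(* Genus 0: each connected component satisfies v - e + f = 2. An isolated
   vertex has one face but no dart, hence the third summand. *)
Definition genus0 (V : finType) (adj : rel V) (rot : V -> {perm V}) : Prop :=
  #|V| + fcard (next_dart rot) [pred d : V * V | adj d.1 d.2]
       + #|[set x | [forall y, ~~ adj x y]]|
  = #|edges adj| + 2 * n_comp adj [pred x : V | true].

Record sphere_graph (V : finType) := SphereGraph {
  adj : rel V;
  rot : V -> {perm V};
  adj_sym : symmetric adj;
  adj_irr : irreflexive adj;
  rot_cycle : forall x y z, adj x y -> (z \in porbit (rot x) y) = adj x z;
  sphere_genus0 : genus0 adj rot
}.

(* Q is obtained from P by drawing additional edges: the cyclic order of Q
   around each vertex, with the new neighbours skipped, is that of P. *)
Definition extends (V : finType) (P Q : sphere_graph V) : Prop :=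
  subrel (adj P) (adj Q) /\
  forall x y, adj P x y ->
    exists2 k, rot P x y = iter k.+1 (rot Q x) y
             & forall j, j < k -> ~~ adj P x (iter j.+1 (rot Q x) y).

Definition triangulation (V : finType) (P : sphere_graph V) : Prop :=
  3 <= #|V| /\ forall Q, extends P Q -> subrel (adj Q) (adj P).

(* The data of a braced triangulation up to isomorphism: a set of vertices
   with its triangulation edges and its braces. *)
Record bigraph (V : finType) := BiGraph { tedge : rel V; bedge : rel V }.

Definition isomorphic (V W : finType) (G : bigraph V) (H : bigraph W) : Prop :=
  exists2 f : V -> W, bijective f &
    forall x y, tedge H (f x) (f y) = tedge G x y
             /\ bedge H (f x) (f y) = bedge G x y.

Record braced_triangulation (V : finType) := BracedTriangulation {
  tri : sphere_graph V;
  tri_max : triangulation tri;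
  brace : rel V;
  brace_sym : symmetric brace;
  brace_irr : irreflexive brace;
  brace_nonadj : forall x y, brace x y -> ~~ adj tri x y
}.

Definition to_bigraph (V : finType) (G : braced_triangulation V) : bigraph V :=
  BiGraph (adj (tri G)) (brace G).
Coercion to_bigraph : braced_triangulation >-> bigraph.

Definition contractible_tri (V : finType) (P : sphere_graph V) (u v : V) :=
  adj P u v /\
  #|[set T in three_cycles (adj P) | [set u; v] \subset T]| = 2.

Definition contractible (V : finType) (G : braced_triangulation V) (u v : V) :=
  contractible_tri (tri G) u v /\
  forall T, T \in three_cycles [rel x y | adj (tri G) x y || brace G x y] ->
    [set u; v] \subset T ->
    ~ exists x y, [/\ x \in T, y \in T & brace G x y].

(* Identifying v with u (the resulting vertex is called u), without loops
   and without multiple edges. *)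
Definition contract_rel (V : finType) (u v : V) (r : rel V) :
    rel {x : V | x != v} :=
  fun x y => (x != y) &&
    [|| r (val x) (val y), (val x == u) && r v (val y)
      | (val y == u) && r (val x) v].

Definition contract (V : finType) (G : bigraph V) (u v : V) :
    bigraph {x : V | x != v} :=
  BiGraph (contract_rel u (tedge G)) (contract_rel u (bedge G)).

Definition vertex_splitting (W V : finType)
    (G : braced_triangulation W) (G' : braced_triangulation V) : Prop :=
  exists u v, contractible G' u v /\ isomorphic (contract G' u v) G.

Definition bigraph_of (n : nat) (E B : seq (nat * nat)) : bigraph 'I_n :=
  let r s := fun x y : 'I_n =>
    ((x : nat, y : nat) \in s) || ((y : nat, x : nat) \in s) in
  BiGraph (r E) (r B).

(* The octahedron, with vertex i of {1, ..., 6} encoded as i - 1. *)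
Definition base_I : bigraph 'I_6 :=
  bigraph_of 6
    [seq p <- [seq (i, j) | i <- iota 0 6, j <- iota 0 6]
       | (p.1 < p.2) && (p \notin [:: (0, 3); (1, 4); (2, 5)])]
    [:: (0, 3); (1, 4)].

Definition base_II_III (B : nat -> nat -> nat -> nat -> nat -> nat ->
                            seq (nat * nat)) : bigraph 'I_6 :=
  let a := 0 in let t := 1 in let c := 2 in
  let m := 3 in let h := 4 in let k := 5 in
  bigraph_of 6
    [:: (a, t); (t, c); (c, a); (a, m); (m, c); (h, a);
        (h, m); (h, c); (t, h); (m, k); (k, h); (k, c)]
    (B a t c m h k).

Definition base_II : bigraph 'I_6 :=
  base_II_III (fun a t c m h k => [:: (t, m); (k, a)]).

Definition base_III : bigraph 'I_6 :=
  base_II_III (fun a t c m h k => [:: (t, m); (t, k)]).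

Definition base_IV : bigraph 'I_7 :=
  let s1 := 0 in let s2 := 1 in let s3 := 2 in let s4 := 3 in
  let v1 := 4 in let v2 := 5 in let v3 := 6 in
  bigraph_of 7
    [:: (s1, s3); (s3, v2); (v2, s1); (s4, v1); (v1, s2);
        (s2, v2); (s4, s1); (v1, s1); (s2, s1); (s2, s3);
        (v1, s3); (s4, s3); (s4, v3); (v3, s1); (v3, s3)]
    [:: (v1, v2); (v1, v3)].

Definition base_V : bigraph 'I_7 :=
  let s1 := 0 in let s2 := 1 in let s3 := 2 in let s4 := 3 in
  let v1 := 4 in let v2 := 5 in let v3 := 6 in
  bigraph_of 7
    [:: (s1, s3); (s3, v2); (v2, s1); (s4, v1); (v1, s2);
        (s2, v2); (s4, s1); (v1, s1); (s2, s1); (s2, s3);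
        (v1, s3); (s4, v3); (v3, s1); (v3, s3); (v1, v3)]
    [:: (v1, v2); (s4, s3)].

Definition is_base (V : finType) (G : braced_triangulation V) : Prop :=
  isomorphic base_I G \/ isomorphic base_II G \/ isomorphic base_III G \/
  isomorphic base_IV G \/ isomorphic base_V G.

Inductive constructible :
    forall V : finType, braced_triangulation V -> Prop :=
| constructible_base (V : finType) (G : braced_triangulation V) :
    is_base G -> constructible G
| constructible_split (W V : finType)
    (G : braced_triangulation W) (G' : braced_triangulation V) :
    constructible G -> vertex_splitting G G' -> constructible G'.

(* Main.v *)
(* In a sphere graph that cannot be extended all faces are triangles: two
   non-adjacent corners of a face, or of two components, could be joined, and
   if the corners of a longer face were pairwise adjacent there would be two
   crossing diagonals outside it. That diagonals cross, and that a non-facial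
   3-cycle separates, both follow from one fact: on the sphere every even set
   of edges bounds a set of faces. Contracting an edge that lies in exactly
   two 3-cycles deletes two faces and preserves the Euler characteristic, so by
   induction it remains to classify the irreducible braced triangulations,
   where every edge lies in a separating 3-cycle or in a 3-cycle with a brace.
   - Take a separating 3-cycle whose side A is minimal. The edges meeting A lie
     in no separating 3-cycle, so each of them is in a 3-cycle with a brace and
     has a brace end. As the opposite side also contains a brace end, at most
     three are left for A, and counting degrees forces A to be a single vertex
     of degree 3 which is a brace end.
   - If no 3-cycle separates, all edges have a brace end, and the graph is the
     octahedron (I).
   - Otherwise each side of every separating 3-cycle contains a vertex of
     degree 3. If two such vertices p, p' form a brace, the graph is (III).
   - If not, the braces are pq and p'q' with q adjacent to all neighbours of p,
     and q' to those of p'. Every separating 3-cycle separates p from p'; an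
     innermost one through a given vertex w, seen from p, has w joined to its
     p-side only by edges of 3-cycles with braces. Hence all vertices are in the
     two cliques on q, N(p) and on q', N(p'), or equal to p or p', and
     (II), (IV), (V) are the only ways in which the two cliques can overlap. *)

From mathcomp Require Import all_boot all_fingroup.
From mathcomp Require Import ssralg zmodp matrix mxalgebra zify.
From Stdlib Require Import Classical_Prop.
Require Import Defs.

Set Implicit Arguments.
Unset Strict Implicit.
Unset Printing Implicit Defensive.

(** * Darts and edges of a finite graph *)

Section Darts.

Variables (V : finType) (e : rel V).

Definition dart : pred (V * V) := fun d => e d.1 d.2.

Definition dart_edge (d : V * V) : {set V} := [set d.1; d.2].

Lemma next_dart_inj (r : V -> {perm V}) : injective (next_dart r).
Proof. by move=> [x y] [x' y'] [<- /perm_inj ->]. Qed.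

Lemma edgesP (E : {set V}) :
  reflect (exists x y, e x y /\ E = [set x; y]) (E \in edges e).
Proof.
apply: (iffP imsetP) => [[[x y]]|[x [y [exy ->]]]]; last by exists (x, y); rewrite ?inE.
by rewrite inE => exy ->; exists x, y.
Qed.

Lemma set2_eq (x y x' y' : V) : [set x; y] = [set x'; y'] ->
  (x = x' /\ y = y') \/ (x = y' /\ y = x').
Proof.
move=> E; have := set21 x y; have := set22 x y; rewrite E !inE.
move=> /orP[]/eqP ? /orP[]/eqP ?; subst; auto.
  by have := set22 x' y'; rewrite -E !inE orbb => /eqP ->; auto.
by have := set21 x' y'; rewrite -E !inE orbb => /eqP ->; auto.
Qed.

Hypothesis e_sym : symmetric e.

Lemma mem_edges x y : ([set x; y] \in edges e) = e x y.
Proof.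
apply/edgesP/idP => [[x' [y' [exy /set2_eq]]]|exy]; last by exists x, y.
by case=> [[-> ->]//|[-> ->]]; rewrite e_sym.
Qed.

Hypothesis e_irr : irreflexive e.

Lemma edge_neq x y : e x y -> x != y.
Proof. by case: eqP => // ->; rewrite e_irr. Qed.

(** The map from darts to edges is two-to-one, since a loopless edge has two orientations. *)
Lemma card_darts : #|dart| = 2 * #|edges e|.
Proof.
have -> : edges e = dart_edge @: dart.
  apply/setP => E; apply/edgesP/imsetP => [[x [y [exy ->]]]|[[x y] exy ->]].
    by exists (x, y).
  by exists x, y.
transitivity (\sum_(d in dart) 1); first by rewrite sum1_card.
rewrite (partition_big_imset dart_edge) /= mulnC -sum_nat_const.
apply: eq_bigr => E /imsetP[[x y] exy ->].
rewrite sum1_card -[RHS](_ : #|[set (x, y); (y, x)]| = 2); last first.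
  by rewrite cards2 xpair_eqE negb_and (edge_neq exy).
apply: eq_card => -[x' y']; rewrite !inE /= !xpair_eqE.
apply/andP/idP => [[exy' /eqP/set2_eq[] /= [-> ->]]|]; rewrite ?eqxx ?orbT //.
case/orP=> /andP[/eqP-> /eqP->]; first by [].
by rewrite -[_ \in _]/(e y x) e_sym /dart_edge setUC.
Qed.

End Darts.

(** * Even sets of edges bound *)

Section FaceColouring.

Import GRing.Theory.
Local Open Scope ring_scope.

Variables (V : finType) (e : rel V) (r : V -> {perm V}).
Hypotheses (e_sym : symmetric e) (e_irr : irreflexive e).
Hypothesis r_cycle : forall x y z, e x y -> (z \in porbit (r x) y) = e x z.
Hypothesis e_conn : forall x y, connect e x y.
Hypothesis euler :
  (#|V| + fcard (next_dart r) (dart e) = #|edges e| + 2)%N.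

Let phi := next_dart r.
Let D := dart e.

Lemma dart_next d : D (phi d) = D d.
Proof.
case: d => x y; rewrite /D /phi /dart /next_dart /= (e_sym x).
have := mem_porbit (r y) 1 x; rewrite expg1 => H.
apply/idP/idP => [h|/r_cycle <- //].
by rewrite -(r_cycle _ h) porbit_sym.
Qed.

Lemma dart_fclosed : fclosed phi D.
Proof. by move=> d d' /eqP <-; rewrite -!topredE /= dart_next. Qed.

Let froot_next d : fingraph.root (frel phi) (phi d) = fingraph.root (frel phi) d.
Proof.
apply/esym/fingraph.rootP; first exact: fconnect_sym (@next_dart_inj _ _).
exact: fconnect1.
Qed.

Let F2_double (x : 'F_2) : x + x = 0.
Proof. by apply: val_inj; case: x => [[|[|]]]. Qed.

Let F2_opp (x : 'F_2) : - x = x.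
Proof. by apply: val_inj; case: x => [[|[|]]]. Qed.

Let F2_bool (x : 'F_2) : x = (x != 0)%:R.
Proof. by apply: val_inj; case: x => [[|[|]]]. Qed.

(** Each face is represented by the canonical root of its orbit of darts. *)
Let FS := [set d in D | froots phi d].
Let ES := edges e.
Let froot d := fingraph.root (frel phi) d.

Let card_FS : #|FS| = fcard phi D.
Proof.
rewrite /FS cardsE /n_comp_mem; apply: eq_card => d.
by rewrite !inE /= andbC.
Qed.

(** Edge-vertex incidence over F_2; its row kernel consists of the even edge sets. *)
Let M1 : 'M['F_2]_(#|ES|, #|[set: V]|) :=
  \matrix_(i < #|ES|, j < #|[set: V]|) (enum_val j \in enum_val i)%:R.
(** Face-edge incidence over F_2. Darts are counted, so an edge with the same face on both sides
    gets the entry 0. *)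
Let M2 : 'M['F_2]_(#|FS|, #|ES|) :=
  \matrix_(i < #|FS|, j < #|ES|) \sum_(d in D | froot d == enum_val i) (dart_edge d ==
    enum_val j)%:R.

Let vertex_vec (s : 'rV['F_2]_#|[set: V]|) (x : V) : 'F_2 := s 0 (enum_rank_in (in_setT x) x).

Let vertex_vecE (s : 'rV['F_2]_#|[set: V]|) j : s 0 j = vertex_vec s (enum_val j).
Proof. by rewrite /vertex_vec enum_valK_in. Qed.

Let M1_mul (s : 'rV['F_2]_#|[set: V]|) (E : 'I_#|ES|) x y : e x y -> enum_val E = [set x; y] ->
  (s *m M1^T) 0 E = vertex_vec s x + vertex_vec s y.
Proof.
move=> exy EE; rewrite mxE.
under eq_bigr => j _ do rewrite !mxE EE vertex_vecE.
rewrite -(big_enum_val (fun z => vertex_vec s z * (z \in [set x; y])%:R)) /=.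
rewrite (bigD1 x (in_setT x)) (bigD1 y) /=; last first.
  by rewrite -[X in X && _]/(y \in setT) in_setT eq_sym (edge_neq e_irr).
rewrite set21 set22 !mulr1 big1 ?addr0 // => z /andP[/andP[_ /negPf zx] /negPf zy].
by rewrite !inE zx zy mulr0.
Qed.

(** The colour that [k] gives to the face of [d]. For a dart the sum has exactly one term. *)
Let face_vec (k : 'rV['F_2]_#|FS|) (d : V * V) : 'F_2 :=
  \sum_(i < #|FS| | froot d == enum_val i) k 0 i.

Let M2_mul (k : 'rV['F_2]_#|FS|) (E : 'I_#|ES|) x y : e x y -> enum_val E = [set x; y] ->
  (k *m M2) 0 E = face_vec k (x, y) + face_vec k (y, x).
Proof.
move=> exy EE; rewrite mxE.
under eq_bigr => i _ do rewrite !mxE EE mulr_sumr.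
rewrite (exchange_big_dep D) /=; last by move=> ? d _ /andP[].
rewrite (bigD1 (x, y)) //= (bigD1 (y, x)) /=; last first.
  by rewrite /D /dart /= e_sym exy xpair_eqE negb_and (edge_neq e_irr) // e_sym.
rewrite [X in _ + (_ + X)]big1 ?addr0; last first.
  move=> -[x' y'] /andP[/andP[Dd d1] d2]; apply: big1 => i _.
  case: eqP => [/set2_eq|_]; last by rewrite mulr0.
  by case=> -[xE yE]; move: d1 d2; rewrite /= in xE yE; rewrite xE yE eqxx.
rewrite /dart_edge /= [[set y; x]]setUC eqxx /face_vec; congr (_ + _).
  by apply: eq_big => [i|i _]; rewrite ?mulr1 // -[_ \in _]/(e x y) exy.
by apply: eq_big => [i|i _]; rewrite ?mulr1 // -[_ \in _]/(e y x) e_sym exy.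
Qed.

Let edge_index x y (exy : e x y) : exists E : 'I_#|ES|, enum_val E = [set x; y].
Proof.
have xyE : [set x; y] \in ES by rewrite mem_edges.
by exists (enum_rank_in xyE [set x; y]); rewrite enum_rankK_in.
Qed.

Let M2M1 : M2 *m M1 = 0.
Proof.
apply/matrixP => i j; rewrite !mxE.
under eq_bigr => E _ do rewrite !mxE mulr_suml.
rewrite (exchange_big_dep (fun d => (d \in D) && (froot d == enum_val i))) //=.
set x := enum_val j.
transitivity (\sum_(d in D | froot d == enum_val i)
   ((d.1 == x)%:R + (d.2 == x)%:R : 'F_2)).
  apply: eq_bigr => -[y z] cond; have eyz : e y z by case/andP: cond.
  have [E EE] := edge_index eyz.
  rewrite (bigD1 E cond) /= EE eqxx mul1r big1 ?addr0; last first.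
    move=> E' /andP[_ nE]; rewrite /dart_edge /= -EE.
    by case: eqP => [/enum_val_inj E_|]; rewrite ?mul0r //; rewrite E_ eqxx in nE.
  rewrite !inE ![x == _]eq_sym; case: eqP => [yx|_] /=; last by rewrite add0r.
  by case: eqP => [zx|_]; rewrite ?addr0 //; move: eyz; rewrite yx zx e_irr.
rewrite big_split /=.
(* The tail of [phi d] is the head of [d], so a face boundary meets [x] equally often as a tail and
   as a head. *)
rewrite (reindex_inj (@next_dart_inj _ r)) /=.
under eq_bigl => d do rewrite -/phi -topredE /= -/D dart_next /froot froot_next.
exact: F2_double.
Qed.

(** A vertex vector in the kernel of the transpose is equal at the ends of every edge, hence
    constant by connectedness. *)
Let M1_rank : (#|V| <= \rank M1 + 1)%N.
Proof.
have H : (kermx M1^T <= (const_mx 1 : 'rV_#|[set: V]|))%MS.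
  apply/row_subP => i; 
  have : row i (kermx M1^T) *m M1^T = 0 by apply/sub_kermxP; exact: row_sub.
  move: (row i _) => s sM.
  have sE x y : e x y -> vertex_vec s x = vertex_vec s y.
    move=> exy; have [E EE] := edge_index exy.
    have /eqP := M1_mul s exy EE; rewrite sM mxE eq_sym addr_eq0 F2_opp.
    by move/eqP.
  have sC x y : vertex_vec s x = vertex_vec s y.
    have /connectP[p] := e_conn x y; elim: p x => /= [|z p IH] x; first by move=> _ ->.
    by case/andP=> /sE -> /IH h /h.
  case: (pickP 'I_#|[set: V]|) => [j0 _|nj]; last first.
    suff -> : s = 0 by exact: sub0mx.
    by apply/rowP => j; have := nj j.
  apply/submxP; exists (s 0 j0)%:M; apply/rowP => j.
  rewrite [RHS]mxE big_ord1 !mxE eqxx mulr1.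
  by rewrite vertex_vecE [RHS]vertex_vecE.
have := leq_trans (mxrankS H) (rank_leq_row _).
rewrite mxrank_ker mxrank_tr; move: (\rank M1) (cardsT V); lia.
Qed.

(** Face colours with zero boundary agree across every edge, hence around every vertex, hence
    everywhere: there is at most one relation among the face boundaries. *)
Let M2_rank : (#|FS| <= \rank M2 + 1)%N.
Proof.
have H : (kermx M2 <= (const_mx 1 : 'rV_#|FS|))%MS.
  apply/row_subP => i; 
  have : row i (kermx M2) *m M2 = 0 by apply/sub_kermxP; exact: row_sub.
  move: (row i _) => k kM.
  have kE x y : e x y -> face_vec k (x, y) = face_vec k (y, x).
    move=> exy; have [E EE] := edge_index exy.
    have /eqP := M2_mul k exy EE; rewrite kM mxE eq_sym addr_eq0 F2_opp.
    by move/eqP.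
  have kphi d : face_vec k (phi d) = face_vec k d.
    by apply: eq_bigl => j; rewrite /froot froot_next.
  have kx x y z : e x y -> e x z -> face_vec k (y, x) = face_vec k (z, x).
    move=> exy; rewrite -(r_cycle _ exy) => /porbitP[m ->].
    elim: m => [|m IH]; first by rewrite expg0 perm1.
    rewrite expgSr permM; set w := ((r x ^+ m)%g y) in IH *.
    have exw : e x w by rewrite -(r_cycle _ exy) mem_porbit.
    have exw' : e x (r x w).
      have := mem_porbit (r x) 1 w; rewrite expg1 => h; by rewrite -(r_cycle _ exw).
    by rewrite IH -(kE _ _ exw') -(kphi (w, x)).
  have kC d d' : D d -> D d' -> face_vec k d = face_vec k d'.
    case: d d' => x y [x' y'] exy exy'; rewrite /D /dart /= in exy exy'.
    have /connectP[p] := e_conn x x'; elim: p x y exy => /= [|z p IH] x y exy.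
      by move=> _ E; subst; rewrite kE // [RHS]kE //; apply: kx.
    case/andP=> exz zp /(IH z x _ zp) <-; last by rewrite e_sym.
    by rewrite kE //; apply: kx.
  have kk j : k 0 j = face_vec k (enum_val j).
    have := enum_valP j; rewrite inE => /andP[_ /eqP h].
    rewrite /face_vec (big_pred1 j) // => j'; rewrite /froot h.
    by apply/eqP/eqP => [/enum_val_inj|->].
  case: (pickP 'I_#|FS|) => [j0 _|nj]; last first.
    suff -> : k = 0 by exact: sub0mx.
    by apply/rowP => j; have := nj j.
  apply/submxP; exists (k 0 j0)%:M; apply/rowP => j.
  rewrite [RHS]mxE big_ord1 !mxE eqxx mulr1 kk [RHS]kk; apply: kC.
    by have := enum_valP j; rewrite inE => /andP[].
  by have := enum_valP j0; rewrite inE => /andP[].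
have := leq_trans (mxrankS H) (rank_leq_row _).
rewrite mxrank_ker; lia.
Qed.

(* Over F_2 the even edge sets and the sums of face boundaries both form a
   space of dimension e - v + 1 = f - 1. *)
Lemma even_set_colouring (c : rel V) : symmetric c ->
  (forall x, ~~ odd #|[set y | e x y && c x y]|) ->
  exists k : rel V, (forall x y, e x y -> k x y = k y (r y x)) /\
                    (forall x y, e x y -> c x y = k x y (+) k y x).
Proof.
move=> c_sym c_even.
pose cE (E : {set V}) := [exists d, [&& D d, dart_edge d == E & c d.1 d.2]].
have cEE x y : e x y -> cE [set x; y] = c x y.
  move=> exy; apply/existsP/idP => [[[x' y']] /= /and3P[_ /eqP/set2_eq /= h]|cxy].
    by case: h => [] [-> ->] //; rewrite c_sym.
  by exists (x, y); rewrite /D /dart /= exy eqxx.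
pose cv : 'rV['F_2]_#|ES| := \row_(E < #|ES|) (cE (enum_val E))%:R.
have cM : cv *m M1 = 0.
  apply/rowP => j; rewrite !mxE; set x := enum_val j.
  under eq_bigr => E _ do rewrite !mxE.
  rewrite -(big_enum_val (fun E => (cE E)%:R * (enum_val j \in E)%:R)) /= -/x.
  rewrite (bigID (fun E : {set V} => x \in E)) /= [X in _ + X]big1 ?addr0; last first.
    by move=> E /andP[_ /negPf ->]; rewrite mulr0.
  have -> : \sum_(E in ES | x \in E) ((cE E)%:R * (x \in E)%:R : 'F_2)
    = \sum_(E in (fun y => [set x; y]) @: [set y | e x y]) (cE E)%:R.
    apply: eq_big => [E|E /andP[_ ->]]; last by rewrite mulr1.
    apply/andP/imsetP => [[/edgesP[y [z [eyz ->]]]]|[y]].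
      rewrite !inE => /orP[]/eqP ->; [exists z|exists y] => //; rewrite ?inE //.
        by rewrite e_sym.
      by rewrite setUC.
    by rewrite inE => exy ->; rewrite mem_edges // !inE eqxx.
  rewrite big_imset /=; last first.
    move=> y z; rewrite !inE => exy exz /set2_eq[] [_ //] yx.
    by rewrite yx e_irr in exy.
  transitivity (\sum_(y in [set y | e x y && c x y]) (1 : 'F_2)).
    rewrite big_mkcond /= [RHS]big_mkcond /=; apply: eq_bigr => y _; rewrite !inE.
    by case: ifP => //= exy; rewrite cEE //; case: (c x y).
  rewrite sumr_const.
  have [m ->] : exists m, #|[set y | e x y && c x y]| = (m + m)%N.
    by exists (#|[set y | e x y && c x y]|./2); rewrite addnn even_halfK.
  by rewrite mulrnDr F2_double.
have sub : (M2 <= kermx M1)%MS by apply/sub_kermxP; exact: M2M1.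
have eqr : (kermx M1 <= M2)%MS.
  rewrite -(geq_leqif (mxrank_leqif_sup sub)) mxrank_ker.
  move: (\rank M1) (\rank M2) M1_rank M2_rank card_FS euler; rewrite -/phi -/D -/ES; lia.
have /submxP[k kE] : (cv <= M2)%MS by apply: submx_trans eqr; apply/sub_kermxP.
exists (fun x y => face_vec k (x, y) != 0); split.
  move=> x y exy; rewrite (_ : (y, r y x) = phi (x, y)) //; congr (_ != _).
  by apply: eq_bigl => i; rewrite /froot froot_next.
move=> x y exy; have [E EE] := edge_index exy.
have := M2_mul k exy EE; rewrite -kE mxE EE cEE //.
move: (face_vec k _) (face_vec k _) => a b.
rewrite [in X in X -> _](F2_bool a) [in X in X -> _](F2_bool b).
by case: (a == 0); case: (b == 0); case: (c x y).
Qed.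

End FaceColouring.

(** * Adding an edge *)

Section Permutations.

Variable T : finType.
Implicit Types s : {perm T}.

Lemma porbit1 s x : s x \in porbit s x.
Proof. by have := mem_porbit s 1 x; rewrite expg1. Qed.

Lemma porbit_closed s (I : pred T) x :
  (forall d, d \in porbit s x -> I d -> I (s d)) -> I x ->
  forall d, d \in porbit s x -> I d.
Proof.
move=> cl Ix d /porbitP[i ->]; elim: i => [|i IH]; first by rewrite expg0 perm1.
by rewrite expgSr permM; apply: cl => //; exact: mem_porbit.
Qed.

Lemma porbit_fconnect s x y : (y \in porbit s x) = fconnect s x y.
Proof.
apply/porbitP/idP => [[i ->]|/iter_findex <-]; first by rewrite permX fconnect_iter.
by exists (findex s x y); rewrite permX.
Qed.

Lemma porbit_trans s x y z : y \in porbit s x -> z \in porbit s y -> z \in porbit s x.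
Proof. by rewrite !porbit_fconnect; exact: connect_trans. Qed.

(* [tperm y n * s] is [s] with its fixed point [n] inserted after [y] into its
   cycle [N]. *)
Lemma porbit_insert s (N : pred T) n y :
  (forall z, ~~ N z -> s z = z) ->
  (forall a b, N a -> (b \in porbit s a) = N b) ->
  ~~ N n -> (if [forall z, ~~ N z] then y = n else N y) ->
  forall a b, N a || (a == n) ->
    (b \in porbit (tperm y n * s) a) = N b || (b == n).
Proof.
move=> sfix sN Nn yP; set s' := (tperm y n * s)%g.
have sNcl z : N z -> N (s z) by move=> Nz; rewrite -(sN _ _ Nz) porbit1.
have s'y : s' y = n.
  rewrite permM tpermL; exact: sfix.
have s'D z : z != y -> z != n -> s' z = s z.
  by move=> zy zn; rewrite permM tpermD // eq_sym.
have s'n : s' n = s y by rewrite permM tpermR.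
have cl z : N z || (z == n) -> N (s' z) || (s' z == n).
  have [->|zy] := eqVneq z y; first by rewrite s'y eqxx orbT.
  have [->|zn] := eqVneq z n; last by rewrite orbF s'D // => /sNcl ->.
  rewrite s'n; case: ifP yP => [_ ->|_ /sNcl -> //].
  by rewrite sfix // eqxx orbT.
have all_n b : N b || (b == n) -> b \in porbit s' n.
  case/orP=> [Nb|/eqP ->]; last exact: porbit_id.
  case: ifP yP => [/forallP/(_ b)|_ Ny]; first by rewrite Nb.
  have yO : y \in porbit s' n by rewrite porbit_sym -s'y porbit1.
  apply: (@porbit_closed s (mem (porbit s' n)) y) => //; last by rewrite sN.
  move=> d; rewrite sN // => Nd dO.
  have [->|dy] := eqVneq d y; first by rewrite /= -s'n porbit1.
  rewrite /= -s'D //; last by apply: contraNneq Nn => <-.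
  exact: porbit_trans dO (porbit1 _ _).
move=> a b aN; apply/idP/idP => [|/all_n bn].
  exact: (@porbit_closed s' (fun z => N z || (z == n)) a (fun d _ => @cl d) aN b).
by apply: porbit_trans bn; rewrite porbit_sym all_n.
Qed.

End Permutations.

(** Both images are in bijection with the image of the pair [(f, g)]. *)
Lemma card_imset_ker (A B C : finType) (f : A -> B) (g : A -> C) (D : {pred A}) :
  {in D &, forall x y, f x = f y <-> g x = g y} -> #|f @: D| = #|g @: D|.
Proof.
move=> fg; pose h x := (f x, g x).
have -> : f @: D = fst @: (h @: D) by rewrite -imset_comp; apply: eq_imset.
have -> : g @: D = snd @: (h @: D) by rewrite -imset_comp; apply: eq_imset.
rewrite (card_in_imset (f := fst)); last first.
  move=> _ _ /imsetP[x Dx ->] /imsetP[y Dy ->] /= E.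
  by rewrite /h E (fg x y Dx Dy).1.
rewrite (card_in_imset (f := snd)) // => _ _ /imsetP[x Dx ->] /imsetP[y Dy ->] /= E.
by rewrite /h E (fg x y Dx Dy).2.
Qed.

Section OrbitCount.

Variables (T : finType) (f : T -> T) (D : {pred T}) (n : nat).
Hypotheses (f_inj : injective f) (D_closed : fclosed f D).

Lemma card_froot : #|fingraph.root (frel f) @: D| = fcard f D.
Proof.
apply: eq_card => d; apply/imsetP/andP => [[d' Dd' ->]|[/eqP rd Dd]]; last by exists d.
split; first exact: (roots_root (fconnect_sym f_inj)).
rewrite -[X in is_true X]/(_ \in D).
by rewrite -(closed_connect D_closed (connect_root _ d')).
Qed.

Lemma leq_fcard_order : (forall d, d \in D -> n <= fingraph.order f d) -> fcard f D * n <= #|D|.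
Proof.
move=> D_n; rewrite -card_froot -[X in _ <= X]sum1_card (partition_big_imset (fingraph.root
  (frel f))) /=.
rewrite -sum_nat_const; apply: leq_sum => _ /imsetP[d Dd ->].
rewrite sum1_card (leq_trans (D_n d Dd)) // /fingraph.order; apply: subset_leq_card.
apply/subsetP => d' dd'.
have Dd' : d' \in D by rewrite -(closed_connect D_closed dd').
by apply/andP; split=> //; apply/eqP/esym/(fingraph.rootP (fconnect_sym f_inj)).
Qed.

End OrbitCount.

(** * Faces as orbits on all pairs of vertices *)

Section FacePerm.

Variables (V : finType) (e : rel V) (r : V -> {perm V}).
Hypotheses (e_sym : symmetric e) (e_irr : irreflexive e).
Hypothesis r_cycle : forall x y z, e x y -> (z \in porbit (r x) y) = e x z.
Hypothesis r_fix : forall x z, ~~ e x z -> r x z = z.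

(** It acts on all pairs and not only on darts, so that adding an edge changes the permutation but
    not the set on which it acts. *)
Definition face_perm : {perm V * V} := perm (@next_dart_inj V r).

Lemma face_permE d : face_perm d = next_dart r d.
Proof. exact: permE. Qed.

Lemma nondart_orbit x y d : ~~ e x y ->
  (d \in porbit face_perm (x, y)) = (d == (x, y)) || (d == (y, x)).
Proof.
move=> nxy; have nyx : ~~ e y x by rewrite e_sym.
apply/idP/orP => [|[]/eqP ->]; first last.
- by have := porbit1 face_perm (x, y); rewrite face_permE /next_dart /= r_fix.
- exact: porbit_id.
move=> h; apply/orP.
apply: (@porbit_closed _ face_perm (fun d => (d == (x, y)) || (d == (y, x))) (x, y));
  rewrite ?eqxx //.
move=> _ _ /orP[]/eqP ->; rewrite face_permE /next_dart /= r_fix ?eqxx ?orbT //.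
Qed.

(* If [r] fixes the non-neighbours, each pair of non-adjacent, possibly equal
   vertices contributes one orbit of non-darts. *)
Lemma card_porbits_face :
  #|porbits face_perm| + #|edges e| =
  fcard (next_dart r) (dart e) + #|edges (fun _ _ : V => true)|.
Proof.
pose D := [set d | dart e d].
have Dcl := dart_fclosed e_sym r_cycle.
have fE : frel face_perm =2 frel (next_dart r) by move=> d d'; rewrite /= face_permE.
have pE d d' : (d' \in porbit face_perm d) = fconnect (next_dart r) d d'.
  by rewrite porbit_fconnect (eq_connect fE).
have edE (f : rel V) : edges f = @dart_edge V @: [set d | dart f d].
  apply/setP => E; apply/edgesP/imsetP => [[x [y [exy ->]]]|[[x y]]].
    by exists (x, y); rewrite ?inE.
  by rewrite inE => exy ->; exists x, y.
have -> : #|porbits face_perm| = #|porbit face_perm @: D| + #|porbit face_perm @: ~: D|.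
  rewrite -cardsUI -imsetU setUCr [X in _ + X](_ : _ = 0) ?addn0.
    by apply: eq_card => O; apply/imsetP/imsetP => -[d _ ->]; exists d; rewrite ?inE.
  apply/eqP; rewrite cards_eq0 -subset0; apply/subsetP => O.
  rewrite !inE => /andP[/imsetP[d Dd ->] /imsetP[d' Dd' /setP/(_ d')]].
  rewrite porbit_id pE => /(closed_connect Dcl).
  by move: Dd Dd'; rewrite !inE -!topredE /= => -> /negPf ->.
have -> : #|edges (fun _ _ : V => true)| = #|edges e| + #|@dart_edge V @: ~: D|.
  rewrite !edE -cardsUI -imsetU -/D [X in _ + X](_ : _ = 0) ?addn0.
    by apply: eq_card => E; apply/imsetP/imsetP => -[d _ ->]; exists d; rewrite ?inE //= orbN.
  apply/eqP; rewrite cards_eq0 -subset0; apply/subsetP => E.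
  rewrite !inE => /andP[/imsetP[[x y] Dd ->] /imsetP[[x' y'] Dd' /set2_eq]].
  move: Dd Dd'; rewrite !inE /dart /= => exy nexy.
  by case=> [] [? ?]; subst; rewrite ?exy // e_sym exy in nexy.
have -> : #|porbit face_perm @: ~: D| = #|@dart_edge V @: ~: D|.
  apply: card_imset_ker => -[x y] [x' y']; rewrite !inE /dart /= => n1 n2; split.
    move/setP/(_ (x, y)); rewrite porbit_id nondart_orbit // => /esym/orP[]/eqP[-> ->] //.
    by rewrite /dart_edge setUC.
  case/set2_eq => -[/= -> ->] //; apply/eqP; rewrite eq_porbit_mem nondart_orbit //.
  by rewrite eqxx orbT.
have -> : #|porbit face_perm @: D| = fcard (next_dart r) (dart e).
  have symf := fconnect_sym (@next_dart_inj V r).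
  rewrite (card_imset_ker (g := fingraph.root (frel (next_dart r)))).
    rewrite -(card_froot (@next_dart_inj V r) Dcl); apply: eq_card => E.
    by apply/imsetP/imsetP => -[d Dd ->]; exists d; move: Dd; rewrite ?inE.
  move=> d d' _ _; split.
    by move/setP/(_ d'); rewrite porbit_id pE => h; apply/(fingraph.rootP symf).
  by move/(fingraph.rootP symf) => h; apply/esym/eqP; rewrite eq_porbit_mem pE.
lia.
Qed.

End FacePerm.

(** Defined for every [f], with the identity as default value where [f] is not injective. *)
Definition fun_perm (T : finType) (f : T -> T) : {perm T} :=
  if injectiveP f is ReflectT f_inj then perm f_inj else 1%g.

Lemma fun_permE (T : finType) (f : T -> T) : injective f -> fun_perm f =1 f.
Proof. by rewrite /fun_perm; case: injectiveP => // f_inj _ x; rewrite permE. Qed.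

Lemma eq_in_fcard (T : finType) (f g : T -> T) (D : {pred T}) :
  {in D, f =1 g} -> {homo f : x / x \in D} -> fcard f D = fcard g D.
Proof.
move=> fg Df.
have it x i : x \in D -> iter i f x \in D /\ iter i f x = iter i g x.
  by move=> Dx; elim: i => //= i [Di <-]; rewrite fg // -fg //; split=> //; exact: Df.
have fc x : x \in D -> fconnect f x =1 fconnect g x.
  move=> Dx y; apply/idP/idP => /iter_findex <-.
    by rewrite (it _ _ Dx).2 fconnect_iter.
  by rewrite -(it _ _ Dx).2 fconnect_iter.
apply: eq_card => x; rewrite !inE; case Dx: (x \in D); rewrite /= ?Dx ?andbF ?andbT //.
by rewrite /roots /fingraph.root (eq_pick (fc x Dx)).
Qed.

Section Graph.

Variables (V : finType) (P : sphere_graph V).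

Let e := adj P.
Let e_sym : symmetric e := @adj_sym _ P.
Let e_irr : irreflexive e := @adj_irr _ P.

Lemma adj_rot x y : adj P x y -> adj P x (rot P x y).
Proof. by move=> exy; rewrite -(rot_cycle _ exy) porbit1. Qed.

(** Fixing the non-neighbours lets a new neighbour be inserted by a transposition and makes the
    non-darts contribute a known number of orbits. *)
Lemma normal_rotation : exists r : V -> {perm V},
  [/\ forall x y, adj P x y -> r x y = rot P x y,
      forall x y, ~~ adj P x y -> r x y = y,
      forall x y z, adj P x y -> (z \in porbit (r x) y) = adj P x z &
      genus0 (adj P) r].
Proof.
pose f x z := if adj P x z then rot P x z else z.
have f_inj x : injective (f x).
  move=> y z; rewrite /f; case: ifP => xy; case: ifP => xz //; first exact: perm_inj.
    by move=> E; rewrite -E adj_rot in xz.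
  by move=> E; rewrite E adj_rot in xy.
have fE x y : adj P x y -> fun_perm (f x) y = rot P x y.
  by move=> xy; rewrite fun_permE // /f xy.
exists (fun x => fun_perm (f x)); split=> //.
- by move=> x y /negPf xy; rewrite fun_permE // /f xy.
- move=> x y z xy; rewrite -(rot_cycle z xy).
  have it i : (fun_perm (f x) ^+ i)%g y = (rot P x ^+ i)%g y /\
              adj P x ((rot P x ^+ i)%g y).
    elim: i => [|i [IH xi]]; first by rewrite !expg0 perm1.
    by rewrite !expgSr !permM IH fE //; split=> //; apply: adj_rot.
  by apply/porbitP/porbitP => -[i ->]; exists i; rewrite (it i).1.
- have := sphere_genus0 P; rewrite /genus0.
  rewrite (@eq_in_fcard _ (next_dart (rot P)) (next_dart (fun x => fun_perm (f x)))) //.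
    by move=> -[x y]; rewrite inE /next_dart /= => xy; rewrite fE // adj_sym.
  by move=> -[x y]; rewrite !inE /= => xy; rewrite adj_rot // adj_sym.
Qed.

End Graph.

Section AddEdge.

Variables (V : finType) (e : rel V) (x x' : V).
Hypotheses (e_sym : symmetric e) (e_irr : irreflexive e).
Hypotheses (xx' : x != x') (nxx' : ~~ e x x').

Definition add_edge : rel V :=
  fun y z => [|| e y z, (y == x) && (z == x') | (y == x') && (z == x)].

Lemma add_edge_sym : symmetric add_edge.
Proof.
move=> y z; rewrite /add_edge e_sym; congr (_ || _).
by rewrite orbC; congr orb; rewrite andbC.
Qed.

Lemma add_edge_irr : irreflexive add_edge.
Proof.
move=> y; rewrite /add_edge e_irr andbC orbb; apply/andP => -[/eqP yx' /eqP yx].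
by move: xx'; rewrite -yx -yx' eqxx.
Qed.

Let symC : connect_sym e := sym_connect_sym e_sym.
Let symC' : connect_sym add_edge := sym_connect_sym add_edge_sym.

Lemma connect_add_edge y z : connect e y z -> connect add_edge y z.
Proof. by apply: connect_sub => u w euw; rewrite connect1 // /add_edge euw. Qed.

Lemma n_comp_add_edge :
  n_comp add_edge [pred y : V | true] + ~~ connect e x x' = n_comp e [pred y : V | true].
Proof.
case cxx' : (connect e x x'); rewrite ?addn0.
  apply: eq_n_comp => y z; apply/idP/idP; last exact: connect_add_edge.
  apply: connect_sub => u w /or3P[/connect1//||] /andP[/eqP -> /eqP ->] //.
  by rewrite symC.
have nE (f : rel V) : connect_sym f ->
    n_comp f [pred y : V | true] = #|[set fingraph.root f y | y in [set: V]]|.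
  move=> symf; apply: eq_card => y; apply/andP/imsetP => [[/eqP <- _]|[z _ ->]].
    by exists y; rewrite ?inE // (eqP (roots_root symf y)).
  by split; first exact: roots_root.
(* Component labels after the joining: the component of [x'] takes the label of [x]. *)
pose g y := if connect e y x' then fingraph.root e x else fingraph.root e y.
have gE y z : connect add_edge y z = (g y == g z).
  have step u w : add_edge u w -> g u == g w.
    case/or3P=> [euw||].
    - rewrite /g (same_connect1 symC euw); case: ifP => // _.
      by apply/eqP/(fingraph.rootP symC)/connect1.
    - by case/andP=> /eqP-> /eqP->; rewrite /g cxx' connect0.
    - by case/andP=> /eqP-> /eqP->; rewrite /g cxx' connect0.
  apply/idP/eqP => [/connectP[p]|].
    by elim: p y => /= [|u p IH] y; [move=> _ -> | case/andP=> /step/eqP -> /IH h /h].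
  have x'x : connect add_edge x' x by rewrite connect1 // /add_edge !eqxx !orbT.
  rewrite /g; case: ifP => [/connect_add_edge yx'|_]; case: ifP => [/connect_add_edge zx'|_].
  - by move=> _; apply: connect_trans yx' _; rewrite symC'.
  - move/(fingraph.rootP symC)/connect_add_edge; apply: connect_trans.
    exact: connect_trans yx' x'x.
  - move/(fingraph.rootP symC)/connect_add_edge => yx; apply: connect_trans yx _.
    by rewrite symC'; exact: connect_trans zx' x'x.
  - by move/(fingraph.rootP symC)/connect_add_edge.
rewrite !nE //= (card_imset_ker (g := g)); last first.
  move=> y z _ _; split => [/(fingraph.rootP symC')|/eqP]; first by rewrite gE => /eqP.
  by rewrite -gE => /(fingraph.rootP symC').
have -> : g @: [set: V] = (fingraph.root e @: [set: V]) :\ fingraph.root e x'.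
  apply/setP => y; apply/imsetP/setD1P => [[z _ ->]|[yx' /imsetP[z _ yz]]].
    rewrite /g; case: ifP => zx'; split; rewrite ?imset_f ?inE //.
      by apply: contraFneq cxx' => /(fingraph.rootP symC).
    by apply: contraFneq zx' => /(fingraph.rootP symC).
  exists z => //; rewrite /g; case: ifP => // /(fingraph.rootP symC) E.
  by rewrite yz E eqxx in yx'.
by rewrite [RHS](cardsD1 (fingraph.root e x')) imset_f ?inE // addnC.
Qed.

Variable r : V -> {perm V}.
Hypothesis r_cycle : forall x y z, e x y -> (z \in porbit (r x) y) = e x z.
Hypothesis r_fix : forall x z, ~~ e x z -> r x z = z.
Hypothesis r_genus : genus0 e r.

Variables y y' : V.
(* The corners in which the new edge is drawn; [y = x'] stands for the only
   corner at an isolated vertex [x]. *)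
Hypothesis yP : if [forall z, ~~ e x z] then y = x' else e x y.
Hypothesis y'P : if [forall z, ~~ e x' z] then y' = x else e x' y'.
Hypothesis same_face : connect e x x' ->
  [/\ e x y, e x' y' & (y, x) \in porbit (face_perm r) (y', x')].

Definition add_edge_rot (z : V) : {perm V} :=
  if z == x then (tperm y x' * r x)%g
  else if z == x' then (tperm y' x * r x')%g else r z.

Let nx'x : ~~ e x' x. Proof. by rewrite e_sym. Qed.

Lemma add_edge_rot_cycle a b z :
  add_edge a b -> (z \in porbit (add_edge_rot a) b) = add_edge a z.
Proof.
have e'E w : add_edge x w = e x w || (w == x').
  by rewrite /add_edge eqxx (negPf xx') /= orbF.
have e'E' w : add_edge x' w = e x' w || (w == x).
  by rewrite /add_edge eqxx eq_sym (negPf xx') /=.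
rewrite /add_edge_rot; have [->|ax] := eqVneq a x.
  rewrite !e'E; apply: porbit_insert => // *; first exact: r_fix.
  exact: r_cycle.
have [->|ax'] := eqVneq a x'.
  rewrite !e'E'; apply: porbit_insert => // *; first exact: r_fix.
  exact: r_cycle.
by rewrite /add_edge (negPf ax) (negPf ax') /= !orbF; exact: r_cycle.
Qed.

Lemma add_edge_rot_fix a z : ~~ add_edge a z -> add_edge_rot a z = z.
Proof.
rewrite /add_edge !negb_or !negb_and => /and3P[naz h1 h2]; rewrite /add_edge_rot.
case: ifP => [/eqP ax|_]; last (case: ifP => [/eqP ax|_]; last exact: r_fix).
  subst a; rewrite eqxx /= in h1; rewrite permM tpermD ?r_fix // eq_sym //.
  by apply: contraNneq naz => zy; rewrite zy in h1 *; case: ifP yP => // _ E;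
    rewrite E eqxx in h1.
subst a; rewrite eqxx /= in h2; rewrite permM tpermD ?r_fix // eq_sym //.
by apply: contraNneq naz => zy; rewrite zy in h2 *; case: ifP y'P => // _ E;
  rewrite E eqxx in h2.
Qed.

Let s := face_perm r.
(** The face permutation after the new edge has been inserted at [x'] only. *)
Let s1 : {perm V * V} := (tperm (y', x') (x, x') * s)%g.

Let face_permM : face_perm add_edge_rot = (tperm (y, x) (x', x) * s1)%g.
Proof.
apply/permP => -[u w]; rewrite face_permE /s1 !permM /s face_permE /next_dart /add_edge_rot /=.
have tE (a b c d f : V) : tperm (a, c) (b, c) (d, f) = (if f == c then tperm a b d else d, f).
  have [->|fc] := eqVneq f c; last by rewrite tpermD // xpair_eqE negb_and [c == f]eq_sym fc
    orbT.
  have [->|da] := eqVneq d a; first by rewrite !tpermL.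
  have [->|db] := eqVneq d b; first by rewrite !tpermR.
  by rewrite !tpermD // ?xpair_eqE ?negb_and eq_sym ?da ?db.
rewrite !tE /=; case: (eqVneq w x) => [->|wx] /=.
  by rewrite (negPf xx') /= permM.
by case: (eqVneq w x') => [->|] //=; rewrite permM.
Qed.

Let isolated : {set V} := [set z | [forall w, ~~ e z w]].

Let card_isolated :
  #|[set z | [forall w, ~~ add_edge z w]]| + (x \in isolated) + (x' \in isolated)
  = #|isolated|.
Proof.
rewrite (cardsD1 x isolated) (cardsD1 x' (isolated :\ x)) !inE eq_sym xx' /=.
rewrite -addnA addnC -addnA; congr (_ + (_ + _)); apply: eq_card => z; rewrite !inE.
apply/forallP/and3P => [h|[zx' zx /forallP h] w].
  split; last by apply/forallP => w; move: (h w); rewrite negb_or => /andP[].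
    by apply/eqP => zx'; move: (h x); rewrite /add_edge zx' !eqxx !orbT.
  by apply/eqP => zx; move: (h x'); rewrite /add_edge zx !eqxx !orbT.
by rewrite /add_edge (negPf (h w)) (negPf zx) (negPf zx').
Qed.

(* The face permutation gets multiplied by two transpositions, each of which
   merges or splits orbits. *)
Lemma add_edge_genus : genus0 add_edge add_edge_rot.
Proof.
(* The first transposition merges the orbit of the non-dart [(x, x')] into the face of [(y', x')];
   the second splits this orbit if the ends are connected and merges it with another one if they are
   not. At an isolated end the transposition is trivial. *)
suff H : #|porbits (face_perm add_edge_rot)| + (x \notin isolated) + (x' \notin isolated)
   = #|porbits s| + (connect e x x').*2.
  have := card_porbits_face e_sym r_cycle r_fix.
  have := card_porbits_face add_edge_sym add_edge_rot_cycle add_edge_rot_fix.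
  have gE (f : rel V) q : genus0 f q = (#|V| + fcard (next_dart q) (dart f)
       + #|[set x | [forall y, ~~ f x y]]|
    = #|edges f| + 2 * n_comp f [pred x : V | true]) by [].
  move: H card_isolated n_comp_add_edge r_genus; rewrite !gE -/isolated -/s.
  by case: (connect e x x'); case: (x \in isolated); case: (x' \in isolated) => /=; lia.
have := porbits_mul_tperm s1 (y, x) (x', x).
have := porbits_mul_tperm s (y', x') (x, x').
rewrite /= -face_permM -/s1 !xpair_eqE !eqxx !andbT.
have -> : (x \notin isolated) = (y != x').
  rewrite !inE; case: ifP yP => [_ ->|_ exy]; first by rewrite eqxx.
  by apply/esym; apply: contraTneq exy => ->.
have -> : (x' \notin isolated) = (y' != x).
  rewrite !inE; case: ifP y'P => [_ ->|_ exy]; first by rewrite eqxx.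
  by apply/esym; apply: contraTneq exy => ->.
rewrite /s (nondart_orbit e_sym r_fix _ nxx') !xpair_eqE !eqxx andbT ![x' == x]eq_sym (negPf
  xx') andbF orbF -/s.
have s1F a b : (a, b) != (y', x') -> (a, b) != (x, x') -> s1 (a, b) = (b, r b a).
  by move=> h1 h2; rewrite /s1 permM tpermD 1?eq_sym // /s face_permE.
have s1a : s1 (y', x') = (x', x) by rewrite /s1 permM tpermL /s face_permE /next_dart /= r_fix.
have s1b : s1 (x, x') = s (y', x') by rewrite /s1 permM tpermR.
have [y'x|y'x] := eqVneq y' x.
  have -> : s1 = s by rewrite /s1 y'x tperm1 mul1g.
  have ncon : ~~ connect e x x'.
    by apply: contraNN nx'x => /same_face[_]; rewrite y'x.
  rewrite /s (nondart_orbit e_sym r_fix _ nx'x) !xpair_eqE eqxx (negPf xx') !andbT andbF orbF.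
  by rewrite (negPf ncon); case: (y == x') => /=; lia.
case cxx': (connect e x x').
  have [exy ex'y' inO] := same_face cxx'.
  have yx' : y != x' by apply: contraTneq exy => ->.
  suff -> : (y, x) \in porbit s1 (x', x) by rewrite yx' /=; lia.
  have aO : (y', x') \in porbit s1 (x', x) by rewrite porbit_sym -s1a porbit1.
  have cO : s (y', x') \in porbit s1 (x', x).
    rewrite -s1b; apply: porbit_trans (porbit1 _ _).
    rewrite (_ : (x, x') = s1 (x', x)) ?porbit1 // s1F ?r_fix //.
      by rewrite xpair_eqE negb_and xx' orbT.
    by rewrite xpair_eqE negb_and xx' orbT.
  apply: (@porbit_closed _ s (mem (porbit s1 (x', x))) (y', x')) inO => //.
  move=> [a b] abO abO1.
  have [->//|h1] := eqVneq (a, b) (y', x').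
  rewrite /= {1}/s face_permE /next_dart /= -s1F //;
    first exact: porbit_trans abO1 (porbit1 _ _).
  apply: contraNneq nxx' => -[<- <-].
  have := dart_fclosed e_sym r_cycle; rewrite /s porbit_fconnect in abO.
  have eqf : frel (face_perm r) =2 frel (next_dart r) by move=> d d'; rewrite /= face_permE.
  rewrite (eq_connect eqf) in abO.
  move/closed_connect/(_ _ _ abO); rewrite -!topredE /= /dart /= e_sym ex'y'.
  by move/esym.
(* Apart from the two new darts, the orbit of [(x', x)] stays in the component of [x']; so it
   contains [(y, x)] only if [y = x']. *)
suff inI d : d \in porbit s1 (x', x) ->
    [|| d == (x, x'), d == (x', x) | connect e x' d.1 && connect e x' d.2].
  have -> : ((y, x) \in porbit s1 (x', x)) = (y == x').
    apply/idP/eqP => [/inI|->]; last exact: porbit_id.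
    rewrite !xpair_eqE eqxx (negPf xx') andbF andbT /=.
    by rewrite [connect e x' x]symC cxx' andbF orbF => /eqP.
  by case: (y == x') => /=; lia.
apply: (@porbit_closed _ s1 (fun d => [|| d == (x, x'), d == (x', x) |
  connect e x' d.1 && connect e x' d.2]) (x', x)); last by rewrite eqxx orbT.
move=> {}d _; have ex'y' : e x' y'.
  case: ifP y'P => // _ E; by rewrite E eqxx in y'x.
have stepI a b : connect e x' a -> connect e x' b -> connect e x' (r b a).
  move=> xa xb; case eba: (e b a); last by rewrite r_fix ?eba.
  apply: connect_trans xb _; apply: connect1.
  by rewrite -(r_cycle _ eba) porbit1.
have [->|h1] := eqVneq d (x, x').
  by rewrite s1b /s face_permE /next_dart /= stepI ?connect0 ?orbT // connect1.
have [->|h2] := eqVneq d (y', x'); first by rewrite s1a eqxx orbT.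
case: d h1 h2 => a b h1 h2; rewrite s1F //=.
case/orP=> [|/andP[xa xb]]; last by rewrite xb stepI // !orbT.
by case/eqP=> -> ->; rewrite r_fix // eqxx.
Qed.

End AddEdge.

(** * Maximal sphere graphs are triangular *)

(* [nx x y] is the neighbour of [x] following [y], so that the face on one
   side of the edge [xy] is the triangle [x y (nx y x)], and the one on the
   other side is [x y (nx x y)]. By Euler's formula the number of darts says
   that the surface is a sphere. *)
Record triangular_map (V : finType) (e : rel V) (nx : V -> V -> V) : Prop :=
  TriangularMap {
  tm_sym : symmetric e;
  tm_irr : irreflexive e;
  tm_face : forall x y, e x y -> e y (nx y x) /\ nx (nx y x) y = x;
  tm_link : forall x (S : pred V) y z,
    (forall w, e x w -> S w -> S (nx x w)) -> e x y -> S y -> e x z -> S z;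
  tm_conn : forall (S : pred V) x y,
    (forall z w, S z -> e z w -> S w) -> S x -> S y;
  tm_card : #|dart e| + 12 = 6 * #|V|;
  tm_size : 3 <= #|V| }.

(** There is one component and no isolated vertex, so the genus condition becomes Euler's
    formula. *)
Lemma connected_genus0 (V : finType) (e : rel V) (r : V -> {perm V}) :
  symmetric e -> (forall x y, connect e x y) -> 1 < #|V| ->
  genus0 e r <-> #|V| + fcard (next_dart r) (dart e) = #|edges e| + 2.
Proof.
move=> e_sym conn /card_gt1P[x [y [_ _ xy]]].
rewrite -[genus0 e r]/(#|V| + fcard (next_dart r) (dart e)
       + #|[set x | [forall y, ~~ e x y]]|
    = #|edges e| + 2 * n_comp e [pred x : V | true]).
have -> : n_comp e [pred x : V | true] = 1.
  rewrite -(n_comp_connect (sym_connect_sym e_sym) x); apply: eq_n_comp_r => z.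
  by rewrite -!topredE /= conn.
have -> : #|[set x | [forall y, ~~ e x y]]| = 0; last by rewrite addn0.
apply/eqP; rewrite cards_eq0 -subset0; apply/subsetP => z; rewrite !inE => /forallP niso.
have [w zw] : exists w, z != w.
  by case: (eqVneq z x) => [->|]; [exists y | exists x].
have /connectP[[|u p] /=] := conn z w; first by move=> _ E; rewrite E eqxx in zw.
by case/andP=> zu; have := niso u; rewrite zu.
Qed.

Section EvenClique.

Variables (V : finType) (e : rel V).
Hypothesis e_irr : irreflexive e.

Definition inner_rel (C : {set V}) : rel V := fun x y => (x \in C) && (y \in C).

Lemma inner_rel_sym C : symmetric (inner_rel C).
Proof. by move=> x y; rewrite /inner_rel andbC. Qed.

(** Each corner of a triangle meets two of its sides, every other vertex none. *)
Lemma clique_even (C : {set V}) : #|C| = 3 ->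
  {in C &, forall x y, x != y -> e x y} ->
  forall x, ~~ odd #|[set y | e x y && inner_rel C x y]|.
Proof.
move=> C3 Ccl x; case xC: (x \in C).
  have -> : [set y | e x y && inner_rel C x y] = C :\ x.
    apply/setP => y; rewrite !inE /inner_rel xC /=; case yC: (y \in C); rewrite ?andbF //.
    rewrite !andbT eq_sym; apply/idP/idP => [/(edge_neq e_irr) //|]; exact: Ccl.
  by have := cardsD1 x C; rewrite C3 xC add1n => -[<-].
rewrite (_ : [set y | _] = set0) ?cards0 //.
by apply/setP => y; rewrite !inE /inner_rel xC andbF.
Qed.

End EvenClique.

Section Connected.

Variables (V : finType) (P : sphere_graph V).
Hypotheses (P_conn : forall x y, connect (adj P) x y) (V3 : 2 < #|V|).

Lemma connected_ind (S : pred V) x y :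
  (forall z w, S z -> adj P z w -> S w) -> S x -> S y.
Proof.
move=> cl; have /connectP[p] := P_conn x y.
by elim: p x => /= [|z p IH] x; [move=> _ -> | case/andP=> xz zp ly /cl/(_ xz); exact: IH].
Qed.

Lemma rot_ind x (S : pred V) y z :
  (forall w, adj P x w -> S w -> S (rot P x w)) ->
  adj P x y -> S y -> adj P x z -> S z.
Proof.
move=> cl xy Sy; rewrite -(rot_cycle _ xy).
by apply: porbit_closed Sy z => d; rewrite (rot_cycle _ xy); exact: cl.
Qed.

(** Each of [x] and [y] would have the other as its only neighbour, and the whole graph would have
    two vertices. This excludes faces with two darts. *)
Lemma small_component x y :
  adj P x y -> rot P x y = y -> rot P y x = x -> False.
Proof.
move=> exy rx ry.
have Nx z : adj P x z -> z == y.
  by apply: (@rot_ind x (fun z => z == y) y) => // w _ /eqP->; rewrite rx.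
have Ny z : adj P y z -> z == x.
  apply: (@rot_ind y (fun z => z == x) x) => //; last by rewrite adj_sym.
  by move=> w _ /eqP->; rewrite ry.
have all z : (z == x) || (z == y).
  apply: (@connected_ind (fun z => (z == x) || (z == y)) x); rewrite ?eqxx //.
  by move=> {}z w /orP[]/eqP -> /[dup] h; [move/Nx->|move/Ny->]; rewrite ?orbT.
have : #|V| <= #|[set x; y]|.
  by apply: subset_leq_card; apply/subsetP => z _; rewrite !inE all.
by rewrite cards2; case: (x != y); lia.
Qed.

End Connected.

Section Maximal.

Variables (V : finType) (P : sphere_graph V).
Hypothesis P_max : triangulation P.

Let e_sym : symmetric (adj P) := @adj_sym _ P.
Let e_irr : irreflexive (adj P) := @adj_irr _ P.

(** Otherwise the edge could be drawn in the given corners, giving a proper extension of [P]. *)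
Lemma maximal_corners (r : V -> {perm V}) x x' y y' :
  (forall x y, adj P x y -> r x y = rot P x y) ->
  (forall x y, ~~ adj P x y -> r x y = y) ->
  (forall x y z, adj P x y -> (z \in porbit (r x) y) = adj P x z) ->
  genus0 (adj P) r ->
  x != x' ->
  (if [forall z, ~~ adj P x z] then y = x' else adj P x y) ->
  (if [forall z, ~~ adj P x' z] then y' = x else adj P x' y') ->
  (connect (adj P) x x' ->
   [/\ adj P x y, adj P x' y' & (y, x) \in porbit (face_perm r) (y', x')]) ->
  adj P x x'.
Proof.
move=> r_rot r_fix r_cycle r_genus xx' yP y'P same; apply: contraT => nxx'.
pose Q := SphereGraph (add_edge_sym x x' e_sym) (add_edge_irr e_irr xx')
  (add_edge_rot_cycle e_sym xx' nxx' r_cycle r_fix yP y'P)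
  (add_edge_genus e_sym xx' nxx' r_cycle r_fix r_genus yP y'P same).
have PQ : extends P Q.
  split=> [a b eab|a b eab]; first by rewrite /= /add_edge eab.
  rewrite -r_rot //= /add_edge_rot; case: (eqVneq a x) => [ax|ax].
    subst a; have [->|byn] := eqVneq b y.
      (* A neighbour has been inserted directly after [y]: one step is skipped there, and none after
         the other neighbours. *)
      exists 1; first by rewrite /= !permM tpermL (r_fix _ _ nxx') tpermR.
      by case=> // _; rewrite /= permM tpermL r_fix.
    exists 0 => //=; rewrite permM tpermD // 1?eq_sym //.
    by apply: contraNneq (nxx') => {1}<-.
  case: (eqVneq a x') => [ax'|ax']; last by exists 0.
  have nx'x : ~~ adj P x' x by rewrite adj_sym.
  subst a; have [->|byn] := eqVneq b y'.
    exists 1; first by rewrite /= !permM tpermL (r_fix _ _ nx'x) tpermR.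
    by case=> // _; rewrite /= permM tpermL r_fix.
  exists 0 => //=; rewrite permM tpermD // 1?eq_sym //.
  by apply: contraNneq (nx'x) => {1}<-.
by have /(_ x x') := P_max.2 Q PQ; rewrite (negPf nxx') /= /add_edge !eqxx orbT => /(_ isT).
Qed.

(** Vertices in different components could be joined through arbitrary corners. *)
Lemma maximal_connected x x' : connect (adj P) x x'.
Proof.
apply: contraT => nxx'.
have corner (z w : V) : exists y, if [forall u, ~~ adj P z u] then y = w else adj P z y.
  case iso: [forall u, ~~ adj P z u]; first by exists w.
  by move/negbT: iso; rewrite negb_forall => /existsP[u]; rewrite negbK; exists u.
have [r [r1 r2 r3 r4]] := normal_rotation P.
have [y yP] := corner x x'; have [y' y'P] := corner x' x.
suff : adj P x x' by move=> /connect1 h; rewrite h in nxx'.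
apply: (maximal_corners r1 r2 r3 r4 _ yP y'P); last by rewrite (negPf nxx').
by apply: contraNneq nxx' => ->.
Qed.

(** The vertex [d.2] lies on the face that contains the dart [(y, x)], and two distinct vertices of
    a face could be joined inside it. *)
Lemma maximal_face x y i :
  adj P y x -> let d := iter i (next_dart (rot P)) (y, x) in
  x != d.2 -> adj P x d.2.
Proof.
move=> eyx d xd; have [r [r1 r2 r3 r4]] := normal_rotation P.
have [eqd dD] : d = iter i (face_perm r) (y, x) /\ adj P d.1 d.2.
  rewrite /d; elim: i {d xd} => //= i [<-].
  case: (iter i _ _) => a b /=; rewrite adj_sym => ba.
  by rewrite face_permE /next_dart /= r1 // adj_rot.
have dE : d = (d.1, d.2) by case: (d).
have nis z w : adj P z w -> [forall u, ~~ adj P z u] = false.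
  by move=> zw; apply/negbTE; rewrite negb_forall; apply/existsP; exists w; rewrite negbK.
have exy : adj P x y by rewrite adj_sym.
rewrite adj_sym in dD.
apply: (maximal_corners r1 r2 r3 r4 xd (y := y) (y' := d.1)).
- by rewrite (nis _ _ exy).
- by rewrite (nis _ _ dD).
- by move=> _; split=> //; rewrite -dE porbit_sym porbit_fconnect eqd fconnect_iter.
Qed.

Lemma maximal_euler :
  #|V| + fcard (next_dart (rot P)) (dart (adj P)) = #|edges (adj P)| + 2.
Proof.
apply/connected_genus0; [exact: adj_sym | exact: maximal_connected | | exact: sphere_genus0].
by case: P_max => h _; apply: ltn_trans h.
Qed.

(** Otherwise [x] is the only neighbour of [y]. The face around [y] makes [y] adjacent to the
    neighbour of [x] following it, which would then be [x] itself; and if that neighbour is [y], the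
    graph is a single edge. *)
Lemma maximal_no_leaf x y : adj P x y -> rot P y x != x.
Proof.
move=> exy; have eyx : adj P y x by rewrite adj_sym.
apply/eqP => ryx; have := @maximal_face y x 2 exy; rewrite /= ryx => h.
have [yE|ny] := eqVneq y (rot P x y); first exact: (small_component maximal_connected P_max.1
  exy).
have /eqP E : rot P x y == x.
  by apply: (@rot_ind _ P y (fun z => z == x) x) => // [w _ /eqP->|]; [rewrite ryx|apply: h].
by have := adj_rot exy; rewrite E adj_irr.
Qed.

(* Otherwise [x0], [x1], [x2], [x3] on the face are pairwise adjacent. In the
   colouring bounded by [x0 x1 x2] both sides of the edge [x1 x3] differ in
   colour from this face, which contradicts that all faces at [x3] agree. *)
Lemma maximal_triangle x0 x1 : adj P x0 x1 -> rot P (rot P x1 x0) x1 = x0.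
Proof.
move=> e01; have e10 : adj P x1 x0 by rewrite adj_sym.
move: (adj_rot e10) (maximal_no_leaf e01); move E12: (rot P x1 x0) => x2 e12 x20.
have e21 : adj P x2 x1 by rewrite adj_sym.
move: (adj_rot e21) (maximal_no_leaf e12); move E23: (rot P x2 x1) => x3 e23 x31.
apply/eqP; apply: contraT => x30.
have e13 : adj P x1 x3.
  by have := @maximal_face x1 x0 2 e01; rewrite /= E12 E23 => -> //; rewrite eq_sym.
(* With [y0] before [x1] around [x0], the face runs through [y0], [x0], [x1], [x2]; this yields the
   adjacency of [x0] and [x2]. *)
have [y0 ey0 E01] : exists2 y0, adj P x0 y0 & rot P x0 y0 = x1.
  exists ((rot P x0)^-1%g x1); last exact: permKV.
  by rewrite -(rot_cycle _ e01) porbit_sym -{1}[x1](permKV (rot P x0)) porbit1.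
have ey0' : adj P y0 x0 by rewrite adj_sym.
have e02 : adj P x0 x2.
  by have := @maximal_face x0 y0 2 ey0'; rewrite /= E01 E12 => -> //; rewrite eq_sym.
have n01 := edge_neq (@adj_irr _ P) e01; have n12 := edge_neq (@adj_irr _ P) e12.
have n02 := edge_neq (@adj_irr _ P) e02; have n23 := edge_neq (@adj_irr _ P) e23.
pose C := x0 |: [set x1; x2].
have C_clique : {in C &, forall x y, x != y -> adj P x y}.
  move=> x y; rewrite !inE => /or3P[] /eqP-> /or3P[] /eqP->;
  by rewrite ?eqxx // adj_sym.
have C3 : #|C| = 3 by rewrite cardsU1 cards2 !inE negb_or n01 n02 n12.
have x3C : x3 \notin C by rewrite !inE !negb_or x30 x31 eq_sym n23.
have [k [kf kc]] := even_set_colouring (@adj_sym _ P) (@adj_irr _ P) (@rot_cycle _ P)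
  maximal_connected maximal_euler (inner_rel_sym C) (clique_even (@adj_irr _ P) C3 C_clique).
have k12 : k x1 x2 = k x0 x1 by rewrite -E12 -kf.
have k23 : k x2 x3 = k x0 x1 by rewrite -E23 -kf.
have k21 : k x2 x1 != k x0 x1.
  have := kc _ _ e12; rewrite k12 /inner_rel !inE !eqxx !orbT /=.
  by case: (k x0 x1); case: (k x2 x1).
have kC x y : adj P x y -> ~~ ((x \in C) && (y \in C)) -> k x y = k y x.
  move=> exy nC; have := kc _ _ exy; rewrite /inner_rel (negPf nC).
  by case: (k x y); case: (k y x).
(* Around [x1] the colour changes only at the sides to [x0] and [x2]. As [x2] follows [x0], every
   dart into [x1] from [x2] on until [x0] has the other colour. *)
have : (x3 == x0) || (k x3 x1 != k x0 x1).
  apply: (@rot_ind _ P x1 (fun z => (z == x0) || (k z x1 != k x0 x1)) x0);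
    rewrite ?eqxx // => w e1w /=.
  have [->|w0 /= kw] := eqVneq w x0; first by rewrite E12 k21 orbT.
  have e1w' := adj_rot e1w; have ew1 : adj P w x1 by rewrite adj_sym.
  have [//|w'0] := eqVneq (rot P x1 w) x0.
  have [->|w'2] := eqVneq (rot P x1 w) x2; first by rewrite k21.
  rewrite -kC -?kf //.
  rewrite !inE (negPf w'0) (negPf w'2) !orbF /= andbC; apply/negP => /andP[/eqP E _].
  by rewrite E adj_irr in e1w'.
rewrite (negPf x30) /= -kC ?(negPf x3C) ?andbF // => /negP[].
have e32 : adj P x3 x2 by rewrite adj_sym.
have e31 : adj P x3 x1 by rewrite adj_sym.
apply: (@rot_ind _ P x3 (fun z => k z x3 == k x0 x1) x2) => //; last by rewrite k23.
move=> w e3w; have ew3 : adj P w x3 by rewrite adj_sym.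
by rewrite -(kC x3 (rot P x3 w)) -?kf ?(negPf x3C) // adj_rot.
Qed.

End Maximal.

Section TriangularFaces.

Variables (V : finType) (e : rel V) (r : V -> {perm V}).
Hypotheses (e_sym : symmetric e) (e_irr : irreflexive e).
Hypothesis r_cycle : forall x y z, e x y -> (z \in porbit (r x) y) = e x z.
Hypothesis r_face : forall x y, e x y -> r (r y x) y = x.

Lemma card_triangular_faces : fcard (next_dart r) (dart e) * 3 = #|dart e|.
Proof.
apply: fcard_order_set; [exact: next_dart_inj | | exact: dart_fclosed].
apply/subsetP => -[x y] exy; have eyx : e y x by rewrite e_sym.
have er a b : e a b -> e a (r a b) by move=> eab; rewrite -(r_cycle _ eab) porbit1.
have eyz := er _ _ eyx; have ezy : e (r y x) y by rewrite e_sym.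
have ezx := er _ _ ezy; rewrite r_face // in ezx.
have h3 := r_face eyz; rewrite (r_face exy) in h3.
rewrite inE (@fingraph.order_cycle _ _ [:: (x, y); (y, r y x); (r y x, x)]) //=.
- by rewrite /next_dart /= r_face // h3 !eqxx.
- rewrite !inE !xpair_eqE (negPf (edge_neq e_irr exy)) (negPf (edge_neq e_irr eyx)).
  by rewrite (negPf (edge_neq e_irr eyz)) !andbF.
by rewrite inE eqxx.
Qed.

End TriangularFaces.

Lemma triangulation_triangular_map (V : finType) (P : sphere_graph V) :
  triangulation P -> triangular_map (adj P) (fun x y => rot P x y).
Proof.
move=> Pmax; have conn := maximal_connected Pmax.
split.
- exact: adj_sym.
- exact: adj_irr.
- by move=> x y exy; rewrite adj_rot; [split=> //; exact: maximal_triangle | rewrite adj_sym].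
- by move=> x S y z; exact: rot_ind.
- by move=> S x y; exact: connected_ind.
- have := maximal_euler Pmax; have := Pmax.1.
  have := card_triangular_faces (@adj_sym _ P) (@adj_irr _ P) (@rot_cycle _ P)
    (maximal_triangle Pmax).
  have := card_darts (@adj_sym _ P) (@adj_irr _ P).
  lia.
- exact: Pmax.1.
Qed.

(** In a connected sphere graph on at least three vertices every face has at least three darts, so
    by Euler's formula an extension has at most [6 * #|V| - 12] darts. [P] has that many already. *)
Lemma triangulation_of_card (V : finType) (P : sphere_graph V) :
  2 < #|V| -> (forall x y, connect (adj P) x y) ->
  #|dart (adj P)| + 12 = 6 * #|V| -> triangulation P.
Proof.
move=> V3 conn cP; split=> // Q [sPQ _].
have connQ x y : connect (adj Q) x y.
  by apply: connect_sub (conn x y) => u w /sPQ; exact: connect1.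
have /(connected_genus0 _ (@adj_sym _ Q) connQ (ltnW V3)) := @sphere_genus0 _ Q.
have dQ := card_darts (@adj_sym _ Q) (@adj_irr _ Q).
have := leq_fcard_order (@next_dart_inj _ (rot Q)) (dart_fclosed (@adj_sym _ Q) (@rot_cycle _
  Q)).
move/(_ 3) => fQ cQ.
have {}fQ : fcard (next_dart (rot Q)) (dart (adj Q)) * 3 <= #|dart (adj Q)|.
  apply: fQ => -[x y] exy; rewrite leqNgt; apply/negP => lt3.
  have {}exy : adj Q x y := exy; have eyx : adj Q y x by rewrite adj_sym.
  have := fingraph.iter_order (@next_dart_inj _ (rot Q)) (x, y).
  case: (fingraph.order _ _) (fingraph.order_gt0 (next_dart (rot Q)) (x, y)) lt3 => [|[|[|]]]
    //= _ _.
    by case=> E _; rewrite E adj_irr in exy.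
  case=> ryx; rewrite ryx => rxy.
  exact: (small_component connQ V3 exy).
have dPQ : #|dart (adj Q)| <= #|dart (adj P)| by lia.
have /eqP/setP E : [set d | dart (adj P) d] == [set d | dart (adj Q) d].
  rewrite eqEcard !cardsE dPQ andbT; apply/subsetP => -[x y].
  by rewrite !inE; exact: sPQ.
by move=> x y exy; have := E (x, y); rewrite !inE /dart /= exy.
Qed.

(** * Triangular maps and their rotation systems *)

Section MapTheory.

Variables (V : finType) (e : rel V) (nx : V -> V -> V).
Hypothesis M : triangular_map e nx.

Let e_sym := tm_sym M.
Let e_irr := tm_irr M.

Lemma tm_next x y : e x y -> e y (nx y x).
Proof. by case/(tm_face M). Qed.

Lemma tm_next' x y : e x y -> e x (nx y x).
Proof.
move=> exy; have [eyz zy] := tm_face M exy.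
by have [h _] := tm_face M eyz; rewrite zy e_sym in h.
Qed.

Lemma tm_nextK x y : e x y -> nx (nx y x) y = x.
Proof. by case/(tm_face M). Qed.

Lemma tm_nextK' x y : e x y -> nx x (nx y x) = y.
Proof.
move=> exy; have [eyz zy] := tm_face M exy.
by have [_ h] := tm_face M eyz; rewrite zy in h.
Qed.

Lemma tm_inj x y z : e x y -> e x z -> nx x y = nx x z -> y = z.
Proof.
rewrite !(e_sym x) => eyx ezx E.
by rewrite -(tm_nextK eyx) E tm_nextK.
Qed.

Lemma tm_connect x y : connect e x y.
Proof.
apply: (tm_conn M (S := connect e x)) => // z w xz ezw.
exact: connect_trans xz (connect1 ezw).
Qed.

Definition tm_perm (x : V) : {perm V} := fun_perm (fun y => if e x y then nx x y else y).

Lemma tm_permE x y : e x y -> tm_perm x y = nx x y.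
Proof.
move=> exy; rewrite fun_permE ?exy // => u w.
case: ifP => xu; case: ifP => xw //; first exact: tm_inj.
  by move=> E; rewrite -E tm_next // e_sym in xw.
by move=> E; rewrite E tm_next // e_sym in xu.
Qed.

Lemma tm_perm_cycle x y z : e x y -> (z \in porbit (tm_perm x) y) = e x z.
Proof.
move=> exy; apply/idP/idP => [h|exz].
  apply: (@porbit_closed _ _ (e x) y) h => // w _ exw.
  by rewrite tm_permE // tm_next // e_sym.
apply: (tm_link M (S := mem (porbit (tm_perm x) y))) exy _ exz; last exact: porbit_id.
by move=> w exw /= h; rewrite -tm_permE // (porbit_trans h) // porbit1.
Qed.

Lemma tm_euler : #|V| + fcard (next_dart tm_perm) (dart e) = #|edges e| + 2.
Proof.
have face x y : e x y -> tm_perm (tm_perm y x) y = x.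
  move=> exy; have eyx : e y x by rewrite e_sym.
  by rewrite !tm_permE ?tm_nextK // e_sym tm_next.
have := card_triangular_faces e_sym e_irr tm_perm_cycle face.
have := card_darts e_sym e_irr; have := tm_card M; have := tm_size M; lia.
Qed.

Lemma tm_genus0 : genus0 e tm_perm.
Proof.
apply/(connected_genus0 _ e_sym tm_connect); last exact: tm_euler.
exact: leq_trans (tm_size M).
Qed.

(** The way back to the definition of a triangulation, for use after a contraction. *)
Lemma triangular_map_sphere :
  exists2 P : sphere_graph V, triangulation P & forall x y, adj P x y = e x y.
Proof.
pose P := SphereGraph e_sym e_irr tm_perm_cycle tm_genus0.
exists P => //; apply: triangulation_of_card;
  [exact: tm_size M|exact: tm_connect|exact: tm_card M].
Qed.

End MapTheory.

(** * Separating triangles *)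

Section Cuts.

Variables (V : finType) (e : rel V) (nx : V -> V -> V).
Hypothesis M : triangular_map e nx.
Hypothesis V5 : 4 < #|V|.

Let e_sym := tm_sym M.
Let e_irr := tm_irr M.

Implicit Types (A T Y B : {set V}) (u v w x y z : V).

Definition nbrs u : {set V} := [set w | e u w].

(** If both faces at [uv] had the same apex [a], the links of [u], [v] and [a] would close up after
    two neighbours, and the graph would be a triangle. *)
Lemma tm_apex_neq u v : e u v -> nx u v != nx v u.
Proof.
move=> euv; have evu : e v u by rewrite e_sym.
apply/eqP => E; set a := nx u v in E.
have au : e u a by rewrite /a (tm_next M).
have av : e v a by rewrite E (tm_next M).
have cl x y z : e x y -> nx x y = z -> nx x z = y ->
    forall w, e x w -> (w == y) || (w == z).
  move=> exy xy xz w; apply: (tm_link M (S := fun w => (w == y) || (w == z))) exy _ => //.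
    by move=> {}w _ /orP[]/eqP->; rewrite ?xy ?xz eqxx ?orbT.
  by rewrite eqxx.
have Nu := cl u v a euv erefl.
have Nv := cl v u a evu (esym E).
have Na := cl a u v.
have all z : z \in [set u; v; a].
  have ua := tm_nextK' M euv; have va := tm_nextK' M evu.
  have uva := tm_nextK M euv; have vua := tm_nextK M evu.
  rewrite -E in ua uva; rewrite -/a in va vua.
  apply: (tm_conn M (S := mem [set u; v; a]) (x := u)); last by rewrite !inE eqxx.
  move=> x y; rewrite !inE => /orP[/orP[]|] /eqP->.
  - by move=> /(Nu ua)/orP[]/eqP->; rewrite eqxx ?orbT.
  - by move=> /(Nv va)/orP[]/eqP->; rewrite eqxx ?orbT.
  - have eau : e a u by rewrite e_sym.
    by move=> /(Na eau vua uva)/orP[]/eqP->; rewrite eqxx ?orbT.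
have : #|V| <= #|[set u; v; a]| by apply: subset_leq_card; apply/subsetP => z _.
by rewrite setUC cardsU1 cards2; lia.
Qed.

Lemma has_nbr u : exists v, e u v.
Proof.
apply/existsP; apply: contraT => /existsPn niso.
have : #|V| <= #|[set u]|.
  apply: subset_leq_card; apply/subsetP => z _; rewrite inE.
  apply: (tm_conn M (S := fun z => z == u) (x := u)); rewrite ?eqxx //.
  by move=> x y /eqP->; rewrite (negPf (niso y)).
by rewrite cards1; lia.
Qed.

Lemma nbrs_ge3 u : 3 <= #|nbrs u|.
Proof.
have [v euv] := has_nbr u; have evu : e v u by rewrite e_sym.
apply/card_gt2P; exists v, (nx u v), (nx v u); rewrite !inE euv.
rewrite (tm_next M evu) (tm_next' M euv) (tm_apex_neq euv); split=> //.
by rewrite (edge_neq e_irr (tm_next' M evu)) eq_sym (edge_neq e_irr (tm_next M euv)).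
Qed.

(** For an edge [uv] this says that its only 3-cycles are the two faces on it, which is
    contractibility in the triangulation. *)
Definition simple u v : bool :=
  [forall w, e u w && e v w ==> (w == nx u v) || (w == nx v u)].

Lemma simpleP u v w : simple u v -> e u w -> e v w -> w = nx u v \/ w = nx v u.
Proof.
move/forallP/(_ w)/implyP => h uw vw.
by case/orP: (h (introT andP (conj uw vw))) => /eqP; auto.
Qed.

(** * Vertices of degree three *)

Section Degree3.

Variable u : V.
Hypothesis u3 : #|nbrs u| = 3.

(** The neighbour [v] and the two distinct apexes on [uv] already make three. *)
Lemma deg3_nbrs v w : e u v -> e u w -> [\/ w = v, w = nx u v | w = nx v u].
Proof.
move=> euv euw; have evu : e v u by rewrite e_sym.
have : [set nx u v; nx v u] \subset nbrs u :\ v.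
  apply/subsetP => z; rewrite !inE => /orP[]/eqP->.
    by rewrite (tm_next M evu) eq_sym (edge_neq e_irr (tm_next' M evu)).
  by rewrite (tm_next' M euv) eq_sym (edge_neq e_irr (tm_next M euv)).
move/subset_leqif_cards => -[_]; rewrite cards2 tm_apex_neq //.
have := cardsD1 v (nbrs u); rewrite u3 inE euv add1n => -[<-] /esym/eqP/setP/(_ w).
rewrite !inE euw andbT; have [->|_ /=] := eqVneq w v; first by constructor 1.
by case/orP=> /eqP ->; [constructor 2 | constructor 3].
Qed.

Lemma deg3_clique : {in nbrs u &, forall x y, x != y -> e x y}.
Proof.
move=> x y; rewrite !inE => ux uy xy; have xu : e x u by rewrite e_sym.
case: (deg3_nbrs ux uy) => [E|->|->]; first by rewrite E eqxx in xy.
  exact: (tm_next' M).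
exact: (tm_next M).
Qed.

Lemma deg3_simple v : e u v -> simple u v.
Proof.
move=> euv; apply/forallP => w; apply/implyP => /andP[uw vw].
by case: (deg3_nbrs euv uw) => E; rewrite E ?eqxx ?orbT //; rewrite E e_irr in vw.
Qed.

End Degree3.

(* The rest of the graph is [~: (A :|: T)]. *)
Definition cut T A : Prop :=
  [/\ #|T| = 3, {in T &, forall x y, x != y -> e x y},
      exists a, a \in A, exists b, b \notin A :|: T &
      forall a, a \in A -> a \notin T /\ forall b, e a b -> b \in A :|: T].

(** The neighbours form a triangle, and with more than four vertices something remains outside. *)
Lemma deg3_cut u : #|nbrs u| = 3 -> cut (nbrs u) [set u].
Proof.
move=> u3; split=> //; first exact: deg3_clique.
- by exists u; rewrite inE.
- apply/existsP; apply: contraT => /existsPn h.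
  have : #|V| <= #|[set u] :|: nbrs u|.
    by apply: subset_leq_card; apply/subsetP => z _; have := h z; rewrite negbK.
  by rewrite cardsU1 u3; case: (_ \notin _); lia.
- by move=> a; rewrite !inE => /eqP->; rewrite e_irr; split=> // b; rewrite !inE orbC => ->.
Qed.

(* The triangle is an even set of edges, so it bounds a set of faces. *)
Lemma separating_triangle x y z : e x y -> e y z -> e x z ->
  z != nx x y -> z != nx y x -> exists A, cut (x |: [set y; z]) A.
Proof.
move=> exy eyz exz z1 z2; set T := x |: _.
have eyx : e y x by rewrite e_sym.
have T3 : #|T| = 3.
  rewrite cardsU1 cards2 !inE negb_or (edge_neq e_irr exy) (edge_neq e_irr eyz).
  by rewrite (edge_neq e_irr exz).
have Tcl : {in T &, forall x y, x != y -> e x y}.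
  move=> u v; rewrite !inE => /or3P[] /eqP-> /or3P[] /eqP->;
  by rewrite ?eqxx // e_sym.
have [k [kf kc]] := even_set_colouring e_sym e_irr (tm_perm_cycle M)
  (tm_connect M) (tm_euler M) (inner_rel_sym T) (clique_even e_irr T3 Tcl).
have {}kf u v : e u v -> k u v = k v (nx v u).
  by move=> euv; rewrite (kf u v euv) (tm_permE M) // e_sym.
have kT u v : e u v -> ~~ ((u \in T) && (v \in T)) -> k u v = k v u.
  by move=> /kc h nT; move: h; rewrite /inner_rel (negPf nT); case: (k u v); case: (k v u).
(* No side of the triangle ends at [u], so all faces around [u] have the same colour. *)
have kx u v w : u \notin T -> e u v -> e u w -> k u v = k u w.
  move=> uT uv uw; apply/esym/eqP.
  apply: (tm_link M (S := fun w => k u w == k u v)) uv _ uw => // w' uw' /eqP <-.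
  have w'u : e w' u by rewrite e_sym.
  by rewrite -(kf w' u w'u) (kT w' u w'u) // (negPf uT) andbF.
(* The vertices off the triangle, sorted by the colour of the faces around them. *)
pose A b := [set w in ~: T | [exists v, e w v && (k w v == b)]].
have inA b w v : w \notin T -> e w v -> (w \in A b) = (k w v == b).
  move=> wT wv; rewrite inE in_setC wT /=.
  apply/existsP/idP => [[v' /andP[wv' /eqP <-]]|h]; last by exists v; rewrite wv.
  by rewrite (kx w v v').
have AT b w : w \in A b -> w \notin T by rewrite inE in_setC => /andP[].
have apex u v : e u v -> u \in T -> v \in T -> nx v u \notin T -> nx v u \in A (k u v).
  move=> uv uT vT nT; have [vn nv] := tm_face M uv.
  have nv' : e (nx v u) v by rewrite e_sym.
  by rewrite (inA _ _ v) // (kf u v uv) [k v _]kT // (negPf nT) andbF.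
have nT1 : nx y x \notin T.
  rewrite !inE !negb_or ![nx _ _ == _]eq_sym z2 (edge_neq e_irr (tm_next M exy)).
  by rewrite (edge_neq e_irr (tm_next' M exy)).
have nT2 : nx x y \notin T.
  rewrite !inE !negb_or ![nx _ _ == _]eq_sym z1 (edge_neq e_irr (tm_next M eyx)).
  by rewrite (edge_neq e_irr (tm_next' M eyx)).
have xT : x \in T by rewrite !inE eqxx.
have yT : y \in T by rewrite !inE eqxx orbT.
have kxy : k y x = ~~ k x y.
  by have := kc _ _ exy; rewrite /inner_rel xT yT; case: (k x y); case: (k y x).
exists (A (k x y)); split=> //.
- by exists (nx y x); exact: apex.
- exists (nx x y); rewrite inE (negPf nT2) orbF.
  have h := apex _ _ eyx yT xT nT2; rewrite kxy in h.
  have [v v1] := has_nbr (nx x y).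
  by move: h; rewrite !(inA _ _ v) // => /eqP ->; case: (k x y).
move=> a aA; have aT := AT _ _ aA; split=> // b ab; rewrite inE orbC.
case: (boolP (b \in T)) => //= bT; have ba : e b a by rewrite e_sym.
by move: aA; rewrite (inA _ a b) // (inA _ b a) // (kT a b ab) // (negPf aT).
Qed.

Lemma simple_or_cut u v : e u v ->
  simple u v \/ exists T A, [/\ cut T A, u \in T & v \in T].
Proof.
move=> uv; case: (boolP (simple u v)); first by left.
rewrite negb_forall => /existsP[w]; rewrite negb_imply negb_or => /andP[/andP[uw vw] /andP[w1
  w2]].
have [A cA] := separating_triangle uv vw uw w1 w2.
by right; exists (u |: [set v; w]), A; rewrite !inE !eqxx orbT.
Qed.

(** Two vertices do not separate. Around a vertex [y] of [Y], the neighbours can leave [A :|: Y]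
    only after the other vertex [w] of [Y], and to come back to [A] they would have to pass a third
    one. So a vertex of [Y] with a neighbour in [A] has no neighbour outside. *)
Lemma three_connected A Y a0 z : #|Y| <= 2 -> a0 \in A ->
  (forall a, a \in A -> a \notin Y) ->
  (forall a b, a \in A -> e a b -> b \in A :|: Y) -> z \in A :|: Y.
Proof.
move=> Y2 a0A AY Acl.
have Yun x y w : x \in Y -> y \in Y -> w \in Y -> x != y -> y != w -> w != x -> False.
  move=> xY yY wY xy yw wx; have : 2 < #|Y| by apply/card_gt2P; exists x, y, w.
  by lia.
have Ylink y a b : y \in Y -> a \in A -> e y a -> e y b -> b \in A :|: Y.
  move=> yY aA ya yb; apply: contraT => bZ.
  have ncl : ~ (forall w, e y w -> w \in A :|: Y -> nx y w \in A :|: Y).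
    move=> cl; have /negP[] := bZ.
    by apply: (tm_link M (S := mem (A :|: Y)) cl ya) => //; rewrite /= inE aA.
  have [|/forallPn[w]] := boolP [forall w, (e y w && (w \in A :|: Y)) ==> (nx y w \in A :|: Y)].
    move=> /forallP cl; case: ncl => w yw wAY; have := cl w; by rewrite yw wAY.
  rewrite negb_imply => /andP[/andP[yw wAY] nwZ].
  have wy : e w y by rewrite e_sym.
  have wnw : e w (nx y w) by exact: (tm_next' M).
  have wA : w \notin A by apply: contra nwZ => /Acl; exact.
  have wY : w \in Y by move: wAY; rewrite inE (negPf wA).
  suff : a \notin A by rewrite aA.
  have nyw : e y (nx y w) by exact: (tm_next M).
  apply: (tm_link M (S := fun v => v \notin A)) nyw _ ya.
    move=> v yv vA; have vy : e v y by rewrite e_sym.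
    case: (boolP (v \in Y)) => vY.
      have [->|vw] := eqVneq v w; first by apply: contra nwZ; rewrite inE => ->.
      case: (Yun y v w) => //; [exact: edge_neq yv | by rewrite eq_sym (edge_neq e_irr yw)].
    apply: contra vA => nvA; have : v \in A :|: Y.
      by apply: Acl nvA _; rewrite e_sym (tm_next' M).
    by rewrite inE (negPf vY) orbF.
  by apply: contra nwZ; rewrite inE => ->.
suff : (z \in A) || ((z \in Y) && [exists a, (a \in A) && e z a]).
  by rewrite inE => /orP[->|/andP[-> _]]; rewrite ?orbT.
apply: (tm_conn M (x := a0)
  (S := fun z => (z \in A) || ((z \in Y) && [exists a, (a \in A) && e z a])));
    last by rewrite a0A.
move=> x w /orP[xA xw|/andP[xY /existsP[a /andP[aA xa]]] xw].
  have := Acl x w xA xw; rewrite inE => /orP[->//|->]; rewrite orbC.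
  by apply/orP; left; apply/existsP; exists x; rewrite xA e_sym.
have := Ylink x a w xY aA xa xw; rewrite inE => /orP[->//|wY]; rewrite wY orbC.
have wx : e w x by rewrite e_sym.
have xn := tm_next M wx; have wn := tm_next' M wx.
have := Ylink x a _ xY aA xa xn; rewrite inE => /orP[nA|nY].
  by apply/orP; left; apply/existsP; exists (nx x w); rewrite nA.
by case: (Yun x w (nx x w)) => //; [exact: edge_neq xw|exact: edge_neq wn|rewrite eq_sym;
  exact: edge_neq xn].
Qed.

(** Otherwise the two other corners of [T] would cut off [A]. *)
Lemma cut_nbr T A t : cut T A -> t \in T -> exists2 a, a \in A & e t a.
Proof.
move=> [T3 _ [a0 a0A] [b bZ] Acl] tT.
case: (boolP [exists a, (a \in A) && e t a]) => [/existsP[a /andP[]]|/existsPn nt].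
  by exists a.
have : t \in A :|: (T :\ t).
  apply: three_connected a0A _ _.
  - by have := cardsD1 t T; rewrite T3 tT; lia.
  - by move=> a /Acl[aT _]; rewrite inE negb_and aT orbT.
  - move=> a w aA aw; have [_ /(_ w aw)] := Acl a aA.
    rewrite !inE => /orP[->//|->]; rewrite andbT orbC.
    by have [E|//] := eqVneq w t; move: (nt a); rewrite aA e_sym -E aw.
by rewrite !inE eqxx /= orbF => /Acl[]; rewrite tT.
Qed.

Lemma cut_compl T A : cut T A -> cut T (~: (A :|: T)).
Proof.
move=> [T3 Tcl [a aA] [b bZ] Acl]; split=> //.
- by exists b; rewrite inE.
- exists a; rewrite !inE aA /=; exact: (Acl a aA).1.
move=> z; rewrite inE => zZ; split; first by apply: contra zZ; rewrite inE orbC => ->.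
move=> w zw; rewrite !inE; case: (boolP (w \in A)) => //= wA.
  by case/negP: zZ; apply: (Acl w wA).2; rewrite e_sym.
by case: (w \in T).
Qed.

(* [A3] is the side of [T2] avoiding [T]: if it met the other side of [T] as
   well, the at most two vertices of [T :&: T2] would cut off a part. *)
Lemma nested_cut T A T2 A2 u : cut T A -> u \in A -> cut T2 A2 -> u \in T2 ->
  exists A3, [/\ cut T2 A3, A3 \subset A & u \notin A3].
Proof.
move=> cA uA c2 uT2; have [T3 Tcl _ _ Acl] := cA.
have uT := (Acl u uA).1.
have main B : cut T2 B -> (forall t, t \in T -> t \notin B) -> B \subset A.
  move=> cB TB; have [T23 T2cl _ _ Bcl] := cB.
  apply/subsetP => b bB; apply: contraT => bA.
  have : u \in (B :\: A) :|: (T :&: T2).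
    apply: (@three_connected _ _ b); rewrite ?inE ?bA ?bB //.
    - have : #|T :&: T2| <= #|T2 :\ u|.
        apply: subset_leq_card; apply/subsetP => w; rewrite !inE => /andP[wT ->].
        by rewrite andbT; apply: contraNneq uT => <-.
      by have := cardsD1 u T2; rewrite uT2 T23; lia.
    - move=> a; rewrite !inE => /andP[_ /Bcl[aT2 _]]; by rewrite negb_and aT2 orbT.
    - move=> a w; rewrite !inE => /andP[aA aB] aw.
      have wA : w \notin A.
        apply/negP => wA; have := (Acl w wA).2 a; rewrite e_sym => /(_ aw).
        by rewrite inE (negPf aA) => /= /TB; rewrite aB.
      have := (Bcl a aB).2 w aw; rewrite inE wA /= => /orP[->//|wT2].
      rewrite wT2 andbT; have uw : u != w by apply: contraNneq wA => <-.
      have := (Acl u uA).2 w (T2cl u w uT2 wT2 uw).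
      by rewrite inE (negPf wA) => /= ->; rewrite orbT.
  by rewrite !inE uA (negPf uT).
have [T23 T2cl _ _ A2cl] := c2.
case: (boolP [exists t, (t \in T) && (t \in A2)]) => [/existsP[t /andP[tT tA2]]|/existsPn nt].
  exists (~: (A2 :|: T2)); have cc := cut_compl c2; split=> //.
    apply: main => // t' t'T; rewrite inE negbK.
    have [->|tt'] := eqVneq t' t; first by rewrite inE tA2.
    by apply: (A2cl t tA2).2; apply: Tcl; rewrite // eq_sym.
  by rewrite !inE uT2 orbT.
exists A2; split=> //; first by apply: main => // t tT; have := nt t; rewrite tT.
by apply/negP => /A2cl[]; rewrite uT2.
Qed.

Definition mincut T A : Prop :=
  cut T A /\ forall T' A', cut T' A' -> A' \subset A -> A' = A.

Lemma exists_mincut T A : cut T A -> exists T' A', mincut T' A' /\ A' \subset A.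
Proof.
have [n] := ubnP #|A|; elim: n T A => // n IH T A An cA.
have [[T' [A' [c' pr]]]|none] : (exists T' A', cut T' A' /\ A' \proper A) \/
   ~ (exists T' A', cut T' A' /\ A' \proper A) by exact: classic.
  have [|T2 [A2 [m s]]] := IH T' A' _ c'.
    exact: leq_trans (proper_card pr) An.
  by exists T2, A2; split=> //; apply: subset_trans s (proper_sub pr).
exists T, A; split=> //; split=> // T' A' c' s; apply/eqP; rewrite eqEsubset s /=.
apply: contraT => ns; case: none; exists T', A'; split=> //.
by rewrite properE s.
Qed.

(** A separating triangle through [uv] would have a side inside [A] that avoids [u], contrary to
    minimality. *)
Lemma mincut_simple T A u v : mincut T A -> u \in A -> e u v -> simple u v.
Proof.
move=> [cA mA] uA uv; case: (simple_or_cut uv) => // -[T2 [A2 [c2 uT2 _]]].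
have [A3 [c3 s u3]] := nested_cut cA uA c2 uT2.
by rewrite (mA _ _ c3 s) uA in u3.
Qed.

(** At each corner of [T] the two other corners are common neighbours with [u], hence the apexes of
    the simple edge from [u]. So the link of [u] is [T], and [[set u]] is a side contained in
    [A]. *)
Lemma mincut_full T A u : mincut T A -> u \in A -> (forall t, t \in T -> e u t) ->
  A = [set u] /\ #|nbrs u| = 3.
Proof.
move=> mA uA uT; have [[T3 Tcl _ _ Acl] minA] := mA.
have NT : nbrs u = T.
  apply/eqP; rewrite eqEsubset; apply/andP; split; last first.
    by apply/subsetP => t /uT; rewrite inE.
  have [t tT] : exists t, t \in T by apply/card_gt0P; rewrite T3.
  apply/subsetP => w; rewrite inE.
  apply: (tm_link M (S := mem T)) (uT t tT) tT => w' uw' /= w'T.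
  have /simpleP sw := mincut_simple mA uA uw'.
  have : T :\ w' \subset [set nx u w'; nx w' u].
    apply/subsetP => t'; rewrite !inE => /andP[t'w' t'T].
    by case: (sw t') => [||->|->]; rewrite ?eqxx ?orbT //; [exact: uT|apply: Tcl;
      rewrite // eq_sym].
  move/subset_leqif_cards => -[_]; rewrite cards2 tm_apex_neq //.
  have := cardsD1 w' T; rewrite T3 w'T add1n => -[<-] /esym/eqP/setP/(_ (nx u w')).
  by rewrite !inE eqxx => /andP[].
have u3 : #|nbrs u| = 3 by rewrite NT.
split=> //; apply/esym; apply: minA (deg3_cut u3) _.
by rewrite sub1set.
Qed.

End Cuts.

(** * Contraction *)

Section Contraction.

Variables (V : finType) (e : rel V) (nx : V -> V -> V).
Hypothesis M : triangular_map e nx.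
Hypothesis V5 : 4 < #|V|.
Variables u v : V.
Hypotheses (uv : e u v) (s_uv : simple e nx u v).

Let e_sym := tm_sym M.
Let e_irr := tm_irr M.

Local Notation W := {x : V | x != v}.
Let e' : rel W := contract_rel u e.

Let u_v : u != v. Proof. exact: edge_neq uv. Qed.
Let vu : e v u. Proof. by rewrite e_sym. Qed.

(** The quotient map: the default value of [insubd] is what sends [v] to [u]. *)
Definition collapse (x : V) : W := insubd (exist _ u u_v : W) x.

Lemma val_collapse x : val (collapse x) = if x == v then u else x.
Proof. by rewrite /collapse val_insubd /=; case: (x == v). Qed.

Lemma collapseK (x : W) : collapse (val x) = x.
Proof. by apply: val_inj; rewrite val_collapse (negPf (valP x)). Qed.

Lemma collapse_eq x y : collapse x = collapse y ->
  [\/ x = y, (x = u /\ y = v) | (x = v /\ y = u)].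
Proof.
move/(congr1 val); rewrite !val_collapse.
have [->|xv] := eqVneq x v; have [->|yv] := eqVneq y v => E.
- by constructor 1.
- by constructor 3.
- by constructor 2.
- by constructor 1.
Qed.

Lemma collapse_uv : collapse u = collapse v.
Proof. by apply: val_inj; rewrite !val_collapse eqxx (negPf u_v). Qed.

Lemma contract_rel_sym (r : rel V) : symmetric r -> symmetric (contract_rel (v := v) u r).
Proof.
move=> r_sym x y; rewrite /contract_rel eq_sym r_sym (r_sym v (val y)) (r_sym (val x) v).
by congr (_ && (_ || _)); rewrite orbC.
Qed.

Lemma contract_rel_collapse (r : rel V) x y : symmetric r ->
  r x y -> collapse x != collapse y -> contract_rel u r (collapse x) (collapse y).
Proof.
move=> r_sym rxy nxy; rewrite /contract_rel nxy !val_collapse /=; move: nxy rxy.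
have [->|xv] := eqVneq x v; have [->|yv] := eqVneq y v; rewrite ?eqxx ?orbT //.
- by move=> _ ->; rewrite !orbT.
- by move=> _ ->; rewrite !orbT.
- by move=> _ ->.
Qed.

Lemma contract_relP (r : rel V) (x y : W) : contract_rel u r x y ->
  exists x0 y0, [/\ r x0 y0, collapse x0 = x & collapse y0 = y].
Proof.
case/andP=> _ /or3P[rxy|/andP[/eqP xu ry]|/andP[/eqP yu rx]].
- by exists (val x), (val y); rewrite !collapseK.
- by exists v, (val y); rewrite collapseK -collapse_uv -xu collapseK.
- by exists (val x), v; rewrite collapseK -collapse_uv -yu collapseK.
Qed.

Let a := nx v u.
Let b := nx u v.

Let ab : a != b. Proof. by rewrite /a /b eq_sym (tm_apex_neq M V5). Qed.
Let va : e v a. Proof. exact: (tm_next M). Qed.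
Let ua : e u a. Proof. exact: (tm_next' M). Qed.
Let ub : e u b. Proof. exact: (tm_next M). Qed.
Let vb : e v b. Proof. exact: (tm_next' M). Qed.
Let nx_av : nx a v = u. Proof. exact: (tm_nextK M). Qed.
Let nx_ua : nx u a = v. Proof. exact: (tm_nextK' M). Qed.
Let nx_bu : nx b u = v. Proof. exact: (tm_nextK M). Qed.
Let nx_vb : nx v b = u. Proof. exact: (tm_nextK' M). Qed.

Let common w : e u w -> e v w -> w = a \/ w = b.
Proof. by move=> uw vw; case: (simpleP s_uv uw vw); auto. Qed.

(* The darts of the two triangles on the contracted edge. *)
Let flat : seq (V * V) := [:: (u, v); (v, a); (a, u); (v, u); (u, b); (b, v)].
Let kept d := dart e d && (d \notin flat).
Let phi (d : V * V) := (d.2, nx d.2 d.1).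

Let phi_kept d : kept d -> kept (phi d).
Proof.
case: d => x y /andP[xy nd]; have yx : e y x by rewrite e_sym.
rewrite /kept /dart /= (tm_next M xy) /=.
apply: contra nd => nd.
have {nd} : phi (phi (phi (x, y))) \in flat.
  have [/= p d3] : phi (phi (x, y)) = (nx y x, x) /\ phi (nx y x, x) = (x, y).
    rewrite /phi /= (tm_nextK M xy); split=> //; congr pair.
    by have := tm_nextK M (tm_next M xy); rewrite (tm_nextK M xy).
  have cl d : d \in flat -> phi d \in flat.
    rewrite /flat !inE => /orP[|/orP[|/orP[|/orP[|/orP[]]]]] /eqP ->;
    by rewrite /phi /= -?/a -?/b ?nx_av ?nx_ua ?nx_bu ?nx_vb ?eqxx ?orbT.
  exact/cl/cl.
rewrite /phi /= (tm_nextK M xy).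
by have := tm_nextK M (tm_next M xy); rewrite (tm_nextK M xy) => ->.
Qed.

(** Two darts with the same image join [u] and [v] to a common neighbour, which is [a] or [b]
    because [uv] is simple; one of the two darts is flat. *)
Let kept_inj x y x' y' : kept (x, y) -> kept (x', y') ->
  collapse x = collapse x' -> collapse y = collapse y' -> x = x' /\ y = y'.
Proof.
rewrite /kept /dart /= /flat !inE !xpair_eqE.
move=> /andP[+ +] /andP[+ +] /collapse_eq cx /collapse_eq cy.
case: cx => [->|[-> ->]|[-> ->]]; case: cy => [->|[-> ->]|[-> ->]] //;
  rewrite ?e_irr // !eqxx ?(negPf u_v) ?[v == u]eq_sym ?(negPf u_v) //= ?orbT //;
  move=> xy n1 xy' n2; exfalso.
- rewrite e_sym in xy; rewrite e_sym in xy'; case: (common xy xy') => E;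
  by move: n1 n2; rewrite E !eqxx /= ?andbF ?orbT.
- rewrite e_sym in xy; rewrite e_sym in xy'; case: (common xy' xy) => E;
  by move: n1 n2; rewrite E !eqxx /= ?andbF ?orbT.
- by case: (common xy xy') => E; move: n1 n2; rewrite E !eqxx /= ?andbF ?orbT.
- by case: (common xy' xy) => E; move: n1 n2; rewrite E !eqxx /= ?andbF ?orbT.
Qed.

Let kept_contract x y : kept (x, y) -> e' (collapse x) (collapse y).
Proof.
rewrite /kept /flat => /andP[xy nd]; apply: contract_rel_collapse => //.
apply/eqP => /collapse_eq[E|[E1 E2]|[E1 E2]]; first by move: xy; rewrite /dart /= E e_irr.
  by rewrite E1 E2 !inE eqxx in nd.
by rewrite E1 E2 !inE eqxx !orbT in nd.
Qed.

(** A flat dart between [a] or [b] and one of [u], [v] has the same image as the dart with [u] and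
    [v] exchanged, and that one is kept. *)
Let kept_cover (x y : W) : e' x y ->
  exists x0 y0, [/\ kept (x0, y0), collapse x0 = x & collapse y0 = y].
Proof.
move=> xy; have [x0 [y0 [xy0 cx cy]]] := contract_relP xy.
have ncxy : collapse x0 != collapse y0 by rewrite cx cy; case/andP: xy.
case: (boolP ((x0, y0) \in flat)) => nd; last by exists x0, y0; rewrite /kept /dart /= xy0 nd.
have av : e a v by rewrite e_sym.
have bu : e b u by rewrite e_sym.
have na w : e w a -> (w == a) = false by move=> /(edge_neq e_irr)/negPf.
move: nd; rewrite /flat !inE !xpair_eqE => /orP[|/orP[|/orP[|/orP[|/orP[]]]]] /andP[/eqP h1
  /eqP h2];
  subst x0 y0; rewrite ?collapse_uv ?eqxx // in ncxy.
- exists u, a; rewrite collapse_uv; split=> //.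
  rewrite /kept /dart /= ua !inE !xpair_eqE eqxx (negPf u_v) (negPf ab) /=.
  by rewrite ![a == _]eq_sym (na _ ua) (na _ va) !andbF.
- exists a, v; rewrite -collapse_uv; split=> //.
  rewrite /kept /dart /= av !inE !xpair_eqE eqxx (negPf ab) ![v == _]eq_sym (negPf u_v) /=.
  by rewrite ![a == _]eq_sym (na _ ua) (na _ va) !andbF.
- exists v, b; rewrite -collapse_uv; split=> //.
  rewrite /kept /dart /= vb !inE !xpair_eqE eqxx [b == a]eq_sym (negPf ab) ![v == _]eq_sym
    (negPf u_v) /=.
  have nb w : e w b -> (b == w) = false by rewrite eq_sym => /(edge_neq e_irr)/negPf.
  by rewrite (nb _ ub) (nb _ vb) !andbF.
- exists b, u; rewrite collapse_uv; split=> //.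
  have nb w : e w b -> (b == w) = false by rewrite eq_sym => /(edge_neq e_irr)/negPf.
  rewrite /kept /dart /= bu !inE !xpair_eqE eqxx [b == a]eq_sym (negPf ab) (negPf u_v) /=.
  by rewrite (nb _ ub) (nb _ vb) !andbF.
Qed.

(** Read off at the only kept dart over [(x, y)]; where there is none, [x] is a default value. *)
Definition contract_next (y x : W) : W :=
  if [pick d | [&& kept d, collapse d.1 == x & collapse d.2 == y]] is Some d
  then collapse (nx d.2 d.1) else x.

Let contract_nextE x y : kept (x, y) ->
  contract_next (collapse y) (collapse x) = collapse (nx y x).
Proof.
move=> xy; rewrite /contract_next; case: pickP => [[x0 y0]|] /=.
  by case/and3P=> k0 /eqP cx /eqP cy; have [-> ->] := kept_inj k0 xy cx cy.
by move/(_ (x, y)); rewrite xy !eqxx.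
Qed.

Let flat_uniq : uniq flat.
Proof.
have nb w : e w b -> (b == w) = false by rewrite eq_sym => /(edge_neq e_irr)/negPf.
have nb' w : e w b -> (w == b) = false by move=> /(edge_neq e_irr)/negPf.
have na w : e w a -> (a == w) = false by rewrite eq_sym => /(edge_neq e_irr)/negPf.
have na' w : e w a -> (w == a) = false by move=> /(edge_neq e_irr)/negPf.
rewrite /flat /= !inE !xpair_eqE !eqxx (negPf u_v) ![v == u]eq_sym (negPf u_v).
by rewrite !(na u, na v, na' u, na' v, nb u, nb v, nb' u, nb' v) //= (negPf ab) ?andbF.
Qed.

Let card_kept : #|[pred d | kept d]| + 6 = #|dart e|.
Proof.
rewrite -(cardID (mem flat) (dart e)) addnC; congr (_ + _).
  rewrite -[LHS](card_uniqP flat_uniq); apply: eq_card => d.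
  apply/idP/andP => [dF|[]//]; split=> //; move: dF.
  rewrite /flat !inE => /orP[|/orP[|/orP[|/orP[|/orP[]]]]] /eqP ->;
  by rewrite /in_mem /= /dart /= // e_sym.
by apply: eq_card => d; exact: andbC.
Qed.

Let card_contract : #|dart e'| + 6 = #|dart e|.
Proof.
rewrite -card_kept; congr (_ + _).
rewrite -(card_in_imset (f := fun d => (collapse d.1, collapse d.2))).
  apply: eq_card => -[x y]; apply/idP/imsetP => [/kept_cover[x0 [y0 [k cx cy]]]|].
    by exists (x0, y0) => //; rewrite cx cy.
  by case=> -[x0 y0] k [xE yE]; rewrite -[_ \in _]/(e' x y) xE yE; exact: kept_contract.
move=> [x y] [x' y'] k k' E; have [-> ->] // := kept_inj k k' (congr1 fst E) (congr1 snd E).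
Qed.

(** The neighbours of the merged vertex form one cycle: around [u] from [b] to [a], then around [v]
    from [a] back to [b]. *)
Let contract_link (y : W) (S : pred W) p q :
  (forall w, e' y w -> S w -> S (contract_next y w)) ->
  e' y p -> S p -> e' y q -> S q.
Proof.
move=> cl; have e'_sym : symmetric e' := contract_rel_sym e_sym.
have step w y0 : kept (w, y0) -> collapse y0 = y -> S (collapse w) -> S (collapse (nx y0 w)).
  move=> k cy Sw; rewrite -contract_nextE // cy; apply: cl => //.
  by rewrite -cy e'_sym; exact: kept_contract.
rewrite [e' y p]e'_sym [e' y q]e'_sym.
move=> /kept_cover[p0 [yp [kp <- cyp]]] Sp /kept_cover[q0 [yq [kq <- cyq]]].
have [yu|yu] := eqVneq (val y) u; last first.
  have lift y0 : collapse y0 = y -> y0 = val y.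
    by move/(congr1 val); rewrite val_collapse; case: eqP => // _ E; rewrite E eqxx in yu.
  have yv : val y != v := valP y.
  have [eyp eyq] : e (val y) p0 /\ e (val y) q0.
    move: kp kq; rewrite (lift _ cyp) (lift _ cyq) /kept /dart /= => /andP[h _] /andP[h' _].
    by rewrite !(e_sym (val y)).
  apply: (tm_link M (S := fun w => S (collapse w))) eyp Sp eyq => w yw Sw.
  case: (boolP ((w, val y) \in flat)) => nd; last first.
    by apply: step; rewrite ?collapseK // /kept /dart /= e_sym yw.
  move: nd; rewrite /flat !inE !xpair_eqE (negPf yu) (negPf yv) !andbF /= !orbF.
  case/orP=> /andP[/eqP wE /eqP yE]; rewrite yE wE ?nx_av ?nx_bu in Sw *.
    by rewrite collapse_uv.
  by rewrite -collapse_uv.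
have cyu : collapse u = y by rewrite -yu collapseK.
have cyv : collapse v = y by rewrite -collapse_uv.
have stepU w : e u w -> w != v -> w != a -> S (collapse w) -> S (collapse (nx u w)).
  move=> uw wv wa; apply: step => //; rewrite /kept /dart /= e_sym uw.
  by rewrite /flat !inE !xpair_eqE (negPf wv) (negPf wa) (negPf u_v) !(negPf (edge_neq e_irr
    ub), negPf (edge_neq e_irr ua)) !andbF.
have stepV w : e v w -> w != u -> w != b -> S (collapse w) -> S (collapse (nx v w)).
  move=> vw wu wb; apply: step => //; rewrite /kept /dart /= e_sym vw.
  by rewrite /flat !inE !xpair_eqE (negPf wu) (negPf wb) [v == u]eq_sym (negPf u_v) !(negPf
    (edge_neq e_irr vb), negPf (edge_neq e_irr va)) !andbF.
(* Turning around [u] from any neighbour but [v], one meets [a] before [v]. *)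
have HU w : e u w -> w != v -> S (collapse w) -> S (collapse a).
  move=> uw wv Sw; apply: contraT => nSa.
  suff : (v != v) && S (collapse v) by rewrite eqxx.
  apply: (tm_link M (x := u) (S := fun w => (w != v) && S (collapse w))) uw _ uv;
    last by rewrite wv.
  move=> w' uw' /andP[w'v Sw']; have w'a : w' != a by apply: contraNneq nSa => <-.
  rewrite stepU // andbT; apply: contra w'a => /eqP E; apply/eqP.
  by apply: (tm_inj M uw' ua); rewrite nx_ua.
have HV w : e v w -> w != u -> S (collapse w) -> S (collapse b).
  move=> vw wu Sw; apply: contraT => nSb.
  suff : (u != u) && S (collapse u) by rewrite eqxx.
  apply: (tm_link M (x := v) (S := fun w => (w != u) && S (collapse w))) vw _ vu;
    last by rewrite wu.
  move=> w' vw' /andP[w'u Sw']; have w'b : w' != b by apply: contraNneq nSb => <-.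
  rewrite stepV // andbT; apply: contra w'b => /eqP E; apply/eqP.
  by apply: (tm_inj M vw' vb); rewrite nx_vb.
have split_y w y0 : kept (w, y0) -> collapse y0 = y -> (e u w /\ w != v) \/ (e v w /\ w != u).
  move=> k; rewrite -cyu => /collapse_eq[E|[_ E]|[E _]]; first last.
  - move: k; rewrite E /kept /dart /flat /= => /andP[h nd].
    right; rewrite e_sym; split=> //; apply: contraNneq nd => ->; by rewrite !inE eqxx.
  - by move: u_v; rewrite E eqxx.
  - move: k; rewrite E /kept /dart /flat /= => /andP[h nd].
    left; rewrite e_sym; split=> //; apply: contraNneq nd => ->; by rewrite !inE eqxx !orbT.
have [Sa Sb] : S (collapse a) /\ S (collapse b).
  have au : a != u by rewrite eq_sym (edge_neq e_irr ua).
  have bv : b != v by rewrite eq_sym (edge_neq e_irr vb).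
  case: (split_y _ _ kp cyp) => -[h1 h2].
    by have Sa := HU _ h1 h2 Sp; split=> //; exact: HV Sa.
  by have Sb := HV _ h1 h2 Sp; split=> //; exact: HU Sb.
case: (split_y _ _ kq cyq) => -[h1 h2].
  have : (q0 == v) || S (collapse q0).
    apply: (tm_link M (S := fun w => (w == v) || S (collapse w))) uv _ h1; last by rewrite eqxx.
    move=> w uw; have [->|wv] := eqVneq w v; first by rewrite Sb orbT.
    have [->|wa /= Sw] := eqVneq w a; first by rewrite nx_ua eqxx.
    by rewrite stepU ?orbT.
  by rewrite (negPf h2).
have : (q0 == u) || S (collapse q0).
  apply: (tm_link M (S := fun w => (w == u) || S (collapse w))) vu _ h1; last by rewrite eqxx.
  move=> w vw; have [->|wu] := eqVneq w u; first by rewrite Sa orbT.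
  have [->|wb /= Sw] := eqVneq w b; first by rewrite nx_vb eqxx.
  by rewrite stepV ?orbT.
by rewrite (negPf h2).
Qed.

Lemma card_contract_type : #|(W : finType)|.+1 = #|V|.
Proof.
rewrite card_sig; have := cardC1 v; rewrite (_ : #|predC1 v| = #|[pred x | x != v]|) // => ->.
by rewrite prednK //; apply: leq_trans V5.
Qed.

(** One vertex and the six darts of two faces disappear, so the relation between the numbers of
    darts and vertices persists. *)
Lemma contract_triangular_map : triangular_map e' contract_next.
Proof.
have e'_sym : symmetric e' := contract_rel_sym e_sym; split=> //.
- by move=> x; rewrite /e' /contract_rel eqxx.
- move=> x y /kept_cover[x0 [y0 [k <- <-]]]; have k' := phi_kept k.
  rewrite contract_nextE //; split; first exact: kept_contract k'.
  by rewrite (contract_nextE k') (tm_nextK M) //; case/andP: k.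
- move=> S x y cl Sx; rewrite -(collapseK y).
  apply: (tm_conn M (S := fun z => S (collapse z)) (x := val x)); last by rewrite collapseK.
  move=> z w Sz zw; have [<-//|nzw] := eqVneq (collapse z) (collapse w).
  by apply: cl Sz _; exact: contract_rel_collapse.
- have := card_contract; have := tm_card M; have := card_contract_type;
  rewrite /reverse_coercion; lia.
- have := card_contract_type; have := V5; rewrite /reverse_coercion; lia.
Qed.

End Contraction.

(** * Irreducible braced triangulations *)

Section Recognition.

Variables (V : finType) (e B : rel V).
Hypotheses (e_sym : symmetric e) (e_irr : irreflexive e).

(** For the bases on six vertices it replaces a proof of pairwise distinctness, since at least six
    vertices are known to exist. *)
Lemma uniq_of_card (s : seq V) : (forall x, x \in s) -> size s <= #|V| -> uniq s.
Proof.
move=> all_s sV; have : #|s| = #|V| by apply: eq_card => x; rewrite all_s.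
by move=> E; apply/card_uniqP/eqP; rewrite eqn_leq card_size E sV.
Qed.

(* Adjacency is given by the full neighbourhoods [rows] of some vertices and
   by the [pairs] of remaining vertices, all of which are adjacent or not as
   indicated. *)
Definition pattern_ok (E Br : seq (nat * nat)) n rows (pairs : seq (nat * nat * bool))
    (k1 k2 k3 k4 : nat) : bool :=
  let known (i j : nat) (b : bool) :=
    has (fun r => (r.1 == i) && ((j \in r.2) == b)) rows || ((i, j, b) \in pairs) in
  all (fun i => all (fun j =>
    [&& (i == j) && ~~ (((i, j) \in E) || ((j, i) \in E)) ||
        (let b := ((i, j) \in E) || ((j, i) \in E) in known i j b || known j i b) &
     (((i, j) \in Br) || ((j, i) \in Br)) ==
       [|| (i == k1) && (j == k2), (i == k2) && (j == k1),
           (i == k3) && (j == k4) | (i == k4) && (j == k3)]])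
    (iota 0 n)) (iota 0 n)
  && all (fun r => all (fun k => k < n) (r.1 :: r.2)) rows
  && all (fun k => k < n) [:: k1; k2; k3; k4].

Lemma isomorphic_pattern (s : seq V) x0 n E Br rows pairs k1 k2 k3 k4 :
  size s = n -> uniq s -> (forall x, x \in s) ->
  foldr (fun r Q => (forall w, e (nth x0 s r.1) w = (w \in map (nth x0 s) r.2)) /\ Q)
    True rows ->
  foldr (fun p Q => e (nth x0 s p.1.1) (nth x0 s p.1.2) = p.2 /\ Q) True pairs ->
  (forall x y, B x y =
    ([set x; y] == [set nth x0 s k1; nth x0 s k2]) ||
    ([set x; y] == [set nth x0 s k3; nth x0 s k4])) ->
  pattern_ok E Br n rows pairs k1 k2 k3 k4 ->
  isomorphic (bigraph_of n E Br) (BiGraph e B).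
Proof.
move=> sn us all_s Hrows Hpairs HB /andP[/andP[/allP ok /allP okr] /and5P[l1 l2 l3 l4 _]].
have inj i j : i < n -> j < n -> (nth x0 s i == nth x0 s j) = (i == j).
  by move=> li lj; rewrite nth_uniq // sn.
have row_in r : r \in rows -> forall w, e (nth x0 s r.1) w = (w \in map (nth x0 s) r.2).
  by elim: rows Hrows {ok okr} => //= r' l IH [h /IH{}IH]; rewrite inE => /orP[/eqP->|/IH].
have pair_in p : p \in pairs -> e (nth x0 s p.1.1) (nth x0 s p.1.2) = p.2.
  by elim: pairs Hpairs {ok} => //= r' l IH [h /IH{}IH]; rewrite inE => /orP[/eqP->|/IH].
have known i j b : i < n -> j < n ->
    has (fun r => (r.1 == i) && ((j \in r.2) == b)) rows || ((i, j, b) \in pairs) ->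
    e (nth x0 s i) (nth x0 s j) = b.
  move=> li lj /orP[/hasP[r rin /andP[/eqP <- /eqP <-]]|/pair_in //].
  rewrite row_in //; apply/mapP/idP => [[k kr /eqP]|jr]; last by exists j.
  have /allP/(_ k) := okr r rin; rewrite inE kr orbT => /(_ isT) lk.
  by rewrite inj // => /eqP ->.
exists (fun i : 'I_n => nth x0 s i).
  apply: inj_card_bij; first by move=> i j /eqP; rewrite inj // => /eqP /val_inj.
  rewrite card_ord -sn -(card_uniqP us); apply: subset_leq_card; exact/subsetP.
move=> i j /=; have iio : (i : nat) \in iota 0 n by rewrite mem_iota add0n ltn_ord.
have jio : (j : nat) \in iota 0 n by rewrite mem_iota add0n ltn_ord.
have /andP[okE /eqP okB] := allP (ok _ iio) _ jio; split.
  case/orP: okE => [/andP[/eqP ij /negPf ->]|/orP[]]; first by rewrite ij e_irr.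
    by apply: known.
  by rewrite e_sym; apply: known.
rewrite okB HB; apply/orP/or4P.
  case=> /eqP/set2_eq[] [/eqP + /eqP]; rewrite !inj // => -> ->.
  - by constructor 1.
  - by constructor 2.
  - by constructor 3.
  - by constructor 4.
by case=> /andP[/eqP -> /eqP ->]; rewrite ?eqxx; auto; [left|right]; rewrite setUC.
Qed.

End Recognition.

(** * Brace ends and separating triangles *)

Section Irreducible.

Variables (V : finType) (e B : rel V) (nx : V -> V -> V).
Hypothesis M : triangular_map e nx.
Hypothesis V6 : 5 < #|V|.
Hypotheses (B_sym : symmetric B) (B_irr : irreflexive B).
Hypothesis B_nonadj : forall x y, B x y -> ~~ e x y.

(** For an edge [uv]: some 3-cycle through it contains a brace, which cannot be [uv] and so ends at
    the third vertex [w]. *)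
Definition braced_edge u v : Prop :=
  exists w, [/\ e u w || B u w, e v w || B v w & B u w || B v w].

Hypothesis irred : forall u v, e u v -> simple e nx u v -> braced_edge u v.

Let e_sym := tm_sym M.
Let e_irr := tm_irr M.
Let V5 : 4 < #|V| := ltnW V6.

Implicit Types (A T Y : {set V}).

Local Notation N := (nbrs e).
Local Notation simple := (simple e nx).
Local Notation cut := (cut e).
Local Notation deg3 p := (#|nbrs e p| = 3).

Definition braces p q c d : Prop :=
  (forall x y, B x y = ([set x; y] == [set p; q]) || ([set x; y] == [set c; d])) /\
  [set p; q] <> [set c; d].

Definition ends p q c d : {set V} := p |: (q |: [set c; d]).

Lemma bracesC p q c d : braces p q c d -> braces c d p q.
Proof. by case=> h n; split=> [x y|E]; [rewrite h orbC | case: n]. Qed.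

Lemma bracesCl p q c d : braces p q c d -> braces q p c d.
Proof. by rewrite /braces [[set q; p]]setUC. Qed.

Lemma braces1 p q c d : braces p q c d -> B p q.
Proof. by case=> -> _; rewrite eqxx. Qed.

Lemma braces2 p q c d : braces p q c d -> B c d.
Proof. by move/bracesC/braces1. Qed.

Lemma braces_ends p q c d x y : braces p q c d -> B x y -> x \in ends p q c d.
Proof.
case=> -> _ /orP[]/eqP/set2_eq[] [-> _];
by rewrite !inE eqxx ?orbT.
Qed.

Lemma card_ends p q c d : #|ends p q c d| <= 4.
Proof. by rewrite !cardsU1 cards1; lia. Qed.

Lemma braces_of p q c d u v : braces p q c d -> B u v -> exists c' d', braces u v c' d'.
Proof.
move=> br; have [h _] := br; rewrite h => /orP[]/eqP/set2_eq[] [-> ->].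
- by exists c, d.
- by exists c, d; exact: bracesCl.
- by exists p, q; exact: bracesC.
- by exists p, q; exact/bracesCl/bracesC.
Qed.

Lemma simple_sym u v : simple u v -> simple v u.
Proof.
move=> s; apply/forallP => w; apply/implyP => /andP[vw uw].
by case: (simpleP s uw vw) => ->; rewrite eqxx ?orbT.
Qed.

Lemma braced_edge_ends p q c d u v : braces p q c d -> braced_edge u v ->
  (u \in ends p q c d) || (v \in ends p q c d).
Proof.
by move=> br [w [_ _ /orP[]]] /(braces_ends br) ->; rewrite ?orbT.
Qed.

Lemma simple_ends p q c d u v : braces p q c d -> e u v -> simple u v ->
  (u \in ends p q c d) || (v \in ends p q c d).
Proof. by move=> br uv s; apply: braced_edge_ends br (irred uv s). Qed.

(** An edge at a vertex of [A] is simple, hence lies in a 3-cycle with a brace. If no end of the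
    brace were in [A], both would be corners of [T] and therefore adjacent. *)
Lemma mincut_has_end p q c d T A : braces p q c d -> mincut e T A ->
  exists2 r, r \in A & r \in ends p q c d.
Proof.
move=> br mA; have [[_ Tcl [u uA] _ Acl] _] := mA.
have [v uv] := has_nbr M V5 u.
have [w [uw vw]] := irred uv (mincut_simple M V5 mA uA uv).
case Buw: (B u w); first by exists u => //; exact: braces_ends br Buw.
rewrite Buw orbF in uw *; rewrite /= => Bvw.
have := (Acl u uA).2 v uv; rewrite inE => /orP[vA|vT].
  by exists v => //; exact: braces_ends br Bvw.
have Bwv : B w v by rewrite B_sym.
have := (Acl u uA).2 w uw; rewrite inE => /orP[wA|wT].
  by exists w => //; exact: braces_ends br Bwv.
have := B_nonadj Bvw; rewrite (Tcl v w) //.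
by apply: contraTneq Bvw => ->; rewrite B_irr.
Qed.

Lemma deg_ge4 u : ~ deg3 u -> 4 <= #|N u|.
Proof. by move/eqP; have := nbrs_ge3 M V5 u; lia. Qed.

(** If all degrees in [A] were at least 4, then [A] would consist of ends other than [r], each with
    at most two neighbours in [T] and so at least two in [A]. This makes [A] a triangle on three of
    four distinct ends, and one of the two braces would join two of its corners. *)
Lemma mincut_deg3 p q c d T A r : braces p q c d -> mincut e T A ->
  r \in ends p q c d -> r \notin A -> (forall u, u \in A -> ~~ e u r) ->
  exists x, [/\ x \in A, deg3 x & x \in ends p q c d].
Proof.
move=> br mA rS rA nr; have [u0 u0A u0S] := mincut_has_end br mA.
have [[T3 Tcl _ _ Acl] minA] := mA.
case: (boolP [exists u, (u \in A) && (#|N u| == 3)]) => [/existsP[u /andP[uA /eqP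
  u3]]|/existsPn n3].
  have E : [set u] = A by apply: minA (deg3_cut M V5 u3) _; rewrite sub1set.
  by move: u0A; rewrite -E inE => /eqP Eu; rewrite Eu in u0S; exists u; rewrite inE eqxx.
have {}n3 u : u \in A -> 4 <= #|N u|.
  by move=> uA; apply: deg_ge4 => u3; have := n3 u; rewrite uA u3.
exfalso; pose S' := ends p q c d :\ r.
have S'3 : #|S'| <= 3.
  by have := cardsD1 r (ends p q c d); rewrite rS -/S'; have := card_ends p q c d; lia.
have AS : A \subset S'.
  apply/subsetP => z zA; apply: contraT => zS'.
  have zS : z \notin ends p q c d.
    by move: zS'; rewrite !in_setD1 negb_and negbK => /orP[/eqP E|//]; rewrite -E zA in rA.
  have := n3 z zA; suff : #|N z| <= #|S'| by lia.
  apply: subset_leq_card; apply/subsetP => w; rewrite inE => zw.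
  have := simple_ends br zw (mincut_simple M V5 mA zA zw); rewrite (negPf zS) /= => wS.
  by rewrite !in_setD1 wS andbT; apply: contraTneq zw => ->; exact: nr.
(* By [mincut_full], [u] misses a corner of [T], as its degree is not 3. *)
have degA u : u \in A -> #|N u| <= #|(A :\ u) :&: N u| + 2.
  move=> uA; have [t tT nut] : exists2 t, t \in T & ~~ e u t.
    apply/exists_inP; apply: contraT => /exists_inPn h.
    have uT t : t \in T -> e u t by move=> /h; rewrite negbK.
    have [_ u3] := mincut_full M V5 mA uA uT; by have := n3 u uA; rewrite u3.
  have : #|N u| <= #|(A :\ u) :&: N u| + #|T :\ t|.
    rewrite -cardsUI; apply: leq_trans (leq_addr _ _); apply: subset_leq_card.
    apply/subsetP => w; rewrite inE => uw; have := (Acl u uA).2 w uw.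
    rewrite !inE uw andbT eq_sym (edge_neq e_irr uw) /= => /orP[->//|->].
    by rewrite andbT orbC; apply/orP; left; apply: contraNneq nut => <-.
  by have := cardsD1 t T; rewrite tT T3; lia.
have A3 : 3 <= #|A|.
  have := degA u0 u0A; have := n3 u0 u0A; have := cardsD1 u0 A; rewrite u0A.
  have := subset_leq_card (subsetIl (A :\ u0) (N u0)); lia.
have AE : A = S' by apply/eqP; rewrite eqEcard AS; lia.
have brc x y : B x y -> x \in A -> y \in A -> False.
  move=> Bxy xA yA; have yx : y != x by apply: contraTneq Bxy => ->; rewrite B_irr.
  have : #|(A :\ x) :&: N x| <= #|A :\ x :\ y|.
    apply: subset_leq_card; apply/subsetP => w; rewrite !inE => /andP[/andP[wx wA] xw].
    rewrite wx wA andbT !andbT; by apply: contraTneq xw => ->; exact: B_nonadj.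
  have := cardsD1 y (A :\ x); have := cardsD1 x A; rewrite !inE xA yA yx.
  have := degA x xA; have := n3 x xA; have : #|A| <= 3 by rewrite AE.
  by rewrite /=; lia.
have SA x : x != r -> x \in ends p q c d -> x \in A.
  by move=> xr xS; rewrite AE in_setD1 xr xS.
have Sp : p \in ends p q c d by rewrite !inE eqxx.
have Sq : q \in ends p q c d by rewrite !inE eqxx orbT.
have Sc : c \in ends p q c d by rewrite !inE eqxx !orbT.
have Sd : d \in ends p q c d by rewrite !inE eqxx !orbT.
have S4 : 4 <= #|ends p q c d|.
  have := cardsD1 r (ends p q c d); rewrite rS -/S' -AE; lia.
have distinct x y z : (ends p q c d) \subset x |: [set y; z] -> False.
  by move/subset_leq_card/(leq_trans S4); rewrite cardsU1 cards2; case: (_ \notin _);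
    case: (_ != _).
have [pr|pr] := eqVneq p r; last first.
  have [qr|qr] := eqVneq q r; last by apply: (brc p q (braces1 br)); exact: SA.
  have cr : c != r.
    apply/eqP => cr; apply: (distinct p r d); apply/subsetP => x.
    by rewrite !inE qr cr => /or4P[] ->; rewrite ?orbT.
  have dr : d != r.
    apply/eqP => cr'; apply: (distinct p r c); apply/subsetP => x.
    by rewrite !inE qr cr' => /or4P[] ->; rewrite ?orbT.
  by apply: (brc c d (braces2 br)); exact: SA.
have cr : c != r.
  apply/eqP => cr; apply: (distinct q r d); apply/subsetP => x.
  by rewrite !inE pr cr => /or4P[] ->; rewrite ?orbT.
have dr : d != r.
  apply/eqP => cr'; apply: (distinct q r c); apply/subsetP => x.
  by rewrite !inE pr cr' => /or4P[] ->; rewrite ?orbT.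
by apply: (brc c d (braces2 br)); exact: SA.
Qed.

(** The side opposite to [A] contains a brace end as well, which has no neighbour in [A]: this is
    the [r] of [mincut_deg3]. *)
Lemma cut_deg3 p q c d T A : braces p q c d -> cut T A ->
  exists x, [/\ x \in A, deg3 x & x \in ends p q c d].
Proof.
move=> br cA; have [T0 [A0 [m0 s0]]] := exists_mincut cA.
have [T1 [A1 [m1 s1]]] := exists_mincut (cut_compl M cA).
have [r rA1 rS] := mincut_has_end br m1.
have rAT : r \notin A :|: T by have := subsetP s1 _ rA1; rewrite inE.
have [||x [xA x3 xS]] := mincut_deg3 br m0 rS.
- by apply: contra rAT => /(subsetP s0) rA; rewrite inE rA.
- move=> u /(subsetP s0) uA; apply: contra rAT; have [_ _ _ _ Acl] := cA.
  exact: (Acl u uA).2.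
by exists x; split=> //; exact: (subsetP s0).
Qed.

(** A vertex of degree 3 is alone on one side of the triangle of its neighbours. *)
Lemma deg3_ends p q c d x : braces p q c d -> deg3 x -> x \in ends p q c d.
Proof.
move=> br x3; have [y [+ _ yS]] := cut_deg3 br (deg3_cut M V5 x3).
by rewrite inE => /eqP <-.
Qed.

(** As [wp] and [wq] are simple, the triangles on them with apexes [y] and [z] are faces, and these
    four faces close up around [w]. *)
Lemma four_link w p q y z : e w p -> e w q -> e w y -> e w z ->
  e p y -> e p z -> e q y -> e q z -> p != q -> y != z ->
  simple w p -> simple w q -> forall t, e w t -> t \in [:: y; z; p; q].
Proof.
move=> wp wq wy wz py pz qy qz pq yz sp sq.
have apex x : e w x -> e x y -> e x z -> simple w x ->
    (nx w x = y \/ nx w x = z) /\ (nx x w = y \/ nx x w = z).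
  move=> wx xy xz s; have ne := tm_apex_neq M V5 wx.
  case: (simpleP s wy xy) => Ey; case: (simpleP s wz xz) => Ez;
    by [rewrite Ey Ez eqxx in yz | rewrite -Ey -Ez; auto].
have [p1 p2] := apex p wp py pz sp; have [q1 q2] := apex q wq qy qz sq.
have pw : e p w by rewrite e_sym.
have kp := tm_nextK' M wp; have kq := tm_nextK' M wq.
have ne : nx p w != nx q w by apply: contra pq => /eqP E; rewrite -kp -kq E.
have yzs : [\/ nx p w = y /\ nx q w = z | nx p w = z /\ nx q w = y].
  by case: p2 q2 => p2 [] q2; rewrite p2 q2 ?eqxx in ne *; auto.
move=> t; apply: (tm_link M (S := mem [:: y; z; p; q])) wy _; last by rewrite /= inE eqxx.
move=> v wv; rewrite /= !inE => /or4P[] /eqP ->.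
- by case: yzs => -[<- E2]; rewrite ?kp -?E2 ?kq eqxx ?orbT.
- by case: yzs => -[E1 <-]; rewrite ?kq -?E1 ?kp eqxx ?orbT.
- by case: p1 => ->; rewrite eqxx ?orbT.
- by case: q1 => ->; rewrite eqxx ?orbT.
Qed.

(** Such sets exhaust the graph by [three_connected]; the bound excludes configurations that close
    up on five vertices. *)
Lemma small_closed A Y a : #|Y| <= 2 -> a \in A -> (forall x, x \in A -> x \notin Y) ->
  (forall x y, x \in A -> e x y -> y \in A :|: Y) -> 5 < #|A| + #|Y|.
Proof.
move=> Y2 aA AY Acl; have all z := three_connected M V5 z Y2 aA AY Acl.
have : #|V| <= #|A :|: Y| by apply: subset_leq_card; apply/subsetP => z _.
by rewrite cardsU; lia.
Qed.

Lemma deg3_apex p x : deg3 p -> e p x ->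
  exists y z, [/\ N p = x |: [set y; z], x != y, x != z & y != z] /\
    [/\ e p y, e p z, e x y, e x z & e y z].
Proof.
move=> p3 px; have xp : e x p by rewrite e_sym.
exists (nx p x), (nx x p).
have py := tm_next M xp; have pz := tm_next' M px.
have xy := tm_next' M xp; have xz := tm_next M px.
have yz := tm_apex_neq M V5 px; do 2 split=> //;
  rewrite ?(edge_neq e_irr xy) ?(edge_neq e_irr xz) //.
  apply/setP => w; rewrite !inE; apply/idP/or3P => [pw|[]/eqP->//].
  by case: (deg3_nbrs M V5 p3 px pw) => ->; [constructor 1|constructor 2|constructor 3].
by apply: (deg3_clique M V5 p3); rewrite ?inE.
Qed.

(** Let [x], [y], [z] be the common neighbours. The link of [x] consists of [y], [z], [p], [p'], so
    that [x], [p], [p'] have no neighbours beyond the five vertices. *)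
Lemma no_twins p p' : deg3 p -> deg3 p' -> p != p' -> N p = N p' -> False.
Proof.
move=> p3 p'3 pp' NN; have [x px] := has_nbr M V5 p.
have [y [z [[Np xy xz yz] [py pz exy exz eyz]]]] := deg3_apex p3 px.
have inN t : e p t = e p' t by have /setP/(_ t) := NN; rewrite !inE.
have [p'x p'y p'z] : [/\ e p' x, e p' y & e p' z] by rewrite -!inN.
have xp : e x p by rewrite e_sym.
have xp' : e x p' by rewrite e_sym.
have Nx := four_link xp xp' exy exz py pz p'y p'z pp' yz
  (simple_sym (deg3_simple M V5 p3 px)) (simple_sym (deg3_simple M V5 p'3 p'x)).
have Np_in t : e p t -> [|| t == x, t == y | t == z].
  by have /setP/(_ t) := Np; rewrite !inE => ->.
suff : 5 < #|x |: [set p; p']| + #|[set y; z]| by rewrite cardsU1 !cards2;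
  case: (_ \notin _); case: (_ != _); case: (_ != _).
apply: (@small_closed _ _ x).
- by rewrite cards2; case: (_ != _).
- by rewrite !inE eqxx.
- move=> t; rewrite !inE => /or3P[]/eqP->; rewrite negb_or ?xy ?xz //.
    by rewrite (edge_neq e_irr py) (edge_neq e_irr pz).
  by rewrite (edge_neq e_irr p'y) (edge_neq e_irr p'z).
- move=> s t; rewrite !inE => /or3P[]/eqP-> st.
  + by have := Nx t st; rewrite !inE => /or4P[] ->; rewrite ?orbT.
  + by have /or3P[] := Np_in t st => ->; rewrite ?orbT.
  + by rewrite -inN in st; have /or3P[] := Np_in t st => ->; rewrite ?orbT.
Qed.

(** * Recognising the bases (I) and (III) *)

Lemma braces_neq p q c d : braces p q c d -> p != q.
Proof. by move/braces1 => Bpq; apply: contraTneq Bpq => ->; rewrite B_irr. Qed.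

(** Every edge is simple and has a brace end, so a vertex of [O] is adjacent to exactly the four
    ends. Around [p] the map [nx p] sends [O] injectively to ends other than [p] and [q], that is to
    [c] and [d]. So [O] has two elements and [p] is adjacent to [c] and [d]; likewise [q]. *)
Lemma no_cut_octahedron p q c d : braces p q c d -> (forall T A, ~ cut T A) ->
  isomorphic base_I (BiGraph e B).
Proof.
move=> br nocut; have pq := braces_neq br; have cd := braces_neq (bracesC br).
pose S := ends p q c d; pose O := ~: S.
have all_simple u v : e u v -> simple u v.
  by move=> uv; case: (simple_or_cut M V5 uv) => // -[T [A [/nocut]]].
have deg u : 4 <= #|N u|.
  by apply: deg_ge4 => u3; apply: nocut (deg3_cut M V5 u3).
have NO o : o \in O -> N o = S.
  rewrite inE => oS; apply/eqP; rewrite eqEcard.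
  rewrite (leq_trans (card_ends p q c d) (deg o)) andbT; apply/subsetP => v; rewrite inE => ov.
  by have := simple_ends br ov (all_simple _ _ ov); rewrite (negPf oS).
have SO : #|S| + #|O| = #|V| by rewrite cardsC.
have S4 := card_ends p q c d; rewrite -/S in S4.
have [o oO] : exists o, o \in O by apply/card_gt0P; lia.
have eO v w : w \in O -> e v w = (v \in S) by move=> wO; rewrite -(NO w wO) inE e_sym.
have SE x : (x \in S) = [|| x == p, x == q, x == c | x == d] by rewrite !inE.
have [pS qS cS dS] : [/\ p \in S, q \in S, c \in S & d \in S] by rewrite !SE !eqxx !orbT.
have link x y z w : x \in S -> (forall t, t \in S -> [|| t == x, t == y, t == z | t == w]) ->
    B x y -> #|O| <= #|[set z; w] :&: N x|.
  move=> xS Sxy Bxy.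
  have sub : nx x @: O \subset [set z; w] :&: N x.
    apply/subsetP => _ /imsetP[o' o'O ->].
    have xo' : e x o' by rewrite eO.
    have o'x : e o' x by rewrite e_sym.
    have xn := tm_next M o'x; have on := tm_next' M o'x.
    have nS : nx x o' \in S by rewrite -(eO _ o') // e_sym.
    rewrite !inE xn andbT; case/or4P: (Sxy _ nS) => /eqP E; rewrite ?E ?eqxx ?orbT //.
      by rewrite E e_irr in xn.
    by have := B_nonadj Bxy; rewrite -E xn.
  rewrite -(card_in_imset (f := nx x)) ?subset_leq_card // => o1 o2 o1O o2O.
  by apply: (tm_inj M); rewrite eO.
have O2 : 2 <= #|O| by lia.
have full x y z w : x \in S -> (forall t, t \in S -> [|| t == x, t == y, t == z | t == w]) ->
    B x y -> e x z /\ e x w /\ #|O| <= 2.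
  move=> xS Sxy Bxy; have := link x y z w xS Sxy Bxy => h.
  have s2 : #|[set z; w]| <= 2 by rewrite cards2; case: (_ != _).
  have sI : #|[set z; w] :&: N x| <= #|[set z; w]| by exact/subset_leq_card/subsetIl.
  have /eqP/setP E : [set z; w] :&: N x == [set z; w].
    rewrite eqEcard subsetIl; exact: leq_trans s2 (leq_trans O2 h).
  have := E z; have := E w; rewrite !inE !eqxx ?orbT /= => -> ->; do 2 split=> //.
  exact: leq_trans h (leq_trans sI s2).
have Bpq := braces1 br; have Bcd := braces2 br.
have Bqp : B q p by rewrite B_sym.
have [pc [pd O2']] : e p c /\ e p d /\ #|O| <= 2.
  by apply: (full p q c d) => // t; rewrite SE.
have [qc [qd _]] : e q c /\ e q d /\ #|O| <= 2.
  by apply: (full q p c d) => // t; rewrite SE orbCA.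
have /card_gt1P[o1 [o2 [o1O o2O o12]]] := O2.
have OE : O = [set o1; o2].
  apply/esym/eqP; rewrite eqEcard cards2 o12 O2' andbT.
  by apply/subsetP => y; rewrite in_set2 => /orP[]/eqP->.
pose s := [:: p; c; o1; q; d; o2].
have all_s x : x \in s.
  case: (boolP (x \in S)) => [|xS].
    by rewrite SE /s !inE => /or4P[] ->; rewrite ?orbT.
  have : x \in O by rewrite inE.
  by rewrite OE in_set2 /s !inE => /orP[] ->; rewrite ?orbT.
apply: (isomorphic_pattern (s := s) (x0 := p) e_sym e_irr
  (rows := [:: (2, [:: 0; 3; 1; 4]); (5, [:: 0; 3; 1; 4])])
  (pairs := [:: (0, 3, false); (1, 4, false); (0, 1, true); (0, 4, true);
    (3, 1, true); (3, 4, true)]) (k1 := 0) (k2 := 3) (k3 := 1) (k4 := 4)) => //.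
- exact: uniq_of_card.
- by do 2 (split; first by move=> w; rewrite /= e_sym eO // SE !inE).
- by rewrite /= (negPf (B_nonadj Bpq)) (negPf (B_nonadj Bcd)) pc pd qc qd.
- by case: br.
Qed.

(** Each neighbour of [p] is joined to [p'] by an edge or a brace, and since [p] and [p'] are no
    twins, one of them, [z], by a brace. The other two are common neighbours; the third neighbour
    [w] of [p'] is adjacent to [z], and the links of [z] and [w] close up. *)
Lemma one_brace_bipyramids p p' c d : braces p p' c d -> deg3 p -> deg3 p' ->
  p != c -> p != d -> isomorphic base_III (BiGraph e B).
Proof.
move=> br p3 p'3 pc pd; have pp' := braces_neq br; have Bpp' := braces1 br.
have npp' := B_nonadj Bpp'.
have Bp w : B p w -> w = p'.
  have [-> _] := br => /orP[]/eqP/set2_eq[] [h1 h2] //; first by rewrite h1 eqxx in pp'.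
    by rewrite h1 eqxx in pc.
  by rewrite h1 eqxx in pd.
have Np x : e p x -> e x p' \/ B x p'.
  move=> px; have [w [pw xw Bw]] := irred px (deg3_simple M V5 p3 px).
  have [E|wp'] := eqVneq w p'; first by rewrite E in xw; apply/orP.
  have nBpw : ~~ B p w by apply: contra wp' => /Bp ->.
  rewrite (negPf nBpw) orbF in pw; rewrite (negPf nBpw) /= in Bw.
  have := B_nonadj Bw; rewrite (deg3_clique M V5 p3) ?inE //.
  by apply: contraTneq Bw => ->; rewrite B_irr.
have [z pz Bzp'] : exists2 z, e p z & B z p'.
  apply: NNPP => nz; apply: (no_twins p3 p'3 pp').
  apply/eqP; rewrite eqEcard p3 p'3 andbT; apply/subsetP => x; rewrite !inE => px.
  by case: (Np x px) => [|Bx]; [rewrite e_sym | case: nz; exists x].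
have zp : e z p by rewrite e_sym.
have {br c d pc pd} br : braces p p' p' z.
  have pz' := edge_neq e_irr pz; have [h n] := br; split.
    have := Bzp'; rewrite h => /orP[]/eqP; last by rewrite setUC => E x y; rewrite h E.
    by case/set2_eq => -[E _]; [rewrite E eqxx in pz' | rewrite E (negPf npp') in pz].
  by case/set2_eq => -[E1 E2]; [rewrite E1 eqxx in pp' | rewrite E1 eqxx in pz'].
have [x [y [[NpE zx zy xy] [px py ezx ezy exy]]]] := deg3_apex p3 pz.
have nz t : t != z -> e p t -> e p' t.
  move=> tz pt; case: (Np t pt) => [|]; first by rewrite e_sym.
  have pt' := edge_neq e_irr pt.
  have [-> _] := br => /orP[]/eqP/set2_eq[] [h1 h2].
  - by rewrite h1 eqxx in pt'.
  - by rewrite h1 (negPf npp') in pt.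
  - by rewrite h1 (negPf npp') in pt.
  - by rewrite h1 eqxx in tz.
have p'x : e p' x by apply: nz px; rewrite eq_sym.
have p'y : e p' y by apply: nz py; rewrite eq_sym.
have [w Np'E] : exists w, N p' :\ x :\ y = [set w].
  apply/cards1P; have := cardsD1 x (N p'); rewrite p'3 inE p'x add1n => -[E].
  by have := cardsD1 y (N p' :\ x); rewrite -E !inE p'y eq_sym xy add1n => -[<-].
have [wy [wx p'w]] : w != y /\ w != x /\ e p' w.
  by have := set11 w; rewrite -Np'E !inE => /and3P[].
have Np' t : e p' t = [|| t == x, t == y | t == w].
  have /setP/(_ t) := Np'E; rewrite !inE.
  have [->|tx] := eqVneq t x; first by rewrite p'x.
  have [->|ty] := eqVneq t y; first by rewrite p'y.
  by [].
have NpP t : e p t = [|| t == z, t == x | t == y] by have /setP/(_ t) := NpE; rewrite !inE.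
have wz : w != z by apply: contraTneq p'w => ->; rewrite e_sym; exact: B_nonadj.
have wp : w != p by apply: contraTneq p'w => ->; rewrite e_sym.
have wp' : w != p' by rewrite eq_sym (edge_neq e_irr p'w).
have nBw t : ~~ B w t.
  have [-> _] := br; apply/negP => /orP[]/eqP/set2_eq[] [h1 h2];
  by [rewrite h1 eqxx in wp | rewrite h1 eqxx in wp' | rewrite h1 eqxx in wz].
(* A brace in a 3-cycle through [p'w] goes from [p'] to [p] or [z], and [w] is not adjacent to
   [p]. *)
have ewz : e w z.
  have [t [_ wt Bt]] := irred p'w (deg3_simple M V5 p'3 p'w).
  rewrite (negPf (nBw t)) orbF in wt; rewrite (negPf (nBw t)) orbF in Bt.
  have [h _] := br; move: Bt; rewrite h => /orP[]/eqP/set2_eq[] [h1 h2].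
  - by rewrite h1 eqxx in pp'.
  - by move: wt; rewrite h2 e_sym NpP (negPf wx) (negPf wy) (negPf wz).
  - by rewrite -h2.
  - by rewrite -h1 B_irr in Bzp'.
have [ewx ewy] : e w x /\ e w y by split; apply: (deg3_clique M V5 p'3); rewrite ?inE.
have ezw : e z w by rewrite e_sym.
have wp'e : e w p' by rewrite e_sym.
(* A triangle through [z] and [w] separating [p] from [p'] would also contain
   their common neighbours [x] and [y]. *)
have szw : simple z w.
  case: (simple_or_cut M V5 ezw) => // -[T [A [cA zT wT]]]; exfalso.
  have pz_x t : deg3 t -> t \notin T -> t = p \/ t = p'.
    move=> t3 tT; have := deg3_ends br t3; rewrite !inE => /or4P[]/eqP; auto => E.
    by rewrite E zT in tT.
  have cA' := cut_compl M cA; have [T3 Tcl _ _ Acl] := cA; have [_ _ _ _ Acl'] := cA'.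
  have [s1 [s1A s13 _]] := cut_deg3 br cA; have [s2 [s2A s23 _]] := cut_deg3 br cA'.
  have s1T := (Acl _ s1A).1; have s2T := (Acl' _ s2A).1.
  have xyT t : e p t -> e p' t -> t \in T.
    move=> pt p't; have [s1t s2t] : e s1 t /\ e s2 t.
      by case: (pz_x _ s13 s1T) => ->; case: (pz_x _ s23 s2T) => ->.
    have := (Acl _ s1A).2 _ s1t; have := (Acl' _ s2A).2 _ s2t; rewrite !inE.
    by case: (t \in T); rewrite ?orbT ?orbF //= => /negPf ->.
  have : #|z |: (w |: [set x; y])| <= #|T|.
    apply: subset_leq_card; apply/subsetP => t; rewrite !inE => /or4P[]/eqP-> //; exact: xyT.
  by rewrite T3 !cardsU1 cards1 !inE !negb_or wx wy xy zx zy [z == w]eq_sym wz.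
have Nz := four_link zp ezw ezx ezy px py ewx ewy _ xy
  (simple_sym (deg3_simple M V5 p3 pz)) szw.
have p'z : p' != z by apply: contraTneq Bzp' => ->; rewrite B_irr.
have Nw := four_link wp'e ewz ewx ewy p'x p'y ezx ezy p'z xy
  (simple_sym (deg3_simple M V5 p'3 p'w)) (simple_sym szw).
have {}Nz := Nz _; rewrite eq_sym in wp; have {}Nz := Nz wp.
pose s := [:: w; p'; x; z; y; p].
have all_s t : t \in s.
  have : t \in (p |: (p' |: [set z; w])) :|: [set x; y].
    apply: (@three_connected _ _ _ M V5 _ _ p).
    - by rewrite cards2; case: (_ != _).
    - by rewrite !inE eqxx.
    - move=> a; rewrite !inE negb_or => /or4P[]/eqP->.
      + by rewrite (edge_neq e_irr px) (edge_neq e_irr py).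
      + by rewrite (edge_neq e_irr p'x) (edge_neq e_irr p'y).
      + by rewrite zx zy.
      + by rewrite wx wy.
    - move=> a b; rewrite !inE => /or4P[]/eqP->.
      + by rewrite NpP => /or3P[] ->; rewrite ?orbT.
      + by rewrite Np' => /or3P[] ->; rewrite ?orbT.
      + by move/Nz; rewrite !inE => /or4P[] ->; rewrite ?orbT.
      + by move/Nw; rewrite !inE => /or4P[] ->; rewrite ?orbT.
  by rewrite /s !inE => /orP[/or4P[]|/orP[]] ->; rewrite ?orbT.
apply: (isomorphic_pattern (s := s) (x0 := p) e_sym e_irr
  (rows := [:: (1, [:: 2; 4; 0]); (5, [:: 3; 2; 4])])
  (pairs := [:: (0, 2, true); (0, 3, true); (0, 4, true); (2, 3, true);
    (2, 4, true); (3, 4, true)]) (k1 := 5) (k2 := 1) (k3 := 1) (k4 := 3)) => //.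
- exact: uniq_of_card.
- by split; [move=> t; rewrite /= Np' !inE | split=> // t; rewrite /= NpP !inE].
- by rewrite /= ewx ewz ewy exy [e x z]e_sym ezx ezy.
- by case: br.
Qed.

(** * Two braces, each with just one end of degree 3 *)

Record two_apexes p q p' q' : Prop := TwoApexes {
  ta_braces : braces p q p' q';
  ta_deg3 : deg3 p;
  ta_deg3' : deg3 p';
  ta_ndeg3 : ~ deg3 q;
  ta_ndeg3' : ~ deg3 q';
  ta_neq : p != p';
  ta_nadj : ~~ e p p' }.

Lemma two_apexesC p q p' q' : two_apexes p q p' q' -> two_apexes p' q' p q.
Proof.
by case=> br p3 p'3 q3 q'3 pp' npp'; split; rewrite 1?eq_sym 1?e_sym //; exact: bracesC.
Qed.

Section TwoApexes.

Variables p q p' q' : V.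
Hypothesis H : two_apexes p q p' q'.

Let br := ta_braces H.
Let p3 := ta_deg3 H.
Let p'3 := ta_deg3' H.

Let Bpq : B p q. Proof. exact: braces1 br. Qed.
Let Bp'q' : B p' q'. Proof. exact: braces2 br. Qed.
Lemma ta_neq_end : p != q'.
Proof. by apply/eqP => E; apply: (ta_ndeg3' H); rewrite -E. Qed.
Lemma ta_neq_end' : p' != q.
Proof. by apply/eqP => E; apply: (ta_ndeg3 H); rewrite -E. Qed.

Lemma ta_B x y : B x y ->
  [\/ x = p /\ y = q, x = q /\ y = p, x = p' /\ y = q' | x = q' /\ y = p'].
Proof.
have [-> _] := br => /orP[]/eqP/set2_eq[] h.
- by constructor 1.
- by constructor 2.
- by constructor 3.
- by constructor 4.
Qed.

Lemma ta_Bp w : B p w -> w = q.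
Proof.
case/ta_B => -[h1 h2] //.
- by have := braces_neq br; rewrite h1 eqxx.
- by have := ta_neq H; rewrite h1 eqxx.
- by have := ta_neq_end; rewrite h1 eqxx.
Qed.

(** The edge [px] is simple, so it lies in a 3-cycle with a brace. This brace is [pq], since [p] has
    no other and two neighbours of [p] are adjacent. *)
Lemma apex_adj x : e p x -> e x q.
Proof.
move=> px; have [w [pw xw Bw]] := irred px (deg3_simple M V5 p3 px).
have nBpx : B x q -> False.
  case/ta_B => -[h1 h2].
  - by rewrite h1 e_irr in px.
  - by have := braces_neq br; rewrite h2 eqxx.
  - by rewrite h1 (negPf (ta_nadj H)) in px.
  - by have := ta_neq_end'; rewrite h2 eqxx.
have [E|wq] := eqVneq w q; first by rewrite E in xw; case/orP: xw => // /nBpx.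
have nBpw : ~~ B p w by apply: contra wq => /ta_Bp ->.
rewrite (negPf nBpw) orbF in pw; rewrite (negPf nBpw) /= in Bw.
have := B_nonadj Bw; rewrite (deg3_clique M V5 p3) ?inE //.
by apply: contraTneq Bw => ->; rewrite B_irr.
Qed.

Lemma ta_deg3P w : deg3 w -> w = p \/ w = p'.
Proof.
move=> w3; have := deg3_ends br w3; rewrite !inE => /or4P[]/eqP E; auto.
  by case: (ta_ndeg3 H); rewrite -E.
by case: (ta_ndeg3' H); rewrite -E.
Qed.

(** Both sides contain a vertex of degree 3, and [p] and [p'] are the only ones. *)
Lemma cut_orient T A : cut T A ->
  exists A', [/\ cut T A', p \in A' & p' \notin A' :|: T].
Proof.
move=> cA; have cA' := cut_compl M cA; have [_ _ _ _ Acl] := cA.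
have [s1 [s1A s13 _]] := cut_deg3 br cA; have [s2 [s2A s23 _]] := cut_deg3 br cA'.
have s1T := (Acl _ s1A).1.
have s12 : s1 != s2 by apply: contraTneq s2A => <-; rewrite !inE s1A.
case: (ta_deg3P s13) (ta_deg3P s23) => E1 [] E2; subst s1 s2; rewrite ?eqxx // in s12.
  by exists A; split=> //; rewrite inE in s2A.
exists (~: (A :|: T)); split=> //; by rewrite !inE s1A (negPf s1T).
Qed.

(** As long as some edge from [w] into [A] is not simple, a separating triangle through it has a
    side properly inside [A]; that side contains a vertex of degree 3, which can only be [p]. *)
Lemma innermost_cut w T A : cut T A -> w \in T -> p \in A -> p' \notin A :|: T ->
  exists T0 A0, [/\ cut T0 A0, w \in T0, p' \notin A0 :|: T0 &
    forall v, v \in A0 -> e w v -> simple w v].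
Proof.
have [n] := ubnP #|A|; elim: n T A => // n IH T A An cA wT pA p'A.
case: (boolP [exists v, [&& v \in A, e w v & ~~ simple w v]]) => [/existsP[v /and3P[vA wv
  ns]]|/existsPn all_s].
  case: (simple_or_cut M V5 wv) => [s|[T2 [A2 [c2 wT2 vT2]]]]; first by rewrite s in ns.
  have [A3 [c3 s v3]] := nested_cut M V5 cA vA c2 vT2.
  have p'3A : p' \notin A3 by apply: contra p'A => /(subsetP s); rewrite inE => ->.
  have [s1 [s1A s13 _]] := cut_deg3 br c3.
  have pA3 : p \in A3.
    case: (ta_deg3P s13) => E; first by rewrite -E.
    by rewrite E (negPf p'3A) in s1A.
  apply: (IH T2 A3) => //.
    apply: leq_trans (proper_card _) An; rewrite properE s; apply/subsetPn; by exists v.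
  have c3' := cut_compl M c3.
  have [s2 [s2A s23 _]] := cut_deg3 br c3'.
  case: (ta_deg3P s23) => E; first by rewrite E !inE pA3 in s2A.
  by rewrite E inE in s2A.
exists T, A; split=> // v vA wv; have := all_s v; by rewrite vA wv /= negbK.
Qed.

(** The brace of the 3-cycle ends at [p] or [p']. If this end is the third corner, the edge joins
    its brace partner to one of its neighbours. *)
Lemma braced_edge_apexes u v : e u v -> braced_edge u v ->
  [\/ (u \in [:: p; p']) || (v \in [:: p; p']),
      (u = q /\ e p v) \/ (v = q /\ e p u) |
      (u = q' /\ e p' v) \/ (v = q' /\ e p' u)].
Proof.
have main x y : e x y -> forall w, e y w || B y w -> B x w ->
  [\/ (x \in [:: p; p']) || (y \in [:: p; p']),
      (x = q /\ e p y) \/ (y = q /\ e p x) |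
      (x = q' /\ e p' y) \/ (y = q' /\ e p' x)].
  move=> xy w yw /ta_B[] [h1 h2]; subst x w.
  - by constructor 1; rewrite inE eqxx.
  - case/orP: yw => [yw|]; first by constructor 2; left; rewrite e_sym.
    by rewrite B_sym => /ta_Bp E; rewrite E e_irr in xy.
  - by constructor 1; rewrite !inE eqxx orbT.
  - case/orP: yw => [yw|/ta_B[] [h1 h2]]; first by constructor 3; left; rewrite e_sym.
    + by have := ta_neq_end'; rewrite h2 eqxx.
    + by have := ta_neq H; rewrite h2 eqxx.
    + by constructor 1; rewrite h1 !inE eqxx !orbT.
    + by rewrite h1 e_irr in xy.
move=> uv [w [uw vw /orP[Bu|Bv]]]; first exact: (main u v uv w).
have vu : e v u by rewrite e_sym.
case: (main v u vu w uw Bv) => h; [constructor 1|constructor 2|constructor 3].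
- by rewrite orbC.
- by case: h; auto.
- by case: h; auto.
Qed.

(** No edge at another vertex [w] lies in a 3-cycle with a brace, so none is simple; but an
    innermost separating triangle through [w] provides a simple one. *)
Lemma apexes_cover w : [|| w == p, w == p', w == q, w == q', e p w | e p' w].
Proof.
apply: contraT; rewrite !negb_or => /and5P[wp wp' wq wq' /andP[/negbTE epw /negbTE ep'w]].
exfalso; have bad v : e w v -> simple w v -> False.
  move=> wv s; case: (braced_edge_apexes wv (irred wv s)).
  - rewrite !inE (negPf wp) (negPf wp') /= => /orP[]/eqP E; rewrite E e_sym in wv.
      by rewrite wv in epw.
    by rewrite wv in ep'w.
  - by case=> -[E]; [rewrite E eqxx in wq | rewrite epw].
  - by case=> -[E]; [rewrite E eqxx in wq' | rewrite ep'w].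
have [v wv] := has_nbr M V5 w.
case: (simple_or_cut M V5 wv) => [/(bad _ wv) //|[T [A [cA wT _]]]].
have [A' [cA' pA' p'A']] := cut_orient cA.
have [T0 [A0 [c0 w0 _ s0]]] := innermost_cut cA' wT pA' p'A'.
have [v0 v0A wv0] := cut_nbr M V5 c0 w0.
exact: bad wv0 (s0 _ v0A wv0).
Qed.

End TwoApexes.

Section Corners.

Variables p q p' q' : V.
Hypothesis H : two_apexes p q p' q'.
Let H' := two_apexesC H.

(* Going around [w] from [p'], the innermost separating triangle through [w]
   leaves [q'] as the only neighbour of [w] on the side of [p]. *)
Lemma corner_nbrs w : e p' w -> ~~ e p w -> w != q ->
  forall t, e w t -> e p' t \/ t = p' \/ t = q'.
Proof.
move=> p'w npw wq; have p'3 := ta_deg3' H.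
have wp : w != p by apply: contraTneq p'w => ->; rewrite e_sym; exact: ta_nadj H.
have wp' : w != p' by rewrite eq_sym (edge_neq e_irr p'w).
have wq' : w != q'.
  by apply: contraTneq p'w => ->; apply: B_nonadj; exact: braces2 (ta_braces H).
have cK := deg3_cut M V5 p'3.
have wK : w \in N p' by rewrite inE.
have [A' [cA' pA' p'A']] := cut_orient H cK.
have [T0 [A0 [c0 w0 p'0 s0]]] := innermost_cut H cA' wK pA' p'A'.
have [v v0A wv] := cut_nbr M V5 c0 w0.
have sv := s0 v v0A wv.
have vE : v = q'.
  case: (braced_edge_apexes H wv (irred wv sv)).
  - rewrite !inE (negPf wp) (negPf wp') /= => /orP[]/eqP E.
      by rewrite E e_sym (negPf npw) in wv.
    by move: p'0; rewrite -E inE v0A.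
  - by case=> -[E]; [rewrite E eqxx in wq | rewrite (negPf npw)].
  - by case=> -[E] //; rewrite E eqxx in wq'.
have [y [z [[NE wy wz yz] [p'y p'z ewy ewz eyz]]]] := deg3_apex p'3 p'w.
have wp'e : e w p' by rewrite e_sym.
have adj := apex_adj H'.
have wq'e := adj w p'w.
have p'q' := braces_neq (bracesC (ta_braces H)).
rewrite vE in sv.
have q'y : e q' y by rewrite e_sym adj.
have q'z : e q' z by rewrite e_sym adj.
have Nw := four_link wp'e wq'e ewy ewz p'y p'z q'y q'z p'q' yz
  (simple_sym (deg3_simple M V5 p'3 p'w)) sv.
by move=> t /Nw; rewrite !inE => /or4P[]/eqP ->; auto.
Qed.

(** Otherwise [p'], [w1] and [w2] would have only the third neighbour [w3] of [p'] and [q'] as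
    further neighbours, giving five vertices in all. *)
Lemma corner_unique w1 w2 : e p' w1 -> ~~ e p w1 -> w1 != q ->
  e p' w2 -> ~~ e p w2 -> w2 != q -> w1 = w2.
Proof.
move=> p'w1 npw1 w1q p'w2 npw2 w2q; apply/eqP; apply: contraT => w12.
have p'3 := ta_deg3' H.
have N1 := corner_nbrs p'w1 npw1 w1q; have N2 := corner_nbrs p'w2 npw2 w2q.
have [w3 NE] : exists w3, N p' :\ w1 :\ w2 = [set w3].
  apply/cards1P; have := cardsD1 w1 (N p'); rewrite p'3 inE p'w1 add1n => -[E].
  by have := cardsD1 w2 (N p' :\ w1); rewrite -E !inE p'w2 eq_sym w12 add1n => -[<-].
have p'E t : e p' t -> [|| t == w1, t == w2 | t == w3].
  move=> p't; have [//|t1] := eqVneq t w1; have [//|t2 /=] := eqVneq t w2.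
  by rewrite -in_set1 -NE !inE t1 t2.
have [w31 [w32 p'w3]] : w3 != w2 /\ w3 != w1 /\ e p' w3.
  by have := set11 w3; rewrite -NE !inE => /and3P[].
have nq' t : e p' t -> t != q'.
  move=> p't; apply: contraTneq p't => ->; apply: B_nonadj; exact: braces2 (ta_braces H).
suff : 5 < #|p' |: [set w1; w2]| + #|[set w3; q']|.
  by rewrite cardsU1 !cards2; case: (_ \notin _); case: (_ != _); case: (_ != _).
apply: (@small_closed _ _ p').
- by rewrite cards2; case: (_ != _).
- by rewrite !inE eqxx.
- move=> t; rewrite !inE negb_or => /or3P[]/eqP->.
  + by rewrite (edge_neq e_irr p'w3) (braces_neq (bracesC (ta_braces H))).
  + by rewrite eq_sym w32 nq'.
  + by rewrite eq_sym w31 nq'.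
- have fin t : e p' t \/ t = p' \/ t = q' ->
      [|| t == p', t == w1 | t == w2] || ((t == w3) || (t == q')).
    by case=> [/p'E/or3P[] ->|[] ->]; rewrite ?eqxx ?orbT.
  move=> s t; rewrite !inE => /or3P[]/eqP-> st; apply: fin; auto.
Qed.

End Corners.

(** * The overlaps that give the bases (II), (IV) and (V) *)

Lemma nbr_neq w a b : e w a -> ~~ e w b -> a != b.
Proof. by move=> wa; apply: contraNneq => <-. Qed.

Lemma deg3_eq w a b c : deg3 w -> e w a -> e w b -> e w c -> a != b -> a != c -> b != c ->
  forall t, e w t = [|| t == a, t == b | t == c].
Proof.
move=> w3 wa wb wc ab ac bc t.
have /eqP/setP/(_ t) : a |: [set b; c] == N w.
  rewrite eqEcard w3 cardsU1 cards2 !inE negb_or ab ac bc; apply/andP; split=> //.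
  by apply/subsetP => u; rewrite !inE => /or3P[]/eqP->.
by rewrite !inE => ->.
Qed.

Lemma deg3_four w a b c d : deg3 w -> e w a -> e w b -> e w c -> e w d ->
  a != b -> a != c -> b != c -> [|| d == a, d == b | d == c].
Proof. by move=> w3 wa wb wc wd ab ac bc; rewrite -(deg3_eq w3 wa wb wc). Qed.

Lemma nbrs_sub_deg3 w a b c : (forall t, e w t -> [|| t == a, t == b | t == c]) -> deg3 w.
Proof.
move=> h; apply/eqP; rewrite eqn_leq (nbrs_ge3 M V5) andbT.
apply: (@leq_trans #|a |: [set b; c]|).
  by apply: subset_leq_card; apply/subsetP => t; rewrite !inE; exact: h.
by rewrite cardsU1 cards2; case: (_ \notin _); case: (_ != _).
Qed.

(** As [p] and [p'] are no twins, their neighbours are [g], [x], [y] and [q], [x], [y]. If [q'] is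
    [g], this is (II). Otherwise [g] is not adjacent to [q'] by [corner_nbrs], and only [q], [x],
    [y] are left as neighbours of [q'], which has degree at least 4. *)
Lemma nested_apex p q p' q' : two_apexes p q p' q' ->
  (forall x, e p' x -> x = q \/ e p x) -> isomorphic base_II (BiGraph e B).
Proof.
move=> H sub; have H' := two_apexesC H; have p3 := ta_deg3 H; have p'3 := ta_deg3' H.
have br := ta_braces H; have Bpq := braces1 br; have Bp'q' := braces2 br.
have npq := B_nonadj Bpq; have np'q' := B_nonadj Bp'q'.
have NN : N p <> N p' by apply: no_twins => //; exact: ta_neq H.
have p'q : e p' q.
  apply: contraT => np'q; case: NN; apply/esym/eqP; rewrite eqEcard p3 p'3 andbT.
  apply/subsetP => x; rewrite !inE => p'x; case: (sub x p'x) => // E.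
  by rewrite -E p'x in np'q.
have [g pg np'g] : exists2 g, e p g & ~~ e p' g.
  have /subsetPn[g] : ~~ (N p \subset N p').
    by apply/negP => s; apply: NN; apply/eqP; rewrite eqEcard s p3 p'3.
  by rewrite !inE; exists g.
have [x [y [[NpE gx gy xy] [px py egx egy exy]]]] := deg3_apex p3 pg.
have pE t : e p t = [|| t == g, t == x | t == y] by have /setP/(_ t) := NpE; rewrite !inE.
have p'E t : e p' t = [|| t == q, t == x | t == y].
  have /eqP/setP/(_ t) : N p' == q |: [set x; y].
    rewrite eqEcard p'3 cardsU1 cards2; apply/andP; split; last by case: (_ \notin _);
      case: (_ != _).
    apply/subsetP => u; rewrite !inE => p'u; case: (sub u p'u) => [->|]; first by rewrite eqxx.
    rewrite pE => /orP[/eqP E|->]; last by rewrite orbT.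
    by rewrite E (negPf np'g) in p'u.
  by rewrite !inE.
have cover t := apexes_cover H t.
have adj := apex_adj H; have adj' := apex_adj H'.
have [q'g|q'g] := eqVneq q' g.
  subst g; pose s := [:: q'; p; x; q; y; p'].
  have all_s t : t \in s.
    have := cover t; rewrite pE p'E /s !inE.
    by do ?[case: (t == _); rewrite ?orbT //].
  apply: (isomorphic_pattern (s := s) (x0 := p) e_sym e_irr
    (rows := [:: (1, [:: 0; 2; 4]); (5, [:: 3; 2; 4])])
    (pairs := [:: (0, 2, true); (0, 3, true); (0, 4, true); (2, 3, true);
      (2, 4, true); (3, 4, true)]) (k1 := 1) (k2 := 3) (k3 := 5) (k4 := 0)) => //.
  - exact: uniq_of_card.
  - by split; [move=> t; rewrite /= pE !inE | split=> // t; rewrite /= p'E !inE].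
  - by rewrite /= egx egy exy !adj // [e q y]e_sym adj.
  - by case: br.
have q'q : q' != q by apply: contraNneq np'q' => ->.
have npq' : ~~ e p q'.
  rewrite pE (negPf q'g) /=; apply: contra np'q' => h; by rewrite p'E h orbT.
have pq' := ta_neq_end H.
have ngq' : ~~ e g q'.
  apply/negP => gq'; have gq'' : g != q' by rewrite eq_sym.
  case: (corner_nbrs H' pg np'g gq'' gq') => [h|[E|E]].
  - by rewrite h in npq'.
  - by rewrite E eqxx in pq'.
  - by rewrite E eqxx in q'q.
case: (ta_ndeg3' H); apply: (@nbrs_sub_deg3 q' q x y) => t q't.
have := cover t; rewrite pE p'E.
have -> : (t == p) = false by apply: contraNF npq' => /eqP <-; rewrite e_sym.
have -> : (t == p') = false by apply: contraNF np'q' => /eqP <-; rewrite e_sym.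
have -> : (t == q') = false by apply: contraTF q't => /eqP ->; rewrite e_irr.
have -> : (t == g) = false by apply: contraNF ngq' => /eqP <-; rewrite e_sym.
by do ?[case: (t == _); rewrite ?orbT //].
Qed.

(** Unless [nested_apex] applies, [p] has exactly one private neighbour [z] other than [q'], and
    [p'] exactly one, [z'], other than [q]. Their links are known from [corner_nbrs], and the
    position of [q'] decides the rest. *)
Lemma two_apexes_base p q p' q' : two_apexes p q p' q' ->
  isomorphic base_II (BiGraph e B) \/ isomorphic base_IV (BiGraph e B) \/
  isomorphic base_V (BiGraph e B).
Proof.
move=> H; have H' := two_apexesC H; have p3 := ta_deg3 H; have p'3 := ta_deg3' H.
have br := ta_braces H; have Bpq := braces1 br; have Bp'q' := braces2 br.
have npq := B_nonadj Bpq; have np'q' := B_nonadj Bp'q'.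
case: (boolP [exists t, [&& e p' t, t != q & ~~ e p t]]) => [/existsP[z' /and3P[p'z' z'q
  npz']]|/existsPn h];
  last first.
  left; apply: (nested_apex H) => t p't; have := h t; rewrite p't /= negb_and !negbK.
  by case/orP=> [/eqP|]; auto.
case: (boolP [exists t, [&& e p t, t != q' & ~~ e p' t]]) => [/existsP[z /and3P[pz zq'
  np'z]]|/existsPn h];
  last first.
  left; apply: (nested_apex H') => t pt; have := h t; rewrite pt /= negb_and !negbK.
  by case/orP=> [/eqP|]; auto.
right; have [x [y [[NpE zx zy xy] [px py ezx ezy exy]]]] := deg3_apex p3 pz.
have [x' [y' [[Np'E zx' zy' xy'] [p'x' p'y' ezx' ezy' exy']]]] := deg3_apex p'3 p'z'.
have pE := deg3_eq p3 pz px py zx zy xy.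
have in_p' t : e p t -> t != z -> t = q' \/ e p' t.
  move=> pt tz; have [|tq'] := eqVneq t q'; first by left.
  right; apply: contraT => np't; have := corner_unique H' pz np'z zq' pt np't tq'.
  by move=> E; rewrite E eqxx in tz.
have in_p t : e p' t -> t != z' -> t = q \/ e p t.
  move=> pt tz; have [|tq'] := eqVneq t q; first by left.
  right; apply: contraT => np't; have := corner_unique H p'z' npz' z'q pt np't tq'.
  by move=> E; rewrite E eqxx in tz.
have Nz := corner_nbrs H' pz np'z zq'.
have Nz' := corner_nbrs H p'z' npz' z'q.
have adj := apex_adj H; have adj' := apex_adj H'; have cover t := apexes_cover H t.
have pq := braces_neq br; have p'q' := braces_neq (bracesC br).
have pq' := ta_neq_end H.
have p'q := ta_neq_end' H.
have npp' := ta_nadj H; have np'p : ~~ e p' p by rewrite e_sym.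
have xz : x != z by rewrite eq_sym.
have yz : y != z by rewrite eq_sym.
have xz' := nbr_neq px npz'; have yz' := nbr_neq py npz'; have z_z' := nbr_neq pz npz'.
(* If [q'] is neither [q] nor a neighbour of [p], its degree forces the edge [qq']; only [x] and [y]
   can be common neighbours of its ends, so it is simple, yet it lies in no 3-cycle with a brace.
   The case [q' = q] gives (IV), and [q'] adjacent to [p] gives (V). *)
case: (boolP ((q' == q) || e p q')) => [|]; last first.
  rewrite negb_or => /andP[q'q npq']; exfalso.
  have p'x : e p' x by case: (in_p' x px xz) => // E; rewrite -E px in npq'.
  have p'y : e p' y by case: (in_p' y py yz) => // E; rewrite -E py in npq'.
  have np'q : ~~ e p' q.
    apply/negP => p'q_; have := deg3_four p'3 p'x p'y p'z' p'q_ xy xz' yz'.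
    rewrite ![q == _]eq_sym (negPf z'q) orbF => /orP[]/eqP E.
      by rewrite -E px in npq.
    by rewrite -E py in npq.
  have p'E := deg3_eq p'3 p'x p'y p'z' xy xz' yz'.
  have nzq' : ~~ e z q'.
    apply/negP => /Nz[h|[h|h]]; first by rewrite h in npq'.
      by rewrite h eqxx in pq'.
    by rewrite h eqxx in q'q.
  have Nq' t : e q' t -> [|| t == x, t == y, t == z' | t == q].
    move=> q't; have := cover t; rewrite pE p'E.
    have -> : (t == p) = false by apply: contraNF npq' => /eqP <-; rewrite e_sym.
    have -> : (t == p') = false by apply: contraNF np'q' => /eqP <-; rewrite e_sym.
    have -> : (t == q') = false by apply: contraTF q't => /eqP ->; rewrite e_irr.
    have -> : (t == z) = false by apply: contraNF nzq' => /eqP <-; rewrite e_sym.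
    by do ?[case: (t == _); rewrite ?orbT //].
  have q'q_adj : e q' q.
    apply: contraT => nq'q; case: (ta_ndeg3' H); apply: (@nbrs_sub_deg3 q' x y z') => t q't.
    have := Nq' t q't; have -> : (t == q) = false by apply: contraNF nq'q => /eqP <-.
    by rewrite orbF.
  have qq'_adj : e q q' by rewrite e_sym.
  have common t : e q t -> e q' t -> (t == x) || (t == y).
    move=> qt /Nq'.
    have -> : (t == q) = false by apply: contraTF qt => /eqP ->; rewrite e_irr.
    have -> : (t == z') = false.
      apply: contraTF qt => /eqP ->; rewrite e_sym; apply/negP => /Nz'[h|[h|h]].
      - by rewrite h in np'q.
      - by rewrite h eqxx in p'q.
      - by rewrite h eqxx in q'q.
    by rewrite !orbF.
  have sqq' : simple q q'.
    apply/forallP => t; apply/implyP => /andP[qt q't].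
    have ne := tm_apex_neq M V5 qq'_adj.
    have c1 := common _ (tm_next M q'q_adj) (tm_next' M q'q_adj).
    have c2 := common _ (tm_next' M qq'_adj) (tm_next M qq'_adj).
    have ct := common _ qt q't; case/orP: c1 c2 ct => /eqP E1 /orP[]/eqP E2 /orP[]/eqP E3;
    by rewrite E1 E2 ?eqxx // in ne *; rewrite E3 eqxx ?orbT.
  case: (braced_edge_apexes H qq'_adj (irred qq'_adj sqq')).
  - rewrite !inE ![q == _]eq_sym ![q' == _]eq_sym (negPf pq) (negPf p'q) (negPf pq') (negPf
    p'q') //.
  - by case=> -[E] //; [rewrite (negPf npq') | rewrite E eqxx in q'q].
  - by case=> -[E] //; [rewrite -E eqxx in q'q | rewrite (negPf np'q)].
have [q'q _|q'q /= pq'_adj] := eqVneq q' q.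
  left; subst q'.
  have p'x : e p' x by case: (in_p' x px xz) => // E; rewrite -E px in npq.
  have p'y : e p' y by case: (in_p' y py yz) => // E; rewrite -E py in npq.
  have p'E := deg3_eq p'3 p'x p'y p'z' xy xz' yz'.
  have zE t : e z t = [|| t == x, t == y, t == q | t == p].
    apply/idP/or4P => [zt|[]/eqP-> //]; last by rewrite e_sym.
      have := edge_neq e_irr zt; rewrite eq_sym => tz.
      case: (Nz t zt) => [|[->|->]]; rewrite ?eqxx.
      - rewrite pE (negPf tz) /= => /orP[] ->; by [constructor 1|constructor 2].
      - by constructor 4.
      - by constructor 3.
    exact: adj.
  have z'x : e z' x by apply: (deg3_clique M V5 p'3); rewrite ?inE // eq_sym.
  have z'y : e z' y by apply: (deg3_clique M V5 p'3); rewrite ?inE // eq_sym.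
  have z'E t : e z' t = [|| t == x, t == y, t == q | t == p'].
    apply/idP/or4P => [zt|[]/eqP-> //]; last by rewrite e_sym.
      have := edge_neq e_irr zt; rewrite eq_sym => tz.
      case: (Nz' t zt) => [|[->|->]]; rewrite ?eqxx.
      - rewrite p'E (negPf tz) orbF => /orP[] ->; by [constructor 1|constructor 2].
      - by constructor 4.
      - by constructor 3.
    exact: adj'.
  pose s := [:: x; z; y; z'; q; p; p'].
  have all_s t : t \in s.
    have := cover t; rewrite pE p'E /s !inE.
    by do ?[case: (t == _); rewrite ?orbT //].
  have us : uniq s.
    rewrite /s /= !inE !negb_or xz xy xz' (nbr_neq px npq) (nbr_neq px npp').
    rewrite zy z_z' zq' (nbr_neq pz npp') yz' (nbr_neq py npq) (nbr_neq py npp').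
    rewrite z'q (nbr_neq p'z' np'p) ![_ == p]eq_sym (negPf (edge_neq e_irr px)).
    rewrite (edge_neq e_irr pz) (edge_neq e_irr py) pq ![_ == p']eq_sym.
    by rewrite (edge_neq e_irr p'z') p'q' eq_sym (ta_neq H).
  apply: (isomorphic_pattern (s := s) (x0 := p) e_sym e_irr
    (rows := [:: (5, [:: 1; 0; 2]); (6, [:: 0; 2; 3]); (1, [:: 0; 2; 4; 5]); (3, [:: 0; 2; 4;
      6])])
    (pairs := [:: (0, 2, true); (0, 4, true); (2, 4, true)])
    (k1 := 5) (k2 := 4) (k3 := 6) (k4 := 4)) => //.
  - by do !split=> //; move=> t; rewrite /= ?pE ?p'E ?zE ?z'E !inE.
  - by rewrite /= exy !adj.
  - by case: br.
right.
(* One of [x] and [y] is [q']; from here on [y] names the other one. *)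
have [{xz yz xz' yz' zx zy NpE px py ezx ezy pE x y xy exy} y [py ezy eq'y yz [yq' pE]]] :
    exists y, [/\ e p y, e z y, e q' y, y != z & y != q' /\
      forall t, e p t = [|| t == z, t == q' | t == y]].
  move: pq'_adj; rewrite pE [q' == z]eq_sym (negPf zq') /= => /orP[]/eqP E; subst q'.
    by exists y; split=> //; split=> //; rewrite eq_sym.
  exists x; split; rewrite 1?[e y x]e_sym //; split=> // t; rewrite pE.
  by case: (t == z); rewrite //= orbC.
have ezq' : e z q' by apply: (deg3_clique M V5 p3); rewrite ?inE.
have p'y : e p' y by case: (in_p' y py yz) => // E; rewrite E eqxx in yq'.
(* Otherwise the two neighbours of [p'] besides [z'] would be neighbours of [p] too, in addition to
   [q'] and [z]. *)
have p'q_adj : e p' q.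
  apply: contraT => np'q; have x'z' : x' != z' by rewrite eq_sym.
  have y'z' : y' != z' by rewrite eq_sym.
  have px' : e p x' by case: (in_p x' p'x' x'z') => // E; rewrite -E p'x' in np'q.
  have py' : e p y' by case: (in_p y' p'y' y'z') => // E; rewrite -E p'y' in np'q.
  have := deg3_four p3 px' py' pq'_adj pz xy' (nbr_neq p'x' np'q') (nbr_neq p'y' np'q').
  rewrite (negPf zq') orbF => /orP[]/eqP E.
    by rewrite E p'x' in np'z.
  by rewrite E p'y' in np'z.
have yz' := nbr_neq py npz'; have yq := nbr_neq py npq; have zq := nbr_neq pz npq.
have zy : z != y by rewrite eq_sym.
have z'y : z' != y by rewrite eq_sym.
have qy : q != y by rewrite eq_sym.
have p'E := deg3_eq p'3 p'z' p'q_adj p'y z'q z'y qy.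
have ez'q : e z' q by apply: (deg3_clique M V5 p'3); rewrite ?inE.
have ez'y : e z' y by apply: (deg3_clique M V5 p'3); rewrite ?inE.
have zE t : e z t = [|| t == y, t == q', t == q | t == p].
  apply/idP/or4P => [zt|[]/eqP-> //]; last by rewrite e_sym.
    have := edge_neq e_irr zt; rewrite eq_sym => tz.
    case: (Nz t zt) => [|[->|->]]; rewrite ?eqxx.
    - rewrite pE (negPf tz) /= => /orP[] ->; by [constructor 2|constructor 1].
    - by constructor 4.
    - by constructor 3.
  exact: adj.
have z'E t : e z' t = [|| t == p', t == q', t == y | t == q].
  apply/idP/or4P => [zt|[]/eqP-> //]; first last.
  - exact: adj'.
  - by rewrite e_sym.
  - have := edge_neq e_irr zt; rewrite eq_sym => tz.
    case: (Nz' t zt) => [|[->|->]]; rewrite ?eqxx.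
    + rewrite p'E (negPf tz) /= => /orP[] ->; by [constructor 4|constructor 3].
    + by constructor 1.
    + by constructor 2.
pose s := [:: y; z; q'; p'; q; p; z'].
have all_s t : t \in s.
  have := cover t; rewrite pE p'E /s !inE.
  by do ?[case: (t == _); rewrite ?orbT //].
have us : uniq s.
  rewrite /s /= !inE !negb_or yz yq' (nbr_neq py npp') yq yz' zq' (nbr_neq pz npp') zq z_z'.
  rewrite q'q p'q (edge_neq e_irr p'z') ![_ == p]eq_sym (edge_neq e_irr py).
  rewrite (edge_neq e_irr pz) pq' (ta_neq H) pq [q' == p']eq_sym p'q'.
  by rewrite [q' == z']eq_sym (nbr_neq p'z' np'q') [q == z']eq_sym z'q eq_sym (nbr_neq p'z'
    np'p).
apply: (isomorphic_pattern (s := s) (x0 := p) e_sym e_irr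
  (rows := [:: (5, [:: 1; 2; 0]); (3, [:: 6; 4; 0]); (1, [:: 0; 2; 4; 5]); (6, [:: 3; 2; 0;
    4])])
  (pairs := [:: (0, 2, true); (0, 4, true); (2, 4, true)])
  (k1 := 5) (k2 := 4) (k3 := 3) (k4 := 2)) => //.
- by do !split=> //; move=> t; rewrite /= ?pE ?p'E ?zE ?z'E !inE.
- by rewrite /= [e y q']e_sym eq'y !adj.
- by case: br.
Qed.

Lemma irreducible_base p q c d : braces p q c d ->
  isomorphic base_I (BiGraph e B) \/ isomorphic base_II (BiGraph e B) \/
  isomorphic base_III (BiGraph e B) \/ isomorphic base_IV (BiGraph e B) \/
  isomorphic base_V (BiGraph e B).
Proof.
move=> br.
case: (classic (exists T A, cut T A)) => [[T [A cA]]|nocut]; last first.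
  by left; apply: (no_cut_octahedron br) => T A cA; apply: nocut; exists T, A.
case: (classic (exists u v, [/\ deg3 u, deg3 v & B u v])) => [[u [v [u3 v3 Buv]]]|noB].
  right; right; left; have [c' [d' bu]] := braces_of br Buv.
  (* If [u] also belongs to the other brace, then [v] does not, as the braces are distinct, and the
     roles of [u] and [v] are exchanged. *)
  case: (boolP ((u == c') || (u == d'))) => [uc|]; last first.
    by rewrite negb_or => /andP[uc ud]; exact: (one_brace_bipyramids bu).
  have Bvu : B v u by rewrite B_sym.
  have [uv n] := bu; apply: (one_brace_bipyramids (bracesCl bu) v3 u3).
    apply/eqP => E; case: n; case/orP: uc => /eqP E2.
      by have := braces_neq bu; rewrite E2 -E eqxx.
    by rewrite E2 -E setUC.
  apply/eqP => E; case: n; case/orP: uc => /eqP E2; first by rewrite E2 E.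
  by have := braces_neq bu; rewrite E2 -E eqxx.
have [x [xA x3 xS]] := cut_deg3 br cA.
have [y [yA y3 yS]] := cut_deg3 br (cut_compl M cA).
have [_ _ _ _ Acl] := cA.
have brace_end w : w \in ends p q c d -> exists v, B w v.
  have Bpq := braces1 br; have Bcd := braces2 br.
  rewrite !inE => /or4P[]/eqP->; [exists q|exists p|exists d|exists c] => //; by rewrite B_sym.
have [x' Bxx'] := brace_end x xS; have [y' Byy'] := brace_end y yS.
have [c' [d' bx]] := braces_of br Bxx'.
have xy : x != y by apply: contraTneq yA => <-; rewrite !inE xA.
have nx'3 : ~ deg3 x' by move=> x'3; apply: noB; exists x, x'.
have ny'3 : ~ deg3 y' by move=> y'3; apply: noB; exists y, y'.
have nxy : ~~ e x y by apply: contraTN yA => /((Acl x xA).2) h; rewrite inE negbK.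
have H : two_apexes x x' y y'.
  split=> //; have [h n] := bx; have := Byy'; rewrite h => /orP[]/eqP E; last first.
    by split; rewrite E.
  case/set2_eq: E => -[E _]; first by rewrite E eqxx in xy.
  by case: nx'3; rewrite -E.
by case: (two_apexes_base H) => [|[|]]; auto.
Qed.

End Irreducible.

(** * Induction *)

Lemma three_cycle_third (V : finType) (r : rel V) (T : {set V}) u v :
  T \in three_cycles r -> u != v -> [set u; v] \subset T ->
  exists w, [/\ T = u |: (v |: [set w]), w != u, w != v, r u w & r v w].
Proof.
rewrite inE => /andP[/eqP T3 /forall_inP Tr] uv /subsetP s.
have uT : u \in T by rewrite s // !inE eqxx.
have vT : v \in T by rewrite s // !inE eqxx orbT.
have adj x y : x \in T -> y \in T -> x != y -> r x y.
  by move=> xT yT xy; have /forall_inP/(_ y yT)/implyP := Tr x xT; exact.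
have [w Tw] : exists w, T :\ u :\ v = [set w].
  apply/cards1P; have := cardsD1 u T; rewrite T3 uT add1n => -[E].
  by have := cardsD1 v (T :\ u); rewrite -E !inE vT eq_sym uv add1n => -[<-].
have [wv [wu wT]] : w != v /\ w != u /\ w \in T.
  by have := set11 w; rewrite -Tw !inE => /and3P[].
exists w; split=> //; [|by apply: adj; rewrite // eq_sym|by apply: adj; rewrite // eq_sym].
rewrite -Tw; apply/setP => t; rewrite !inE.
have [->|tu] := eqVneq t u; first by rewrite uT.
by have [->|tv] := eqVneq t v; rewrite ?vT.
Qed.

Section Step.

Variables (V : finType) (G : braced_triangulation V).
Hypothesis hB : #|edges (brace G)| = 2.

Let e := adj (tri G).
Let B := brace G.
Let nx x y := rot (tri G) x y.
Let M : triangular_map e nx := triangulation_triangular_map (tri_max G).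
Let e_sym : symmetric e := tm_sym M.
Let e_irr : irreflexive e := tm_irr M.
Let B_sym : symmetric B := brace_sym G.
Let B_irr : irreflexive B := brace_irr G.
Let B_nonadj x y : B x y -> ~~ e x y := @brace_nonadj _ G x y.

(** Darts, oriented braces and the diagonal are disjoint sets of pairs. On n vertices this gives 6n
    - 12 + 4 + n <= n^2, which fails for n = 3, 4, 5. *)
Lemma two_braces_card : 5 < #|V|.
Proof.
have dB : #|dart B| = 4 by rewrite (card_darts B_sym B_irr) hB.
have : #|dart e| + #|dart B| + #|[set d : V * V | d.1 == d.2]| <= #|V| * #|V|.
  have disj (A A' : {set V * V}) : (forall d, d \in A -> d \notin A') ->
      #|A| + #|A'| = #|A :|: A'|.
    move=> h; rewrite -cardsUI (_ : A :&: A' = set0) ?cards0 ?addn0 //.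
    by apply/setP => d; rewrite !inE; apply/andP => -[/h/negPf ->].
  rewrite -card_prod -!(cardsE (dart _)).
  rewrite !disj ?max_card // => -[x y]; rewrite !inE /dart /=.
    case/orP=> [/(edge_neq e_irr) //|]; exact: edge_neq.
  by apply: contraTN => /B_nonadj.
have -> : #|[set d : V * V | d.1 == d.2]| = #|V|.
  rewrite -(card_codom (f := fun x : V => (x, x))); last by move=> x y [].
  apply: eq_card => -[x y]; rewrite inE /=; apply/eqP/codomP => [->|[z [-> ->]]] //.
  by exists y.
rewrite dB; have := tm_card M; have := tm_size M.
by move: #|V| #|dart e| => [|[|[|[|[|[|n]]]]]] m //; clear; lia.
Qed.

Let V6 := two_braces_card.
Let V5 : 4 < #|V| := ltnW V6.

Lemma brace_set_eq : exists p q c d, braces B p q c d.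
Proof.
have /eqP/cards2P[E1 [E2 [nE EE]]] := hB.
have /edgesP[p [q [_ E1E]]] : E1 \in edges (brace G) by rewrite EE !inE eqxx.
have /edgesP[c [d [_ E2E]]] : E2 \in edges (brace G) by rewrite EE !inE eqxx orbT.
exists p, q, c, d; split; last by apply/eqP; rewrite -E1E -E2E.
by move=> x y; rewrite -(mem_edges B_sym) EE !inE E1E E2E.
Qed.

Section Contract.

Variables u v : V.
Hypotheses (uv : e u v) (s_uv : simple e nx u v) (nb : ~ braced_edge e B u v).

Let u_v : u != v := edge_neq e_irr uv.
Let vu : e v u. Proof. by rewrite e_sym. Qed.

(** The 3-cycles through [uv] correspond to the common neighbours of [u] and [v], in the
    triangulation as in the braced graph. *)
Lemma simple_contractible : contractible G u v.
Proof.
split; first split=> //.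
  have -> : [set T in three_cycles e | [set u; v] \subset T] =
      [set u |: (v |: [set nx u v]); u |: (v |: [set nx v u])].
    apply/setP => T; rewrite !inE; apply/andP/orP => [[T3 s]|].
      have [|w [-> _ _ uw vw]] := @three_cycle_third _ e T u v _ u_v s; first by rewrite inE.
      by case: (simpleP s_uv uw vw) => ->; [left|right].
    have ok w : e u w -> e v w -> (#|u |: (v |: [set w])| == 3) &&
        [forall x in u |: (v |: [set w]), forall y in u |: (v |: [set w]), (x != y) ==> e x
          y] /\
        [set u; v] \subset u |: (v |: [set w]).
      move=> uw vw; split; last by apply/subsetP => t; rewrite !inE => /orP[] ->; rewrite ?orbT.
      rewrite !cardsU1 cards1 !inE negb_or u_v (edge_neq e_irr uw) (edge_neq e_irr vw) /=.
      apply/forall_inP => x; rewrite !inE => xT; apply/forall_inP => y; rewrite !inE => yT.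
      apply/implyP; move: xT yT; case/or3P=> /eqP-> /or3P[]/eqP->; rewrite ?eqxx //;
      by rewrite e_sym.
    case=> /eqP ->; apply: ok.
    - exact: (tm_next M).
    - exact: (tm_next' M).
    - exact: (tm_next' M).
    - exact: (tm_next M).
  rewrite cards2; suff -> : u |: (v |: [set nx u v]) != u |: (v |: [set nx v u]) by [].
  apply/eqP => /setP/(_ (nx u v)); rewrite !inE eqxx !orbT (negPf (tm_apex_neq M V5 uv)) orbF.
  rewrite ![nx u v == _]eq_sym (negPf (edge_neq e_irr (tm_next M vu))).
  by rewrite (negPf (edge_neq e_irr (tm_next' M vu))).
move=> T T3 s [x [y [xT yT Bxy]]]; apply: nb.
have [w [TE wu wv uw vw]] := three_cycle_third T3 u_v s.
exists w; split=> //; move: xT yT Bxy; rewrite TE !inE.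
have nBuv : B u v = false by apply: contraTF uv => /B_nonadj.
have nBvu : B v u = false by apply: contraTF vu => /B_nonadj.
rewrite -/B; case/or3P=> /eqP-> /or3P[]/eqP->; rewrite ?B_irr ?nBuv ?nBvu //;
  by [move->; rewrite ?orbT | rewrite B_sym => ->; rewrite ?orbT].
Qed.

Let cl := collapse M uv.

Lemma no_brace_fork w : (e u w || B u w) -> (e v w || B v w) -> B u w || B v w -> False.
Proof. by move=> h1 h2 h3; apply: nb; exists w. Qed.

(** If a brace were identified with another brace or edge, some vertex would be joined to both [u]
    and [v], at least once by a brace, and [uv] would lie in a 3-cycle with a brace. *)
Lemma brace_collapse_inj x y x' y' : B x y -> e x' y' || B x' y' ->
  cl x = cl x' -> cl y = cl y' -> x = x' /\ y = y'.
Proof.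
move=> Bxy exy' /collapse_eq cx /collapse_eq cy; move: Bxy exy'.
have nBuv : B u v = false by apply: contraTF uv => /B_nonadj.
have nBvu : B v u = false by apply: contraTF vu => /B_nonadj.
case: cx => [->|[-> ->]|[-> ->]]; case: cy => [->|[-> ->]|[-> ->]] //;
  rewrite ?B_irr ?nBuv ?nBvu // => Bxy exy'; exfalso.
- move: Bxy exy'; rewrite B_sym e_sym [B _ v]B_sym => Bxy exy'.
  by apply: (@no_brace_fork x') => //; rewrite Bxy ?orbT.
- move: Bxy exy'; rewrite B_sym e_sym [B _ u]B_sym => Bxy exy'.
  by apply: (@no_brace_fork x') => //; rewrite Bxy ?orbT.
- by apply: (@no_brace_fork y') => //; rewrite Bxy ?orbT.
- by apply: (@no_brace_fork y') => //; rewrite Bxy ?orbT.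
Qed.

Lemma contract_brace_nonadj x y :
  contract_rel u B x y -> ~~ contract_rel (v := v) u e x y.
Proof.
move=> /(contract_relP M uv)[x0 [y0 [Bxy cx cy]]]; apply/negP.
move=> /(contract_relP M uv)[x1 [y1 [exy cx' cy']]].
have [Ex Ey] := brace_collapse_inj Bxy (introT orP (or_introl exy))
  (etrans cx (esym cx')) (etrans cy (esym cy')).
by have := B_nonadj Bxy; rewrite Ex Ey exy.
Qed.

Lemma card_contract_brace : #|edges (contract_rel (v := v) u B)| = 2.
Proof.
have sym' : symmetric (contract_rel (v := v) u B) := contract_rel_sym u B_sym.
have irr' : irreflexive (contract_rel (v := v) u B) by move=> x; rewrite /contract_rel eqxx.
suff : #|dart (contract_rel (v := v) u B)| = #|dart B|.
  by rewrite (card_darts sym' irr') (card_darts B_sym B_irr) hB; lia.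
rewrite -(card_in_imset (f := fun d => (cl d.1, cl d.2)) (D := dart B)).
  apply: eq_card => -[x y]; apply/idP/imsetP => [/(contract_relP M uv)[x0 [y0 [Bxy cx cy]]]|].
    by exists (x0, y0) => //; rewrite /cl cx cy.
  case=> -[x0 y0] Bxy0 [-> ->]; have Bxy : B x0 y0 := Bxy0.
  apply: (contract_rel_collapse (uv := uv) B_sym Bxy).
  apply/eqP => /collapse_eq E; have nxy := B_nonadj Bxy; move: Bxy nxy.
  by case: E => [->|[-> ->]|[-> ->]] h1 h2;
    [rewrite B_irr in h1 | rewrite uv in h2 | rewrite vu in h2].
move=> [x y] [x' y'] Bxy Bxy' E.
have [/= xx' yy'] := brace_collapse_inj Bxy (introT orP (or_intror Bxy'))
  (congr1 fst E) (congr1 snd E).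
by rewrite xx' yy'.
Qed.

(** The sphere graph realising the contracted map has the same adjacency pointwise, so the identity
    is the isomorphism. *)
Lemma contraction_exists : exists G' : braced_triangulation {x : V | x != v},
  #|edges (brace G')| = 2 /\ isomorphic (contract G u v) G'.
Proof.
have [P Pmax PE] := triangular_map_sphere (contract_triangular_map M V5 uv s_uv).
have nonadj x y : contract_rel u B x y -> ~~ adj P x y.
  by rewrite PE; exact: contract_brace_nonadj.
have irr : irreflexive (contract_rel (v := v) u B) by move=> x; rewrite /contract_rel eqxx.
exists (BracedTriangulation Pmax (contract_rel_sym u B_sym) irr nonadj); split.
  exact: card_contract_brace.
by exists id; [exists id | move=> x y; rewrite /= PE].
Qed.

End Contract.

End Step.

Theorem theorem4p7 (V : finType) (G : braced_triangulation V)
  (hB : #|edges (brace G)| = 2) : constructible G.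
Proof.
have [n] := ubnP #|V|; elim: n V G hB => // n IH V G hB Vn.
have M := triangulation_triangular_map (tri_max G).
have V6 := two_braces_card hB.
case: (classic (exists u v, [/\ adj (tri G) u v,
    simple (adj (tri G)) (fun x y => rot (tri G) x y) u v &
    ~ braced_edge (adj (tri G)) (brace G) u v])) => [[u [v [uv s nb]]]|none].
  have [G' [hB' iso]] := contraction_exists hB uv s nb.
  apply: (@constructible_split _ _ G').
    apply: IH hB' _; have := card_contract_type (ltnW V6) v; rewrite /reverse_coercion.
    by move: Vn; rewrite ltnS => h E; rewrite -ltnS E.
  by exists u, v; split=> //; exact: (simple_contractible hB).
apply: constructible_base; have [p [q [c [d br]]]] := brace_set_eq hB.
apply: (irreducible_base M V6 (brace_sym G) (brace_irr G) (@brace_nonadj _ G) _ br).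
by move=> u v uv s; apply: NNPP => nb; apply: none; exists u, v.
Qed.
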